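(* Consider the hybrid mechanical system, cost function $\psi$, canonical state $x=[q^T\ v^T\ \rho^T\ z^T]^T\in\mathbb{R}^{2n+p+n_c}$ and adjoint sensitivity matrix $\lambda(t,\rho)=\left(\frac{d\psi}{dx(t,\rho)}\right)^T\in\mathbb{R}^{(2n+p+n_c)\times n_c}$ described in the context. Let $t_{\rm eve}\in(t_0,t_F)$ be a time of event, with event function $r$ and velocity jump function $h$. Let $$\lambda|_{t_{\rm eve}}^{\pm}=\left[(\lambda^{Q}|_{t_{\rm eve}}^{\pm})^T\ \ (\lambda^{V}|_{t_{\rm eve}}^{\pm})^T\ \ (\lambda^{\Gamma}|_{t_{\rm eve}}^{\pm})^T\ \ (\lambda^{Z}|_{t_{\rm eve}}^{\pm})^T\right]^T$$ be the adjoint sensitivities right after ($+$) and right before ($-$) the event, with blocks $\lambda^Q|_{t_{\rm eve}}^{\pm},\lambda^V|_{t_{\rm eve}}^{\pm}\in\mathbb{R}^{n\times n_c}$, $\lambda^\Gamma|_{t_{\rm eve}}^{\pm}\in\mathbb{R}^{p\times n_c}$, $\lambda^Z|_{t_{\rm eve}}^{\pm}\in\mathbb{R}^{n_c\times n_c}$. Then $$\lambda|_{t_{\rm eve}}^{-}=\mathsf{S}_{\rm eve}^{T}\cdot\lambda|_{t_{\rm eve}}^{+}\in\mathbb{R}^{(2n+p+n_c)\times n_c},$$ where $\mathsf{S}_{\rm eve}$ is the generalized sensitivity jump matrix $$\mathsf{S}_{\rm eve}=\begin{bmatrix} A & 0_{n\times n} & 0_{n\times p} & 0_{n\times n_c}\\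 B & h_v^- & h_\rho^- & 0_{n\times n_c}\\ 0_{p\times n} & 0_{p\times n} & I_{p\times p} & 0_{p\times n_c}\\ G & 0_{n_c\times n} & 0_{n_c\times p} & I_{n_c\times n_c}\end{bmatrix}$$ with blocks $$A=I_{n\times n}+(v^+-v^-)\,\frac{r_q}{r_q\cdot v^-}\in\mathbb{R}^{n\times n},$$ $$B=h_q^- -\left(h_q^-\,v^- -\ddot q^{+}+h_v^-\,\ddot q^{-}+h_t^-\right)\frac{r_q}{r_q\cdot v^-}\in\mathbb{R}^{n\times n},$$ $$G=(\tilde g^{+}-\tilde g^{-})\,\frac{r_q}{r_q\cdot v^-}\in\mathbb{R}^{n_c\times n}.$$ Here $r_q=\frac{dr}{dq}(q|_{t_{\rm eve}})\in\mathbb{R}^{1\times n}$; $v^\pm$, $\ddot q^\pm$, $\tilde g^\pm$ are the velocity, acceleration and trajectory cost function right after/before the event; and $h_t^-,h_q^-,h_v^-,h_\rho^-$ are the partial Jacobians of $h(t,q,v,\rho)$ evaluated at $(t_{\rm eve},q|_{t_{\rm eve}},v^-,\rho)$.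
   Context: **Smooth dynamics.** $q\in\mathbb{R}^n$ are generalized positions, $v=\dot q\in\mathbb{R}^n$ generalized velocities, $\rho\in\mathbb{R}^p$ time-independent parameters. Away from events the system obeys $\mathsf{M}(t,q,\rho)\,\ddot q=\mathsf{F}(t,q,\dot q,\rho)$, with $\mathsf{M}$ smooth and invertible, i.e. $\dot v=f^{\rm eom}(t,q,v,\rho):=\mathsf{M}^{-1}\mathsf{F}$, for $t_0\le t\le t_F$, with initial conditions $q(t_0)=q_0(\rho)$, $\dot q(t_0)=v_0(\rho)$. All functions are smooth. **Cost function.** $\psi=\int_{t_0}^{t_F}\tilde g(\tau,q,v,\rho)\,d\tau+\tilde w(t_F,q(t_F),v(t_F),\rho)\in\mathbb{R}^{n_c}$, where $\tilde g,\tilde w:\mathbb{R}^{1+2n+p}\to\mathbb{R}^{n_c}$. The functions $\tilde g,\tilde w$ may come from functions that also depend on the acceleration $\dot v$ and on quantities $u(t,q,v,\dot v,\rho)$, after substituting $\dot v=f^{\rm eom}(t,q,v,\rho)$ for the dynamics active at that time. **Canonical state.** The quadrature variable $z\in\mathbb{R}^{n_c}$ satisfies $\dot z=\tilde g(t,q,v,\rho)$, $z(t_0)=0$, so that $\psi=z(t_F)+\tilde w(t_F,q(t_F),v(t_F),\rho)$. The canonical state $x=[q^T\ v^T\ \rho^T\ z^T]^T$ satisfies, between events, $\dot q=v$, $\dot v=f^{\rm eom}(t,q,v,\rho)$, $\dot\rho=0$, $\dot z=\tilde g(t,q,v,\rho)$. **Events.** The trajectory is piecewise smooth in time, with finitely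 many events (no Zeno behavior). An event occurs at a time $t_{\rm eve}$ when $r(q|_{t_{\rm eve}})=0$, where $r:\mathbb{R}^n\to\mathbb{R}$ is a smooth event function. Grazing is excluded: $\frac{dr}{dq}(q|_{t_{\rm eve}})\cdot v^-\ne0$. For any quantity $y$, $y|_{t_{\rm eve}}^{-}=\lim_{\varepsilon\downarrow0}y(t_{\rm eve}-\varepsilon)$ and $y|_{t_{\rm eve}}^{+}=\lim_{\varepsilon\downarrow0}y(t_{\rm eve}+\varepsilon)$; $v^\pm=v|_{t_{\rm eve}}^\pm$. At an event: - $q$ and $z$ are continuous (and $\rho$ is constant); - the velocity jumps by $v^+=h(t_{\rm eve},q|_{t_{\rm eve}},v^-,\rho)$, with $h$ a smooth $\mathbb{R}^n$-valued jump function; - the equations of motion may change from $f^{{\rm eom}-}$ to $f^{{\rm eom}+}$; the accelerations are $\ddot q^{-}=f^{{\rm eom}-}(t_{\rm eve},q|_{t_{\rm eve}},v^-,\rho)$ and $\ddot q^{+}=f^{{\rm eom}+}(t_{\rm eve},q|_{t_{\rm eve}},v^+,\rho)$; - $\tilde g^{\pm}:=\tilde g(t_{\rm eve},q|_{t_{\rm eve}},v^\pm,\rho)$ is the trajectory cost function right after/before the event. Different events may have different $r$, $h$ and changes of the equations of motion. Sufficiently small perturbations of the state undergo the same sequence of events. **Adjoint sensitivities.** For $t$ not an event time, $\frac{d\psi}{dx(t,\rho)}\in\mathbb{R}^{n_c\times(2n+p+n_c)}$ is the derivative of $\psi=z(t_F)+\tilde w(t_F,q(t_F),v(t_F),\rho)$,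 viewed as a function of the canonical state $x(t)$ at time $t$ through the hybrid evolution from $t$ to $t_F$ (all components of $x(t)$ being varied independently), evaluated along the trajectory. The adjoint is $\lambda(t,\rho)=\left(\frac{d\psi}{dx(t,\rho)}\right)^T$, with blocks $\lambda^Q,\lambda^V,\lambda^\Gamma,\lambda^Z$ corresponding to $q,v,\rho,z$. *)

(* Defs.v *)
(* MathComp / MathComp-Analysis. *)
From HB Require Import structures.
From mathcomp Require Import all_boot all_order all_algebra.
From mathcomp Require Import all_classical all_reals all_analysis.
Set Implicit Arguments.
Unset Strict Implicit.
Unset Printing Implicit Defensive.
Import Order.TTheory GRing.Theory Num.Theory numFieldNormedType.Exports.
Local Open Scope classical_set_scope.
Local Open Scope ring_scope.

(* C^k by recursion on directional derivatives; on the finite-dimensional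
   spaces used below this is the usual C^k. *)
Fixpoint is_Ck (R : realType) (V W : normedModType R) (k : nat) (f : V -> W) :
    Prop :=
  if k is k'.+1 then
    (forall x, differentiable f x) /\
    (forall v, is_Ck k' (fun x => ('d f x : V -> W) v))
  else continuous f.

Definition smooth (R : realType) (V W : normedModType R) (f : V -> W) : Prop :=
  forall k, is_Ck k f.

(* Jacobian for column vectors, (jac f x) i j = d f_i / d x_j.  The library's
   'J is the transposed matrix, for row vectors. *)
Definition jac (R : realType) (m n : nat) (f : 'cV[R]_n -> 'cV[R]_m)
    (x : 'cV[R]_n) : 'M[R]_(m, n) :=
  \matrix_(i, j) ('d f x : 'cV[R]_n -> 'cV[R]_m) (delta_mx j 0) i 0.

Definition grad_row (R : realType) (n : nat) (r : 'cV[R]_n -> R)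
    (x : 'cV[R]_n) : 'rV[R]_n :=
  \row_j ('d r x : 'cV[R]_n -> R) (delta_mx j 0).

Definition left_lim (R : realType) (V : normedModType R) (y : R -> V) (t : R) :
    V :=
  lim (y s @[s --> t^'-]).

Definition right_lim (R : realType) (V : normedModType R) (y : R -> V) (t : R) :
    V :=
  lim (y s @[s --> t^'+]).

(* The events met on [t0, tF] are numbered 0, ..., nevents - 1.  Mode i is the
   phase preceding event i (after event i - 1); mode nevents is the last one.
   Only modes i <= nevents and events i < nevents are ever used.
   The running cost depends on the mode because it may have been obtained by
   substituting the acceleration of the dynamics active in that mode. *)
Record hybrid_system (R : realType) (n p nc : nat) := HybridSystem {
  t0 : R;
  tF : R;
  q_init : 'cV[R]_p -> 'cV[R]_n;
  v_init : 'cV[R]_p -> 'cV[R]_n;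
  nevents : nat;
  mass : nat -> R -> 'cV[R]_n -> 'cV[R]_p -> 'M[R]_n;
  force : nat -> R -> 'cV[R]_n -> 'cV[R]_n -> 'cV[R]_p -> 'cV[R]_n;
  run_cost : nat -> R -> 'cV[R]_n -> 'cV[R]_n -> 'cV[R]_p -> 'cV[R]_nc;
  end_cost : R -> 'cV[R]_n -> 'cV[R]_n -> 'cV[R]_p -> 'cV[R]_nc;
  event_fun : nat -> 'cV[R]_n -> R;
  jump : nat -> R -> 'cV[R]_n -> 'cV[R]_n -> 'cV[R]_p -> 'cV[R]_n
}.

Section HybridSystem.
Context {R : realType} {n p nc : nat}.
Variable H : hybrid_system R n p nc.

Definition smooth_tqvr (m : nat)
    (f : R -> 'cV[R]_n -> 'cV[R]_n -> 'cV[R]_p -> 'cV[R]_m) : Prop :=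
  smooth (fun y : R * 'cV[R]_n * 'cV[R]_n * 'cV[R]_p =>
    f y.1.1.1 y.1.1.2 y.1.2 y.2).

Record smooth_system : Prop := SmoothSystem {
  smooth_q_init : smooth (q_init H);
  smooth_v_init : smooth (v_init H);
  smooth_mass : forall i,
    smooth (fun y : R * 'cV[R]_n * 'cV[R]_p => mass H i y.1.1 y.1.2 y.2);
  mass_unit : forall i t q rho, mass H i t q rho \in unitmx;
  smooth_force : forall i, smooth_tqvr (force H i);
  smooth_run_cost : forall i, smooth_tqvr (run_cost H i);
  smooth_end_cost : smooth_tqvr (end_cost H);
  smooth_event_fun : forall i, smooth (event_fun H i);
  smooth_jump : forall i, smooth_tqvr (jump H i)
}.

Definition feom (i : nat) (t : R) (q v : 'cV[R]_n) (rho : 'cV[R]_p) :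
    'cV[R]_n :=
  invmx (mass H i t q rho) *m force H i t q v rho.

(* Canonical state x = [q; v; rho; z]. *)
Definition state := 'cV[R]_(n + (n + (p + nc))).

Definition mk_state (q v : 'cV[R]_n) (rho : 'cV[R]_p) (z : 'cV[R]_nc) : state :=
  col_mx q (col_mx v (col_mx rho z)).

Definition pos (x : state) : 'cV[R]_n := usubmx x.
Definition vel (x : state) : 'cV[R]_n := usubmx (dsubmx x).
Definition par (x : state) : 'cV[R]_p := usubmx (dsubmx (dsubmx x)).
Definition quad (x : state) : 'cV[R]_nc := dsubmx (dsubmx (dsubmx x)).

Definition canonical_rhs (i : nat) (t : R) (x : state) : state :=
  mk_state (vel x) (feom i t (pos x) (vel x) (par x)) 0
           (run_cost H i t (pos x) (vel x) (par x)).

Definition mode_start (s : R) (k : nat) (te : nat -> R) (i : nat) : R :=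
  if i == k then s else te i.-1.

Definition mode_end (te : nat -> R) (i : nat) : R :=
  if (i < nevents H)%N then te i else tF H.

(* Only the one-sided limits of the velocity matter at an event time; its value
   there is left unspecified. *)
Definition event_transition (i : nat) (t : R) (x : R -> state) : Prop :=
  [/\ event_fun H i (pos (x t)) = 0,
      {for t, continuous (fun s => pos (x s))},
      {for t, continuous (fun s => par (x s))},
      {for t, continuous (fun s => quad (x s))} &
      cvg (vel (x s) @[s --> t^'-]) /\
      vel (x s) @[s --> t^'+] -->
        jump H i t (pos (x t)) (left_lim (fun s => vel (x s)) t) (par (x t))].

(* x is a hybrid trajectory on [s, tF], started at time s in mode k and
   undergoing events k, ..., nevents - 1 at the times te k < te k.+1 < ...;
   event i is triggered at the first zero of its event function in mode i. *)
Record hybrid_trajectory (s : R) (k : nat) (te : nat -> R) (x : R -> state) :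
    Prop := HybridTrajectory {
  ht_order : forall i, (k <= i <= nevents H)%N ->
    mode_start s k te i < mode_end te i;
  ht_start : x t @[t --> s^'+] --> x s;
  ht_ode : forall i, (k <= i <= nevents H)%N ->
    forall t, t \in `]mode_start s k te i, mode_end te i[ ->
    is_derive t (1 : R) x (canonical_rhs i t (x t));
  ht_armed : forall i, (k <= i < nevents H)%N ->
    forall t, t \in `]mode_start s k te i, te i[ ->
    event_fun H i (pos (x t)) != 0;
  ht_event : forall i, (k <= i < nevents H)%N -> event_transition i (te i) x;
  ht_end : x t @[t --> (tF H)^'-] --> x (tF H)
}.

Definition cost (x : R -> state) : 'cV[R]_nc :=
  quad (x (tF H)) +
  end_cost H (tF H) (pos (x (tF H))) (vel (x (tF H))) (par (x (tF H))).

(* psi as a function of the canonical state y at time s (in mode k), through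
   the hybrid evolution from s to tF; 0 where there is no such evolution. *)
Definition cost_to_go (s : R) (k : nat) (y : state) : 'cV[R]_nc :=
  xget 0 [set c | exists te x,
    [/\ hybrid_trajectory s k te x, x s = y & c = cost x]].

Section AlongTrajectory.
Variables (te : nat -> R) (x : R -> state).

Definition nominal_trajectory (rho : 'cV[R]_p) : Prop :=
  hybrid_trajectory (t0 H) 0 te x /\
  x (t0 H) = mk_state (q_init H rho) (v_init H rho) rho 0.

Definition event_free (t : R) : Prop :=
  forall i, (i < nevents H)%N -> t != te i.

Definition mode_at (t : R) : nat := (\sum_(i < nevents H) (te i < t)%R)%N.

(* Small perturbations of the state at a non-event time t undergo the same
   remaining events, at times close to the nominal ones. *)
Definition stable_event_sequence : Prop :=
  forall (t e : R), t \in `]t0 H, tF H[ -> event_free t -> 0 < e ->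
  \forall y \near x t, exists te' x',
    [/\ hybrid_trajectory t (mode_at t) te' x', x' t = y &
        forall i, (mode_at t <= i < nevents H)%N -> `|te' i - te i| < e].

Definition cost_to_go_at (t : R) : state -> 'cV[R]_nc :=
  cost_to_go t (mode_at t).

Definition adjoint (t : R) : 'M[R]_(n + (n + (p + nc)), nc) :=
  (jac (cost_to_go_at t) (x t))^T.

Section AtEvent.
Variable i : nat.

Definition v_minus : 'cV[R]_n := left_lim (fun s => vel (x s)) (te i).
Definition v_plus : 'cV[R]_n := right_lim (fun s => vel (x s)) (te i).

Let t := te i.
Let q := pos (x t).
Let rho := par (x t).

Definition r_q : 'rV[R]_n := grad_row (event_fun H i) q.
Definition r_q_v_minus : R := (r_q *m v_minus) 0 0.

Definition acc_minus : 'cV[R]_n := feom i t q v_minus rho.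
Definition acc_plus : 'cV[R]_n := feom i.+1 t q v_plus rho.
Definition g_minus : 'cV[R]_nc := run_cost H i t q v_minus rho.
Definition g_plus : 'cV[R]_nc := run_cost H i.+1 t q v_plus rho.

Definition h_t : 'cV[R]_n := (fun t' => jump H i t' q v_minus rho)^`()%classic t.
Definition h_q : 'M[R]_n := jac (fun q' => jump H i t q' v_minus rho) q.
Definition h_v : 'M[R]_n := jac (fun v' => jump H i t q v' rho) v_minus.
Definition h_rho : 'M[R]_(n, p) := jac (fun rho' => jump H i t q v_minus rho') rho.

Definition r_q_normalized : 'rV[R]_n := r_q_v_minus^-1 *: r_q.

Definition jump_A : 'M[R]_n := 1%:M + (v_plus - v_minus) *m r_q_normalized.

Definition jump_B : 'M[R]_n :=
  h_q - (h_q *m v_minus - acc_plus + h_v *m acc_minus + h_t) *m r_q_normalized.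

Definition jump_G : 'M[R]_(nc, n) := (g_plus - g_minus) *m r_q_normalized.

Definition jump_matrix :
    'M[R]_(n + (n + (p + nc)), n + (n + (p + nc))) :=
  col_mx   (row_mx jump_A (row_mx 0   (row_mx 0     0)))
  (col_mx  (row_mx jump_B (row_mx h_v (row_mx h_rho 0)))
  (col_mx  (row_mx 0      (row_mx 0   (row_mx 1%:M  0)))
           (row_mx jump_G (row_mx 0   (row_mx 0     1%:M))))).

End AtEvent.

Definition no_grazing : Prop :=
  forall i, (i < nevents H)%N -> r_q_v_minus i != 0.

End AlongTrajectory.
End HybridSystem.

(* Main.v *)
(* Only pointwise Frechet differentiability is needed, and a map f between
   column vectors is differentiable at x as soon as, for every c > 0, some matrix
   M satisfies |f y - f x - M (y - x)| <= c |y - x| for y near x: by completeness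
   the matrices M converge as c tends to 0.  Such pairs (M, c) compose well.

   Between events, the time-s map of the flow is handled by cutting [t, s] into
   short steps (a Cousin-type induction): over a step of length d around (c, x0)
   the flow is approximated by 1 + d A with an error o(d), where A is the state
   derivative of the vector field at (c, x0).

   Across event i, from t slightly before te i to s slightly after it, let D be
   the shift of the event time.  Linearizing the event function along the
   trajectory gives D = - p v / (p g1) up to a small error, where v is the
   initial perturbation, p the differential of the event function and g1 the
   vector field before the event.  Substituting D into the first-order expansions
   of the motion before the event, of the jump and of the motion after it shows
   that the flow from t to s is approximated by the jump matrix, with an error
   c |v| where c tends to 0 as t and s tend to te i.

   Downward induction on the mode then gives the differentiability of the
   cost-to-go.  Its Jacobian just after the event is Cauchy, hence has a limit L,
   and by the chain rule the Jacobian before the event tends to L times the jump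
   matrix. *)
Require Import Defs.
From HB Require Import structures.
From mathcomp Require Import all_boot all_order all_algebra.
From mathcomp Require Import all_classical all_reals all_analysis.
From mathcomp Require Import ring lra zify.
Set Implicit Arguments.
Unset Strict Implicit.
Unset Printing Implicit Defensive.
Import Order.TTheory GRing.Theory Num.Theory numFieldNormedType.Exports.
Local Open Scope classical_set_scope.
Local Open Scope ring_scope.

(** * Estimates for curves *)

(** The variational equation is never solved, and neither an existence theorem for differential
    equations nor an implicit function theorem is invoked: [stable_event_sequence] already supplies
    the perturbed trajectories together with their event times, so that only estimates remain. The
    flow and the cost-to-go are picked by [xget]; they are determined because hybrid trajectories
    are unique, and uniqueness rests on the event function being nonzero before each event.

    For fixed t and s around an event, the error of the jump matrix has a fixed factor, since the
    flow also contains short smooth motions that the matrix ignores. Differentiability before the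
    event is therefore reached by cutting [t, [te i]] at a time that approaches the event as the
    required accuracy improves, the motion up to that time being exactly differentiable.

    Jacobians of the cost-to-go at two times are compared only through the identity that the one at
    t is the one at s composed with the flow, valid near [x t]; no continuity of these Jacobians in
    the state is available. Differentiability is proved along with the limits because [jac] carries
    no information without it. *)

Section Estimates.
Context {R : realType}.

Lemma mx_norm_le m n (A : 'M[R]_(m, n)) c : 0 <= c ->
  (forall i j, `|A i j| <= c) -> `|A| <= c.
Proof.
move=> c0 Ac; rewrite [leLHS]/Num.Def.normr /= mx_normrE.
by apply: bigmax_le => // -[i j] _; exact: Ac.
Qed.

Lemma mx_norm_entry m n (A : 'M[R]_(m, n)) i j : `|A i j| <= `|A|.
Proof.
rewrite [leRHS]/Num.Def.normr /= mx_normrE.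
exact: (le_bigmax _ (fun k => `|A k.1 k.2|) (i, j)).
Qed.

Lemma is_derive_entry (V : normedModType R) m n (g : V -> 'M[R]_(m, n)) u v dg i j :
  is_derive u v g dg -> is_derive u v (fun w => g w i j) (dg i j).
Proof.
move=> [dgu <-]; have /derivable_mxP dgu' := dgu.
by split; [exact: dgu'|rewrite derive_mx// mxE].
Qed.

(** The norm is the maximum of the entries, so the scalar mean value theorem, applied to each entry
    at its own intermediate point, loses no dimensional constant. *)
Lemma mean_value_le m n (g dg : R -> 'M[R]_(m, n)) (a b M : R) : a <= b ->
  continuous g -> (forall u, a < u < b -> is_derive u 1 g (dg u)) ->
  (forall u, a < u < b -> `|dg u| <= M) -> `|g b - g a| <= M * (b - a).
Proof.
rewrite le_eqVlt => /predU1P[<-|ab] gc gd gM; first by rewrite !subrr normr0 mulr0.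
have M0 : 0 <= M.
  have : a < (a + b) / 2 < b by rewrite midf_lt//= midf_lt.
  by move=> /gM; exact: le_trans.
apply: mx_norm_le => [|i j]; first by rewrite mulr_ge0// subr_ge0 ltW.
have gci : continuous (fun u => g u i j).
  move=> u; apply: (@continuous_comp _ _ _ g (fun M : 'M[R]_(m, n) => M i j)).
    exact: gc.
  exact: coord_continuous.
have [u uab||c cab] := @MVT R (fun u => g u i j) (fun u => dg u i j) _ _ ab.
- by apply: is_derive_entry; apply: gd; rewrite in_itv in uab.
- exact: continuous_subspaceT.
- rewrite !mxE => ->; rewrite in_itv/= in cab.
  rewrite normrM (@ger0_norm _ (b - a)) ?subr_ge0 ?(ltW ab)//.
  by rewrite ler_wpM2r ?subr_ge0 ?(ltW ab)// (le_trans (mx_norm_entry _ _ _)) ?gM.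
Qed.

(** At the supremum of the [u] with [Q a u], the local condition first reaches the supremum and then
    goes past it, unless [b] stops it. Only intervals that contain [c] are asked of the local
    condition, which is the kind of interval that a derivative at [c] controls. *)
Lemma cousin (Q : R -> R -> Prop) (a b : R) : a <= b ->
  (forall t s u, a <= t -> t <= s -> s <= u -> u <= b -> Q t s -> Q s u -> Q t u) ->
  (forall c, a <= c <= b -> exists2 r, 0 < r & forall t s, a <= t -> s <= b ->
     t <= c -> c <= s -> c - r < t -> s < c + r -> Q t s) ->
  Q a b.
Proof.
move=> ab Qtr Qloc; pose E := [set u | a <= u <= b /\ Q a u].
have Ea : E a.
  split; first by rewrite lexx ab.
  have [|r r0 rQ] := Qloc a; first by rewrite lexx ab.
  by apply: rQ => //; rewrite ?gtrBl ?ltrDl.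
have supE : has_sup E by split; [exists a|exists b => u [/andP[]]].
have ac : a <= sup E by apply: ub_le_sup => //; exact: supE.2.
have cb : sup E <= b by apply: ge_sup; [exists a|move=> u [/andP[]]].
have [|r r0 rQ] := Qloc (sup E); first by rewrite ac cb.
have [t [/andP[at_ tb] Qat] ct] := sup_adherent r0 supE.
have tc : t <= sup E by apply: ub_le_sup; [exact: supE.2|split=> //; rewrite at_ tb].
pose s := Num.min b (sup E + r / 2).
have sb : s <= b by rewrite ge_min lexx.
have cs : sup E <= s by rewrite le_min cb lerDl divr_ge0// ltW.
have sr : s < sup E + r by rewrite gt_min ltrD2l ltr_pdivrMr// ltr_pMr// ltr1n orbT.
have Qas : Q a s by apply: (Qtr a t s) => //; [exact: le_trans cs|exact: rQ].
have Es : E s by split=> //; rewrite sb (le_trans ac).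
have sc : s <= sup E by apply: ub_le_sup => //; exact: supE.2.
have [sbE|] := leP b (sup E + r / 2).
  by move: Qas; rewrite /s (min_idPl sbE).
move=> /ltW/min_idPr scE; move: sc; rewrite /s scE gerDl leNgt divr_gt0//.
Qed.

Lemma continuous_ball (V : normedModType R) (X : R -> V) c e :
  continuous X -> 0 < e ->
  exists2 r, 0 < r & forall u, `|u - c| < r -> `|X u - X c| < e.
Proof.
move=> Xc e0; have /cvgrPdist_lt/(_ e e0) := Xc c.
move=> /nbhs_ballP[r /= r0 rX]; exists r => // u uc.
by rewrite distrC; apply: rX; rewrite /ball/= distrC.
Qed.

Lemma mulmx_bound m n (A : 'M[R]_(m, n)) :
  exists2 K, 0 < K & forall v : 'cV[R]_n, `|A *m v| <= K * `|v|.
Proof.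
(* The summand 1 makes the constant positive even for a zero matrix, so that it can be divided by
   later. *)
exists (n%:R * `|A| + 1) => [|v]; first by rewrite ltr_wpDl// mulr_ge0.
apply: mx_norm_le => [|i j]; first by rewrite mulr_ge0// addr_ge0// mulr_ge0.
rewrite mxE (le_trans (ler_norm_sum _ _ _))//.
apply: (@le_trans _ _ (\sum_(k < n) `|A| * `|v|)).
  by apply: ler_sum => k _; rewrite normrM ler_pM ?mx_norm_entry.
by rewrite sumr_const card_ord mulrDl mul1r -mulrA mulr_natl lerDl.
Qed.

(** The derivative is bounded only while [g] is in the ball, which is what has to be shown. The
    circle is broken by applying [cousin] to the implication that carries the linear bound on
    [g - g a] from [t] to [s]. *)
Lemma stay_in_ball N (g dg : R -> 'cV[R]_N) (a b F r : R) x0 : a <= b -> 0 <= F ->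
  continuous g -> (forall u, a < u < b -> is_derive u 1 g (dg u)) ->
  (forall u, a < u < b -> `|g u - x0| < r -> `|dg u| <= F) ->
  `|g a - x0| + F * (b - a) < r -> `|g b - x0| < r.
Proof.
move=> ab F0 gc gd gF gr.
suff : `|g b - g a| <= F * (b - a).
  have := ler_normD (g b - g a) (g a - x0); rewrite subrKA; lra.
have: `|g a - g a| <= F * (a - a) -> `|g b - g a| <= F * (b - a); last first.
  by apply; rewrite !subrr normr0 mulr0.
apply: (@cousin (fun t s => `|g t - g a| <= F * (t - a) ->
  `|g s - g a| <= F * (s - a)) a b) => //; first by move=> *; auto.
move=> c /andP[ac cb].
have Fcb : F * (c - a) <= F * (b - a) by rewrite ler_wpM2l// lerB.
have [gcr|gcr] := ltP `|g c - x0| r.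
  have [|h h0 hg] := @continuous_ball _ g c (r - `|g c - x0|) gc.
    by rewrite subr_gt0.
  exists h => // t s at_ sb tc cs ct sc gta.
  have : `|g s - g t| <= F * (s - t).
    apply: (@mean_value_le _ _ g dg t s F) => //; first exact: le_trans cs.
      by move=> u ?; apply: gd; lra.
    move=> u uts; apply: gF; first by lra.
    have := hg u; rewrite ltr_distl => /(_ ltac:(lra)) guc.
    by have := ler_normD (g u - g c) (g c - x0); rewrite subrKA; lra.
  have := ler_normD (g s - g t) (g t - g a); rewrite subrKA; lra.
(* Here [g c] is out of the ball, hence too far from [g a]; by continuity the premise of the
   implication fails at every [t] near [c]. *)
have gca : F * (b - a) < `|g c - g a|.
  by have := ler_normD (g c - g a) (g a - x0); rewrite subrKA; lra.
have [|h h0 hg] := @continuous_ball _ g c (`|g c - g a| - F * (b - a)) gc.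
  by rewrite subr_gt0.
exists h => // t s at_ sb tc cs ct sc.
have := hg t; rewrite ltr_distl => /(_ ltac:(lra)) gtc gta; exfalso.
have := ler_normD (g c - g t) (g t - g a); rewrite subrKA (distrC (g c) (g t)).
have : F * (t - a) <= F * (b - a) by rewrite ler_wpM2l//; lra.
by lra.
Qed.

(** In place of Gronwall's inequality, the mean value bound is used at a point [c] where the norm of
    [g] is maximal: it gives |g c| <= |g a| + |g c| / 2. *)
Lemma growth_le N (g dg : R -> 'cV[R]_N) (a b L : R) : a <= b -> 0 <= L ->
  continuous g -> (forall u, a < u < b -> is_derive u 1 g (dg u)) ->
  (forall u, a < u < b -> `|dg u| <= L * `|g u|) -> L * (b - a) <= 1 / 2 ->
  forall u, a <= u <= b -> `|g u| <= 2 * `|g a|.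
Proof.
move=> ab L0 gc gd gL Lab.
have ngc : continuous (fun u => `|g u|).
  by move=> u; apply: cvg_norm; exact: gc.
have [c cab cmax] := @EVT_max R (fun u => `|g u|) a b ab (continuous_subspaceT ngc).
rewrite in_itv/= in cab.
have : `|g c - g a| <= (L * `|g c|) * (c - a).
  apply: (@mean_value_le _ _ g dg) => //; first by lra.
    by move=> u ?; apply: gd; lra.
  move=> u uac; rewrite (le_trans (gL _ _))//; first by lra.
  by rewrite ler_wpM2l// cmax// in_itv/=; lra.
have : (L * `|g c|) * (c - a) <= 1 / 2 * `|g c|.
  rewrite -mulrA [X in L * X]mulrC mulrA ler_wpM2r//.
  by rewrite (le_trans _ Lab)// ler_wpM2l//; lra.
have := ler_normD (g c - g a) (g a); rewrite subrK => h1 h2 h3 u uab.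
by have := cmax u; rewrite in_itv/= => /(_ uab); lra.
Qed.

End Estimates.

(** * Differentiability of ODE flows *)

Section ODE.
Context {R : realType} {N : nat}.
Implicit Types (f : R -> 'cV[R]_N -> 'cV[R]_N) (X Y : R -> 'cV[R]_N).

(** Continuity is required on the whole line and the equation only inside the interval: the values
    at the end points are then one-sided limits, which is all that an event leaves of a
    trajectory. *)
Definition sol f (a b : R) X :=
  continuous X /\ forall u, a < u < b -> is_derive u 1 X (f u (X u)).

(* Strict differentiability in the state, uniformly in time near [c]. *)
Definition sdiff_at f (c : R) (x0 : 'cV[R]_N) (A : 'M[R]_N) := forall e : R, 0 < e ->
  exists2 r : R, 0 < r & forall u y z, `|u - c| < r -> `|y - x0| < r ->
    `|z - x0| < r -> `|f u y - f u z - A *m (y - z)| <= e * `|y - z|.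

Definition cont_at f (c : R) (x0 : 'cV[R]_N) := forall e : R, 0 < e ->
  exists2 r : R, 0 < r & forall u y, `|u - c| < r -> `|y - x0| < r ->
    `|f u y - f c x0| <= e.

Definition C1field f := forall c x0,
  cont_at f c x0 /\ exists A, sdiff_at f c x0 A.

Lemma is_derive_subZ (X : R -> 'cV[R]_N) (u : R) (d w : 'cV[R]_N) :
  is_derive u 1 X d -> is_derive u 1 (fun t => X t - t *: w) (d - w).
Proof.
move=> Xd; apply: is_deriveB.
have dw : differentiable (fun t : R => t *: w) u.
  exact: (@ex_diff _ _ _ _ _ _ _ (is_diff_scalel u w)).
split; first exact: diff_derivable.
by rewrite deriveE// (@diff_val _ _ _ _ _ _ _ (is_diff_scalel u w)) scale1r.
Qed.

Lemma sol_sub f a b X t s : sol f a b X -> a <= t -> s <= b -> sol f t s X.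
Proof. by move=> [Xc Xd] at_ sb; split=> // u uts; apply: Xd; lra. Qed.

(** Both bounds are mean value bounds for a curve minus its affine model. For the second one, strict
    differentiability compares the derivative of [Y - X] with [A *m (Y - X)], and [growth_le] keeps
    [Y - X] comparable with its initial value, so that it may be frozen at time [t]. *)
Lemma short_step f c x0 A e : cont_at f c x0 -> sdiff_at f c x0 A -> 0 < e ->
  exists2 h, 0 < h & forall t s X Y, t <= s -> `|t - c| < h -> `|s - c| < h ->
    `|X t - x0| < h -> `|Y t - x0| < h -> sol f t s X -> sol f t s Y ->
    `|Y s - Y t - (s - t) *: f c x0| <= e * (s - t) /\
    `|Y s - X s - (Y t - X t) - (s - t) *: (A *m (Y t - X t))|
      <= e * (s - t) * `|Y t - X t|.
Proof.
move=> fc fA e0; have [K K0 AK] := mulmx_bound A.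
have [|r1 r10 f1] := fc (Num.min e 1); first by rewrite lt_min e0 ltr01.
have [|r2 r20 f2] := fA (Num.min (e / 4) 1).
  by rewrite lt_min ltr01 andbT divr_gt0.
pose F := `|f c x0| + 1; pose L := K + 1; pose r := Num.min r1 r2.
have F0 : 0 < F by rewrite ltr_wpDl.
have L0 : 0 < L by rewrite ltr_wpDl// ltW.
have r0 : 0 < r by rewrite lt_min r10.
have rr1 : r <= r1 by rewrite ge_min lexx.
have rr2 : r <= r2 by rewrite ge_min lexx orbT.
(* A step lasts less than [2 * h]. The three terms keep both curves within [r] of [x0], make
   [L * (2 * h)] at most 1/2 as [growth_le] demands, and make the cost of freezing [Y - X] at most
   [e / 2]; the other half of [e] is the tolerance [e / 4] doubled by [growth_le]. *)
pose h := Num.min (r / (1 + 2 * F)) (Num.min (1 / (4 * L)) (e / (8 * (K * L)))).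
have h0 : 0 < h.
  by rewrite !lt_min !divr_gt0 ?mulr_gt0 ?addr_gt0 ?mulr_gt0//.
have hF : h * (1 + 2 * F) <= r.
  by rewrite -ler_pdivlMr ?addr_gt0 ?mulr_gt0// ge_min lexx.
have hL : h * (4 * L) <= 1.
  by rewrite -ler_pdivlMr ?mulr_gt0// !ge_min lexx orbT.
have hKL : h * (8 * (K * L)) <= e.
  by rewrite -ler_pdivlMr ?mulr_gt0// !ge_min lexx !orbT.
have hr : h < r by apply: lt_le_trans hF; rewrite ltr_pMr// ltrDl// mulr_gt0.
clearbody h.
exists h => // t s X Y ts tc sc Xt Yt Xsol Ysol.
have nearc u : t <= u <= s -> `|u - c| < h.
  by move: tc sc; rewrite !ltr_distl => ? ? ?; lra.
have st : s - t < 2 * h by move: tc sc; rewrite !ltr_distl => ? ?; lra.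
have fF u y : `|u - c| < h -> `|y - x0| < r -> `|f u y| <= F.
  move=> uc yx; have := f1 u y (lt_le_trans (lt_trans uc hr) rr1) (lt_le_trans yx rr1).
  rewrite le_min => /andP[_]; have := ler_normD (f u y - f c x0) (f c x0).
  by rewrite subrK /F; lra.
have stayr Z : sol f t s Z -> `|Z t - x0| < h -> forall u, t <= u <= s -> `|Z u - x0| < r.
  move=> [Zc Zd] Zt u uts; apply: (@stay_in_ball _ _ Z (fun w => f w (Z w)) t u F) => //.
  - lra.
  - exact: ltW.
  - by move=> w ?; apply: Zd; lra.
  - by move=> w ?; apply: fF; apply: nearc; lra.
  - have : F * (u - t) <= F * (2 * h) by rewrite ler_wpM2l ?ltW//; lra.
    by lra.
have fYX u : t <= u <= s -> forall e', Num.min (e / 4) 1 <= e' ->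
    `|f u (Y u) - f u (X u) - A *m (Y u - X u)| <= e' * `|Y u - X u|.
  move=> uts e' ee'; apply: le_trans (ler_wpM2r (normr_ge0 _) ee').
  apply: f2.
  - exact: (lt_trans (nearc _ uts) (lt_le_trans hr rr2)).
  - exact: lt_le_trans (stayr _ Ysol Yt _ uts) rr2.
  - exact: lt_le_trans (stayr _ Xsol Xt _ uts) rr2.
split.
  have := @mean_value_le _ _ _ (fun u => Y u - u *: f c x0)
    (fun u => f u (Y u) - f c x0) t s e ts.
  rewrite [X in `|X| <= _](_ : _ = Y s - Y t - (s - t) *: f c x0); last first.
    by apply/matrixP => i j; rewrite !mxE; ring.
  apply.
  - by move=> u; apply: cvgB; [exact: Ysol.1|exact: scalel_continuous].
  - by move=> u uts; apply: is_derive_subZ; exact: Ysol.2.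
  - move=> u uts; have := f1 u (Y u); rewrite le_min => /(_ _ _)/andP[]//.
      by apply: (lt_trans (nearc _ _) (lt_le_trans hr rr1)); lra.
    by apply: lt_le_trans rr1; apply: stayr => //; lra.
pose dl u := Y u - X u.
have dlc : continuous dl by move=> u; apply: cvgB; [exact: Ysol.1|exact: Xsol.1].
have dld u : t < u < s -> is_derive u 1 dl (f u (Y u) - f u (X u)).
  by move=> uts; apply: is_deriveB; [exact: Ysol.2|exact: Xsol.2].
have dlL u : t < u < s -> `|f u (Y u) - f u (X u)| <= L * `|dl u|.
  move=> uts; have := fYX u _ 1; rewrite -/(dl u) => /(_ _ _) h1.
  have := h1 ltac:(lra); rewrite ge_min lexx orbT => /(_ erefl).
  have := ler_normD (f u (Y u) - f u (X u) - A *m dl u) (A *m dl u).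
  by rewrite subrK; have := AK (dl u); rewrite /L; lra.
have dl2 : forall u, t <= u <= s -> `|dl u| <= 2 * `|dl t|.
  apply: (growth_le _ (ltW L0)) dld dlL _ => //.
  have : L * (s - t) <= L * (2 * h) by rewrite ler_wpM2l// ltW.
  by lra.
have dlt u : t <= u <= s -> `|dl u - dl t| <= (L * (2 * `|dl t|)) * (u - t).
  move=> uts; apply: (@mean_value_le _ _ _ dl (fun u => f u (Y u) - f u (X u))) => //.
  - lra.
  - by move=> w ?; apply: dld; lra.
  - move=> w wtu; rewrite (le_trans (dlL _ _))//; first by lra.
    by rewrite ler_wpM2l ?(ltW L0)// dl2//; lra.
rewrite -!/(dl _) -mulrA [_ * `|dl t|]mulrC mulrA.
have := @mean_value_le _ _ _ (fun u => dl u - u *: (A *m dl t))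
    (fun u => f u (Y u) - f u (X u) - A *m dl t) t s (e * `|dl t|) ts.
rewrite [X in `|X| <= _](_ : _ = dl s - dl t - (s - t) *: (A *m dl t)); last first.
  by apply/matrixP => i j; rewrite !mxE; ring.
apply.
- by move=> u; apply: cvgB; [exact: dlc|exact: scalel_continuous].
- by move=> u uts; apply: is_derive_subZ; exact: dld.
- move=> u uts; have uts' : t <= u <= s by lra.
  have := fYX u uts' (e / 4); rewrite ge_min lexx => /(_ erefl); rewrite -/(dl u).
  have := ler_normD (f u (Y u) - f u (X u) - A *m dl u) (A *m (dl u - dl t)).
  rewrite [X in `|X| <= _](_ : _ = f u (Y u) - f u (X u) - A *m dl t); last first.
    by rewrite (mulmxBr A (dl u) (dl t)) addrA subrK.
  have := AK (dl u - dl t); have := dl2 u uts'.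
  have : K * `|dl u - dl t| <= K * ((L * (2 * `|dl t|)) * (u - t)).
    by rewrite ler_wpM2l ?(ltW K0)// dlt.
  have : K * (L * (2 * `|dl t|) * (u - t)) <= K * (L * (2 * `|dl t|) * (2 * h)).
    rewrite ler_wpM2l ?(ltW K0)// ler_wpM2l ?mulr_ge0 ?(ltW L0)//; clear -uts st; lra.
  have : h * (8 * (K * L)) * `|dl t| <= e * `|dl t| by rewrite ler_wpM2r.
  have : e / 4 * `|dl u| <= e / 4 * (2 * `|dl t|).
    by rewrite ler_wpM2l ?dl2// divr_ge0// ltW.
  clear; lra.
Qed.

(** [cousin] is applied to the implication that transports equality from [t] to [s]. Where the
    curves agree at [c], [short_step] applies with a zero initial deviation; where they differ at
    [c], they differ nearby and the implication is vacuous. *)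
Lemma ode_uniq f a b X Y : a <= b -> C1field f -> sol f a b X -> sol f a b Y ->
  X a = Y a -> forall u, a <= u <= b -> X u = Y u.
Proof.
move=> ab fC Xsol Ysol XYa u uab.
apply: (@cousin _ (fun t s => X t = Y t -> X s = Y s) a u) => //; first by lra.
  by move=> *; auto.
move=> c cau; have [XYc|XYc] := eqVneq (X c) (Y c).
  have [fc [A fA]] := fC c (X c); have [h h0 hloc] := short_step fc fA ltr01.
  have [r1 r10 Xr1] := continuous_ball c Xsol.1 h0.
  have [r2 r20 Yr2] := continuous_ball c Ysol.1 h0.
  exists (Num.min h (Num.min r1 r2)); first by rewrite !lt_min h0 r10 r20.
  move=> t s at_ su tc cs ct sc XYt.
  have : `|t - c| < Num.min h (Num.min r1 r2) by rewrite ltr_distl; lra.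
  have : `|s - c| < Num.min h (Num.min r1 r2) by rewrite ltr_distl; lra.
  rewrite !lt_min => /and3P[s1 s2 s3] /and3P[t1 t2 t3].
  have ts : t <= s := le_trans tc cs.
  have [||||] := hloc t s X Y ts t1 s1.
  - exact: Xr1.
  - by rewrite XYc; exact: Yr2.
  - by apply: sol_sub Xsol _ _ => //; lra.
  - by apply: sol_sub Ysol _ _ => //; lra.
  - move=> _; rewrite XYt !subrr !mulmx0 scaler0 !subr0 normr0 mulr0 normr_le0 subr_eq0.
    by move=> /eqP.
have e0 : 0 < `|X c - Y c| / 2 by rewrite divr_gt0// normr_gt0 subr_eq0.
have [r1 r10 Xr1] := continuous_ball c Xsol.1 e0.
have [r2 r20 Yr2] := continuous_ball c Ysol.1 e0.
exists (Num.min r1 r2); first by rewrite !lt_min r10 r20.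
move=> t s at_ su tc cs ct _ XYt.
have : `|t - c| < Num.min r1 r2 by rewrite ltr_distl; lra.
rewrite lt_min => /andP[t1 t2].
have := ler_normD (X c - X t) (Y t - Y c); rewrite XYt subrKA.
by have := Xr1 t t1; have := Yr2 t t2; rewrite XYt (distrC _ (X c)) => ? ? ?; exfalso; lra.
Qed.

(** The derivatives [A] come without any continuity in [c]. But near [c0] the field is Lipschitz in
    the state with constant [K + 1], and this bounds every strict derivative at a nearby point by
    [K + 2]. *)
Lemma sdiff_uniform_bound f a b X : a <= b -> continuous X -> C1field f ->
  exists2 K : R, 0 < K & forall c, a <= c <= b -> forall A, sdiff_at f c (X c) A ->
    forall v : 'cV[R]_N, `|A *m v| <= K * `|v|.
Proof.
move=> ab Xc fC.
apply: (@cousin _ (fun t s => exists2 K : R, 0 < K & forall c, t <= c <= s ->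
  forall A, sdiff_at f c (X c) A -> forall v : 'cV[R]_N, `|A *m v| <= K * `|v|) a b) => //.
  move=> t s u _ ts su _ [K K0 KA] [K' K'0 KA'].
  exists (Num.max K K'); first by rewrite lt_max K0.
  move=> c ctu A cA v; have [cs|sc] := leP c s.
    apply: le_trans (KA c _ A cA v) _; first by lra.
    by rewrite ler_wpM2r// le_max lexx.
  apply: le_trans (KA' c _ A cA v) _; first by lra.
  by rewrite ler_wpM2r// le_max lexx orbT.
move=> c0 c0ab; have [_ [A0 fA0]] := fC c0 (X c0).
have [K K0 AK] := mulmx_bound A0.
have [r r0 f1] := fA0 1 ltr01; have [r' r'0 Xr'] := continuous_ball c0 Xc r0.
exists (Num.min r r'); first by rewrite lt_min r0.
move=> t s at_ sb tc cs ct sc; exists (K + 2); first by rewrite addr_gt0.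
move=> c cts A cA v.
have [cr cr'] : `|c - c0| < r /\ `|c - c0| < r'.
  by apply/andP; rewrite -lt_min ltr_distl; lra.
have [r1 r10 f2] := cA 1 ltr01.
pose m := Num.min r1 (r - `|X c - X c0|).
have m0 : 0 < m by rewrite lt_min r10 subr_gt0 Xr'.
have v1 : 0 < `|v| + 1 by rewrite ltr_wpDl.
(* [v] is scaled down into the neighbourhoods of both derivatives; homogeneity removes [th] at the
   end. *)
pose th := m / (`|v| + 1).
have th0 : 0 < th by rewrite divr_gt0.
have thv : `|th *: v| < m.
  by rewrite normrZ (gtr0_norm th0) /th mulrAC -mulrA gtr_pMr// ltr_pdivrMr// mul1r ltrDl.
clearbody th.
have [thv1 thv2] : `|th *: v| < r1 /\ `|th *: v| + `|X c - X c0| < r.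
  by move: thv; rewrite lt_min => /andP[-> ?]; rewrite -ltrBrDr.
have := f2 c (th *: v + X c) (X c); rewrite addrK !subrr !normr0 mul1r.
move=> /(_ r10 thv1 r10).
have := f1 c (th *: v + X c) (X c) cr; rewrite addrK -(addrA _ (X c)) mul1r.
move=> /(_ _ (Xr' _ cr')) h1.
have := h1 (le_lt_trans (ler_normD _ _) thv2).
set a1 := f c _ - f c _ => h2 h3.
have : `|A *m (th *: v)| <= (K + 2) * `|th *: v|.
  have := AK (th *: v); have := ler_normD (a1 - A0 *m (th *: v)) (A0 *m (th *: v)).
  have := ler_normB a1 (a1 - A *m (th *: v)); rewrite subrK subKr; lra.
by rewrite -scalemxAr !normrZ (gtr0_norm th0) (mulrCA (K + 2)) ler_pM2l.
Qed.

(** The matrix is a product of short steps. The induction carries three bounds: on the matrix, on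
    the deviation and on the error. The exponential factors multiply when two intervals are joined
    and the factors [e1 * (s - t)] add up, so the three bounds reproduce themselves. *)
Lemma ode_diff f a b X e : a <= b -> C1field f -> sol f a b X -> 0 < e ->
  exists M : 'M[R]_N, exists2 r : R, 0 < r & forall Y, sol f a b Y ->
    `|Y a - X a| < r -> `|Y b - X b - M *m (Y a - X a)| <= e * `|Y a - X a|.
Proof.
move=> ab fC Xsol e0.
have [K0 K00 KA] := sdiff_uniform_bound ab Xsol.1 fC.
(* The extra 1 pays for the error of a step, capped at 1 by [Num.min e1 1] below: a step multiplies
   the deviation by at most [1 + K * (s - t)], hence by at most the exponential. In [e1], the length
   is replaced by [b - a + 1] to exclude a zero denominator. *)
pose K := K0 + 1; have K_gt0 : 0 < K by rewrite addr_gt0.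
pose e1 := e / ((b - a + 1) * expR (K * (b - a))).
have ba1 : 0 < b - a + 1 by rewrite ltr_wpDl// subr_ge0.
have e10 : 0 < e1 by rewrite divr_gt0// mulr_gt0// expR_gt0.
suff : exists M : 'M[R]_N, exists2 r : R, 0 < r &
  (forall v : 'cV[R]_N, `|M *m v| <= expR (K * (b - a)) * `|v|) /\
  forall Y, sol f a b Y -> `|Y a - X a| < r ->
    `|Y b - X b| <= expR (K * (b - a)) * `|Y a - X a| /\
    `|Y b - X b - M *m (Y a - X a)| <=
      e1 * (b - a) * expR (K * (b - a)) * `|Y a - X a|.
  move=> [M [r r0 [_ Mr]]]; exists M, r => // Y Ysol Yr.
  apply: le_trans (Mr Y Ysol Yr).2 _; rewrite ler_wpM2r//.
  rewrite /e1 -mulrA mulrAC ler_pdivrMr ?mulr_gt0 ?expR_gt0// ler_wpM2l ?(ltW e0)//.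
  by rewrite ler_wpM2r ?expR_ge0// lerDl.
clearbody e1.
apply: (@cousin _ (fun t s => exists M : 'M[R]_N, exists2 r : R, 0 < r &
  (forall v : 'cV[R]_N, `|M *m v| <= expR (K * (s - t)) * `|v|) /\
  forall Y, sol f t s Y -> `|Y t - X t| < r ->
    `|Y s - X s| <= expR (K * (s - t)) * `|Y t - X t| /\
    `|Y s - X s - M *m (Y t - X t)| <=
      e1 * (s - t) * expR (K * (s - t)) * `|Y t - X t|) a b) => //.
  move=> t s u at_ ts su ub [M1 [r1 r10 [M1b M1Y]]] [M2 [r2 r20 [M2b M2Y]]].
  have -> : expR (K * (u - t)) = expR (K * (u - s)) * expR (K * (s - t)).
    by rewrite -expRD; congr expR; ring.
  move: M1b M1Y M2b M2Y.
  set E1 := expR (K * (s - t)); set E2 := expR (K * (u - s)) => M1b M1Y M2b M2Y.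
  have E10 : 0 < E1 by exact: expR_gt0.
  have E20 : 0 < E2 by exact: expR_gt0.
  exists (M2 *m M1), (Num.min r1 (r2 / E1)).
    by rewrite lt_min r10 divr_gt0.
  split=> [v|Y Ysol].
    by rewrite -mulmxA (le_trans (M2b _))// -mulrA ler_wpM2l// ltW.
  rewrite lt_min => /andP[Yr1]; rewrite ltr_pdivlMr// mulrC => Yr2.
  have [|Ys1 Ys2] := M1Y Y _ Yr1; first by apply: sol_sub Ysol _ _ => //; lra.
  have [|Yu1 Yu2] := M2Y Y _ (le_lt_trans Ys1 Yr2).
    by apply: sol_sub Ysol _ _ => //; lra.
  split; first by rewrite (le_trans Yu1)// -mulrA ler_wpM2l// ltW.
  have := ler_normD (Y u - X u - M2 *m (Y s - X s))
    (M2 *m (Y s - X s - M1 *m (Y t - X t))).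
  rewrite (mulmxBr M2 (Y s - X s)) addrA subrK mulmxA => /le_trans; apply.
  have := M2b (Y s - X s - M1 *m (Y t - X t)).
  rewrite (mulmxBr M2 (Y s - X s)) mulmxA.
  have : E2 * `|Y s - X s - M1 *m (Y t - X t)| <=
      E2 * (e1 * (s - t) * E1 * `|Y t - X t|) by rewrite ler_wpM2l// ltW.
  have : e1 * (u - s) * E2 * `|Y s - X s| <= e1 * (u - s) * E2 * (E1 * `|Y t - X t|).
    by rewrite ler_wpM2l// mulr_ge0 ?(ltW E20)// mulr_ge0 ?subr_ge0// ltW.
  clear -Yu2; lra.
move=> c cab; have [fc [A fA]] := fC c (X c).
have [|h h0 hloc] := @short_step f c (X c) A (Num.min e1 1) fc fA.
  by rewrite lt_min e10 ltr01.
have [r' r'0 Xr'] := continuous_ball c Xsol.1 h0.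
exists (Num.min h r'); first by rewrite lt_min h0.
move=> t s at_ sb tc cs ct sc.
have [tc1 tc2] : `|t - c| < h /\ `|t - c| < r'.
  by apply/andP; rewrite -lt_min ltr_distl; lra.
have sc1 : `|s - c| < h.
  have : `|s - c| < Num.min h r' by rewrite ltr_distl; lra.
  by rewrite lt_min => /andP[].
have ts : t <= s := le_trans tc cs.
have Kst : 1 + K * (s - t) <= expR (K * (s - t)) by exact: expR_ge1Dx.
have Kst0 : 0 <= K * (s - t) by rewrite mulr_ge0 ?subr_ge0// ltW.
(* One explicit Euler step of the variational equation; the radius keeps [Y t] within [h] of
   [X c]. *)
exists (1%:M + (s - t) *: A), (h - `|X t - X c|); first by rewrite subr_gt0 Xr'.
have AK (v : 'cV[R]_N) : `|A *m v| <= K0 * `|v| by exact: (KA c cab A fA v).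
have AK' (v : 'cV[R]_N) : `|(s - t) *: (A *m v)| <= (s - t) * (K0 * `|v|).
  by rewrite normrZ ger0_norm ?subr_ge0// ler_wpM2l ?subr_ge0.
split=> [v|Y Ysol Yr].
  rewrite mulmxDl mul1mx -scalemxAl (le_trans (ler_normD _ _))//.
  apply: le_trans (ler_wpM2r (normr_ge0 _) Kst); have := AK' v; rewrite /K.
  have : 0 <= (s - t) * `|v| by rewrite mulr_ge0// subr_ge0.
  lra.
have Yc : `|Y t - X c| < h.
  by have := ler_normD (Y t - X t) (X t - X c); rewrite subrKA; lra.
have [_] := hloc t s X Y ts tc1 sc1 (Xr' _ tc2) Yc (sol_sub Xsol at_ sb) Ysol.
set d := Y t - X t => hd.
rewrite mulmxDl mul1mx -scalemxAl (opprD d) addrA.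
have std : 0 <= (s - t) * `|d| by rewrite mulr_ge0// subr_ge0.
have h1 : Num.min e1 1 * (s - t) * `|d| <= (s - t) * `|d|.
  by rewrite -mulrA ler_piMl// ge_min lexx orbT.
have h2 : Num.min e1 1 * (s - t) * `|d| <= e1 * (s - t) * `|d|.
  by rewrite -!mulrA ler_wpM2r// ge_min lexx.
split.
  have := ler_normD (Y s - X s - d - (s - t) *: (A *m d)) (d + (s - t) *: (A *m d)).
  rewrite [X in `|X| <= _](_ : _ = Y s - X s); last first.
    by rewrite -(addrA _ (- d)) -opprD subrK.
  have := ler_normD d ((s - t) *: (A *m d)); have := AK' d.
  have : (1 + K * (s - t)) * `|d| <= expR (K * (s - t)) * `|d| by rewrite ler_wpM2r.
  clear -hd h1; rewrite /K; lra.
apply: le_trans hd _; apply: le_trans h2 _.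
rewrite -[in leRHS]mulrA [expR _ * _]mulrC mulrA ler_peMr// ?mulr_ge0 ?subr_ge0 ?(ltW e10)//.
clear -Kst Kst0; lra.
Qed.

End ODE.

(** * Smooth vector fields *)

Section StrictDiff.
Context {R : realType}.

Definition bounded_linear (V W : normedModType R) (l : V -> W) :=
  [/\ (forall u v, l (u + v) = l u + l v), (forall (a : R) u, l (a *: u) = a *: l u) &
    exists2 K : R, 0 < K & forall v, `|l v| <= K * `|v|].

(** Two-point differentiability at a single point. It is stable under sums, products and inverses,
    so it passes through the determinants behind [invmx], and it yields at once the continuity and
    the strict state derivative of the vector field. *)
Definition strict_diff (V : normedModType R) (F : V -> R) (P : V) :=
  exists2 l : V -> R^o, bounded_linear l & forall e : R, 0 < e ->
    exists2 r : R, 0 < r & forall y z, `|y - P| < r -> `|z - P| < r ->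
      `|F y - F z - l (y - z)| <= e * `|y - z|.

Lemma fin_radius (I : finType) (Q : I -> R -> Prop) :
  (forall i r r', r' <= r -> Q i r -> Q i r') ->
  (forall i, exists2 r, 0 < r & Q i r) ->
  exists2 r, 0 < r & forall i, Q i r.
Proof.
move=> Qm Qr; have {}Qr i : exists r, 0 < r /\ Q i r by have [r] := Qr i; exists r.
have [rho rhoP] := choice Qr.
exists (\big[Num.min/1]_i rho i).
  by apply: lt_bigmin => // i _; exact: (rhoP i).1.
by move=> i; apply: Qm (rhoP i).2; exact: bigmin_le_cond.
Qed.

Section Calculus.
Variable V : normedModType R.
Implicit Types (F G : V -> R) (P : V).

Lemma strict_diff_cont F P : strict_diff F P -> forall e : R, 0 < e ->
  exists2 r, 0 < r & forall y, `|y - P| < r -> `|F y - F P| < e.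
Proof.
move=> [l [_ _ [K K0 lK]] lF] e e0.
have [r r0 rF] := lF 1 ltr01.
exists (Num.min r (e / (K + 2))); first by rewrite lt_min r0 divr_gt0// addr_gt0.
move=> y; rewrite lt_min => /andP[yr]; rewrite ltr_pdivlMr ?addr_gt0// => ye.
have := rF y P yr; rewrite subrr normr0 mul1r => /(_ r0).
have := lK (y - P); have := ler_normD (F y - F P - l (y - P)) (l (y - P)).
have := normr_ge0 (y - P).
by rewrite subrK; lra.
Qed.

Lemma strict_diff_cst (a : R) P : strict_diff (fun _ => a) P.
Proof.
exists (fun _ => 0).
  split=> [u v|b u|]; rewrite ?addr0 ?scaler0//.
  by exists 1 => // v; rewrite normr0 mul1r.
move=> e e0; exists 1 => // y z _ _.
by rewrite subrr subr0 normr0 mulr_ge0// ltW.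
Qed.

Lemma strict_diffD F G P : strict_diff F P -> strict_diff G P ->
  strict_diff (fun y => F y + G y) P.
Proof.
move=> [l [lD lZ [K K0 lK]] lF] [m [mD mZ [L L0 mL]] mG].
exists (fun v => l v + m v).
  split=> [u v|a u|]; first by rewrite lD mD addrACA.
    by rewrite lZ mZ scalerDr.
  exists (K + L); first exact: addr_gt0.
  move=> v; have := lK v; have := mL v; have := ler_normD (l v) (m v); lra.
move=> e e0; have e20 : 0 < e / 2 by rewrite divr_gt0.
have [r r0 rF] := lF _ e20; have [s s0 sG] := mG _ e20.
exists (Num.min r s); first by rewrite lt_min r0.
move=> y z; rewrite !lt_min => /andP[yr ys] /andP[zr zs].
have := rF y z yr zr; have := sG y z ys zs.
have := ler_normD (F y - F z - l (y - z)) (G y - G z - m (y - z)).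
rewrite [X in `|X| <= _](_ : _ = F y + G y - (F z + G z) - (l (y - z) + m (y - z))).
  lra.
by ring.
Qed.

Lemma strict_diffM F G P : strict_diff F P -> strict_diff G P ->
  strict_diff (fun y => F y * G y) P.
Proof.
move=> sF sG; have [l [lD lZ [K K0 lK]] lF] := sF.
have [m [mD mZ [L L0 mL]] mG] := sG.
have FK : 0 <= `|F P| * L by rewrite mulr_ge0// ltW.
have GK : 0 <= `|G P| * K by rewrite mulr_ge0// ltW.
exists (fun v => F P * m v + G P * l v).
  split=> [u v|a u|]; first by rewrite lD mD; ring.
    by rewrite lZ mZ /GRing.scale/=; ring.
  exists (`|F P| * L + `|G P| * K + 1); first by rewrite ltr_wpDl// addr_ge0.
  move=> v; have := ler_normD (F P * m v) (G P * l v); rewrite !normrM.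
  have : `|F P| * `|m v| <= `|F P| * (L * `|v|) by rewrite ler_wpM2l.
  have : `|G P| * `|l v| <= `|G P| * (K * `|v|) by rewrite ler_wpM2l.
  have := normr_ge0 v; lra.
(* [D] is the sum of the coefficients of [e1 * d] in the bounds [a1] to [a4] below. *)
move=> e e0; pose D : R := `|F P| + `|G P| + K + L + 2.
have D0 : 0 < D by have := normr_ge0 (F P); have := normr_ge0 (G P); rewrite /D; lra.
pose e1 : R := Num.min 1 (e / D).
have e10 : 0 < e1 by rewrite lt_min ltr01 divr_gt0.
have e11 : e1 <= 1 by rewrite ge_min lexx.
have e1D : e1 * D <= e by rewrite -ler_pdivlMr// ge_min lexx orbT.
clearbody e1.
have [r1 r10 r1F] := lF _ e10; have [r2 r20 r2G] := mG _ e10.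
have [r3 r30 r3F] := strict_diff_cont sF e10; have [r4 r40 r4G] := strict_diff_cont sG e10.
exists (Num.min (Num.min r1 r2) (Num.min r3 r4)).
  by rewrite !lt_min r10 r20 r30.
move=> y z; rewrite !lt_min => /andP[/andP[y1 y2] /andP[y3 y4]].
move=> /andP[/andP[z1 z2] /andP[z3 z4]].
have h1 := r1F y z y1 z1; have h2 := r2G y z y2 z2.
have h3 := r3F y y3; have h4 := r4G z z4.
have h5 := lK (y - z); have h6 := mL (y - z).
set d := `|y - z| in h1 h2 h5 h6 *; have d0 : 0 <= d by exact: normr_ge0.
have -> : F y * G y - F z * G z - (F P * m (y - z) + G P * l (y - z)) =
   F y * (G y - G z - m (y - z)) + (F y - F P) * m (y - z) +
   (G z * (F y - F z - l (y - z)) + (G z - G P) * l (y - z)) by ring.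
have FyP : `|F y| <= `|F P| + 1.
  by move: (h3) e11 (ler_normD (F y - F P) (F P)); rewrite subrK; clear; lra.
have GzP : `|G z| <= `|G P| + 1.
  by move: (h4) e11 (ler_normD (G z - G P) (G P)); rewrite subrK; clear; lra.
have a1 : `|F y * (G y - G z - m (y - z))| <= (`|F P| + 1) * (e1 * d).
  by rewrite normrM ler_pM.
have a2 : `|(F y - F P) * m (y - z)| <= e1 * (L * d).
  by rewrite normrM ler_pM// ltW.
have a3 : `|G z * (F y - F z - l (y - z))| <= (`|G P| + 1) * (e1 * d).
  by rewrite normrM ler_pM.
have a4 : `|(G z - G P) * l (y - z)| <= e1 * (K * d).
  by rewrite normrM ler_pM// ltW.
have : e1 * D * d <= e * d by rewrite ler_wpM2r.
have := ler_normD (F y * (G y - G z - m (y - z))) ((F y - F P) * m (y - z)).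
have := ler_normD (G z * (F y - F z - l (y - z))) ((G z - G P) * l (y - z)).
move: (ler_normD (F y * (G y - G z - m (y - z)) + (F y - F P) * m (y - z))
  (G z * (F y - F z - l (y - z)) + (G z - G P) * l (y - z))).
clear -a1 a2 a3 a4; rewrite /D; lra.
Qed.

Lemma strict_diffV F P : strict_diff F P -> F P != 0 ->
  strict_diff (fun y => (F y)^-1) P.
Proof.
move=> sF FP0; have [l [lD lZ [K K0 lK]] lF] := sF.
set q := (F P)^-1.
exists (fun v => - (q * q * l v)).
  split=> [u v|a u|]; first by rewrite lD; ring.
    by rewrite lZ /GRing.scale/=; ring.
  exists (`|q * q| * K + 1); first by rewrite ltr_wpDl// mulr_ge0// ltW.
  move=> v; rewrite normrN normrM.
  have : `|q * q| * `|l v| <= `|q * q| * (K * `|v|) by rewrite ler_wpM2l.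
  have := normr_ge0 v; lra.
move=> e e0; pose D : R := (`|q| + 1) * (`|q| + 1) + (2 * `|q| + 1) * K + 1.
have D0 : 0 < D.
  by rewrite ltr_wpDl// addr_ge0// mulr_ge0 ?addr_ge0 ?mulr_ge0// ltW.
pose e1 : R := Num.min 1 (e / D).
have e10 : 0 < e1 by rewrite lt_min ltr01 divr_gt0.
have e11 : e1 <= 1 by rewrite ge_min lexx.
have e1D : e1 * D <= e by rewrite -ler_pdivlMr// ge_min lexx orbT.
clearbody e1.
have [r1 r10 r1F] := lF _ e10.
have Vc : {for F P, continuous (fun x : R => x^-1)} by exact: inv_continuous.
have /cvgrPdist_lt/(_ e1 e10) := Vc; move=> /nbhs_ballP[s /= s0 sV].
have [r2 r20 r2F] := strict_diff_cont sF s0.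
have FP0' : 0 < `|F P| by rewrite normr_gt0.
have [r3 r30 r3F] := strict_diff_cont sF FP0'.
exists (Num.min r1 (Num.min r2 r3)); first by rewrite !lt_min r10 r20.
move=> y z; rewrite !lt_min => /and3P[y1 y2 y3] /and3P[z1 z2 z3].
have ne0 w : `|w - P| < r3 -> F w != 0.
  move=> /r3F; apply: contraTneq => ->.
  by rewrite sub0r normrN ltxx.
have near w : `|w - P| < r2 -> `|(F w)^-1 - q| < e1.
  by move=> /r2F wP; rewrite distrC; apply: sV; rewrite /ball/= distrC.
have hy := near _ y2; have hz := near _ z2; have h1 := r1F y z y1 z1.
have h5 := lK (y - z).
set a := (F y)^-1 in hy *; set b := (F z)^-1 in hz *.
set d := `|y - z| in h1 h5 *; have d0 : 0 <= d by exact: normr_ge0.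
(* Since a - b = - a b (F y - F z), what remains is the linearization error of [F] and the
   replacement of a b by q q, with a b - q q = a (b - q) + q (a - q). *)
have -> : a - b - - (q * q * l (y - z)) =
   - (a * b * (F y - F z - l (y - z))) - (a * (b - q) + q * (a - q)) * l (y - z).
  by rewrite /a /b; field; rewrite !ne0.
have aq : `|a| <= `|q| + 1.
  by move: (hy) e11 (ler_normD (a - q) q); rewrite subrK; clear; lra.
have bq : `|b| <= `|q| + 1.
  by move: (hz) e11 (ler_normD (b - q) q); rewrite subrK; clear; lra.
have a1 : `|a * b * (F y - F z - l (y - z))| <= (`|q| + 1) * (`|q| + 1) * (e1 * d).
  by rewrite !normrM !ler_pM// mulr_ge0.
have a2 : `|a * (b - q) + q * (a - q)| <= (2 * `|q| + 1) * e1.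
  have := ler_normD (a * (b - q)) (q * (a - q)); rewrite !normrM.
  have : `|a| * `|b - q| <= (`|q| + 1) * e1 by rewrite ler_pM// ltW.
  have : `|q| * `|a - q| <= `|q| * e1 by rewrite ler_wpM2l// ltW.
  clear; lra.
have a3 : `|(a * (b - q) + q * (a - q)) * l (y - z)| <= ((2 * `|q| + 1) * e1) * (K * d).
  by rewrite normrM ler_pM.
have : e1 * D * d <= e * d by rewrite ler_wpM2r.
move: (ler_normB (- (a * b * (F y - F z - l (y - z))))
  ((a * (b - q) + q * (a - q)) * l (y - z))).
have : 0 <= e1 * d by rewrite mulr_ge0// ltW.
clear -a1 a3; rewrite normrN /D; lra.
Qed.

Lemma strict_diff_sum (I : Type) (s : seq I) (Q : pred I) (F : I -> V -> R) P :
  (forall i, strict_diff (F i) P) ->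
  strict_diff (fun y => \sum_(i <- s | Q i) F i y) P.
Proof.
move=> sF; elim: s => [|i s ih].
  by under eq_fun do rewrite big_nil; exact: strict_diff_cst.
under eq_fun do rewrite big_cons.
by case: (Q i) => //; exact: strict_diffD.
Qed.

Lemma strict_diff_prod (I : Type) (s : seq I) (Q : pred I) (F : I -> V -> R) P :
  (forall i, strict_diff (F i) P) ->
  strict_diff (fun y => \prod_(i <- s | Q i) F i y) P.
Proof.
move=> sF; elim: s => [|i s ih].
  by under eq_fun do rewrite big_nil; exact: strict_diff_cst.
under eq_fun do rewrite big_cons.
by case: (Q i) => //; exact: strict_diffM.
Qed.

Lemma strict_diff_det n (F : V -> 'M[R]_n) P :
  (forall i j, strict_diff (fun y => F y i j) P) ->
  strict_diff (fun y => \det (F y)) P.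
Proof.
move=> sF; apply: strict_diff_sum => s.
apply: strict_diffM; first exact: strict_diff_cst.
exact: strict_diff_prod.
Qed.

(** By Cramer's rule, an entry of the inverse is a cofactor, polynomial in the entries, divided by
    the determinant. *)
Lemma strict_diff_invmx n (F : V -> 'M[R]_n) P i j :
  (forall y, F y \in unitmx) ->
  (forall i j, strict_diff (fun y => F y i j) P) ->
  strict_diff (fun y => invmx (F y) i j) P.
Proof.
move=> uF sF.
under eq_fun do rewrite /invmx uF !mxE /cofactor.
apply: strict_diffM.
  apply: strict_diffV; first exact: strict_diff_det.
  by have := uF P; rewrite unitmxE unitfE.
apply: strict_diffM; first exact: strict_diff_cst.
apply: strict_diff_det => a b; under eq_fun do rewrite !mxE.
exact: sF.
Qed.

Lemma strict_diff_mulmx m n p (F : V -> 'M[R]_(m, n)) (G : V -> 'M[R]_(n, p)) P i j :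
  (forall i j, strict_diff (fun y => F y i j) P) ->
  (forall i j, strict_diff (fun y => G y i j) P) ->
  strict_diff (fun y => (F y *m G y) i j) P.
Proof.
move=> sF sG; under eq_fun do rewrite mxE.
by apply: strict_diff_sum => k; apply: strict_diffM.
Qed.

Lemma strict_diff_col_mx m1 m2 n (F : V -> 'M[R]_(m1, n)) (G : V -> 'M[R]_(m2, n)) P i j :
  (forall i j, strict_diff (fun y => F y i j) P) ->
  (forall i j, strict_diff (fun y => G y i j) P) ->
  strict_diff (fun y => col_mx (F y) (G y) i j) P.
Proof.
by move=> sF sG; under eq_fun do rewrite mxE; case: (fintype.split i).
Qed.

End Calculus.

Lemma strict_diff_comp (V W : normedModType R) (F : W -> R) (p : V -> W) P :
  bounded_linear p -> strict_diff F (p P) -> strict_diff (F \o p) P.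
Proof.
move=> [pD pZ [K K0 pK]] [l [lD lZ [L L0 lL]] lF].
have pB u v : p (u - v) = p u - p v by rewrite pD -scaleN1r pZ scaleN1r.
exists (l \o p).
  split=> [u v|a u|] /=; rewrite ?pD ?lD ?pZ ?lZ//.
  exists (L * K) => [|v]; first exact: mulr_gt0.
  by rewrite (le_trans (lL _))// -mulrA ler_wpM2l// ltW.
move=> e e0; have eK0 : 0 < e / K by rewrite divr_gt0.
have [r r0 rF] := lF _ eK0; exists (r / K); first by rewrite divr_gt0.
move=> y z; rewrite !ltr_pdivlMr// => yr zr /=.
have h u : `|u - P| * K < r -> `|p u - p P| < r.
  by rewrite mulrC -pB; apply: le_lt_trans.
rewrite pB (le_trans (rF _ _ (h _ yr) (h _ zr)))//.
by rewrite -mulrA ler_wpM2l// ?(ltW e0)// ler_pdivrMl// -pB.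
Qed.

End StrictDiff.

(** * From C^1 maps on finite-dimensional spaces to strict differentiability *)

Section SmoothStrict.
Context {R : realType}.

(* A finite family spanning [V] with bounded coordinates: a form of finite dimension
   that is stable under the product spaces on which the data are smooth. *)
Definition fin_frame (V : normedModType R) :=
  exists (I : finType) (b : I -> V) (c : I -> V -> R), forall v,
    v = \sum_i c i v *: b i /\ forall i, `|c i v| <= `|v|.

Lemma fin_frame_R : fin_frame R.
Proof.
exists unit, (fun=> 1), (fun=> id) => v; split=> //.
by rewrite (big_pred1 tt) => [|[]]//; rewrite /GRing.scale/= mulr1.
Qed.

Lemma fin_frame_cV n : fin_frame 'cV[R]_n.
Proof.
exists 'I_n, (fun i => delta_mx i 0), (fun i (v : 'cV[R]_n) => v i 0) => v.
split; last by move=> i; exact: mx_norm_entry.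
rewrite [LHS]matrix_sum_delta; apply: eq_bigr => i _.
by rewrite big_ord1.
Qed.

Lemma fin_frame_prod (V W : normedModType R) :
  fin_frame V -> fin_frame W -> fin_frame (V * W)%type.
Proof.
move=> [I [b [c bc]]] [J [b' [c' bc']]].
exists (I + J)%type, (fun k => match k with inl i => (b i, 0) | inr j => (0, b' j) end),
  (fun k v => match k with inl i => c i v.1 | inr j => c' j v.2 end) => -[v w].
split.
  rewrite big_sumType/=.
  have h1 (f : I -> R) : \sum_i f i *: ((b i, 0) : V * W) = (\sum_i f i *: b i, 0).
    elim/big_ind2 : _ => // [x1 [x21 x22] y1 [y21 y22] -> ->|i _].
      by rewrite /GRing.add/=/add_pair/= addr0.
    by rewrite /GRing.scale/=/scale_pair scaler0.
  have h2 (f : J -> R) : \sum_i f i *: ((0, b' i) : V * W) = (0, \sum_i f i *: b' i).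
    elim/big_ind2 : _ => // [x1 [x21 x22] y1 [y21 y22] -> ->|i _].
      by rewrite /GRing.add/=/add_pair/= addr0.
    by rewrite /GRing.scale/=/scale_pair scaler0.
  rewrite h1 h2 -(bc v).1 -(bc' w).1.
  by rewrite /GRing.add/=/add_pair/= addr0 add0r.
move=> [i|j]; rewrite prod_normE/= le_max; first by rewrite (bc v).2.
by rewrite (bc' w).2 orbT.
Qed.

Lemma is_derive_line (V W : normedModType R) (F : V -> W) (z d : V) (th : R) :
  differentiable F (z + th *: d) ->
  is_derive th 1 (fun s : R => F (z + s *: d)) ('d F (z + th *: d) d).
Proof.
move=> dF.
have dl : is_diff th (fun s : R => z + s *: d) (fun s => s *: d).
  have := is_diffD (is_diff_cst z th) (is_diff_scalel th d).
  by rewrite add0r.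
have dl' : differentiable (fun s : R => z + s *: d) th := ex_diff.
have dc : differentiable (F \o (fun s : R => z + s *: d)) th by exact: differentiable_comp.
split; first exact: diff_derivable.
rewrite deriveE// (@diff_comp _ _ _ _ (fun s : R => z + s *: d) F)//=.
by rewrite (@diff_val _ _ _ _ _ _ _ dl) scale1r.
Qed.

(** Mean value theorem on the segment from [z] to [y]. The hypothesis gives the continuity of the
    differential one direction at a time only; a finite frame turns this into closeness of the
    differentials on all directions at once, each frame vector taking a share [e1] of the error. *)
Lemma strict_diff_C1 (V : normedModType R) m n (F : V -> 'M[R]_(m, n)) P i j :
  fin_frame V -> is_Ck 1 F -> strict_diff (fun y => F y i j) P.
Proof.
move=> [I [b [c bc]]] [dF cF]; exists (fun v => ('d F P v : 'M[R]_(m, n)) i j).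
  split=> [u v|a u|]; rewrite ?linearD ?linearZ ?mxE//.
  have [K K0 KF] := linear_lipschitz (diff_continuous (dF P)).
  by exists K => // v; rewrite (le_trans (mx_norm_entry _ _ _)).
move=> e e0; pose e1 := e / (#|I|%:R + 1).
have e10 : 0 < e1 by rewrite divr_gt0// ltr_wpDl.
have [r r0 rF] : exists2 r, 0 < r & forall k w, `|w - P| < r ->
    `|('d F w : V -> 'M[R]_(m, n)) (b k) - ('d F P : V -> 'M[R]_(m, n)) (b k)| <= e1.
  apply: fin_radius => [k r r' rr' h w wr|k]; first by apply: h; exact: lt_le_trans rr'.
  have /cvgrPdist_le/(_ _ e10) := cF (b k) P; move=> /nbhs_ballP[r /= r0 rF].
  exists r => // w wr; rewrite distrC; apply: rF; by rewrite -ball_normE /= distrC.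
exists r => // y z yr zr; set d := y - z.
have [th|th thc|th] := @MVT R (fun s : R => F (z + s *: d) i j)
    (fun s => ('d F (z + s *: d) d : 'M[R]_(m, n)) i j) 0 1 ltr01.
- by move=> _; apply: is_derive_entry; exact: is_derive_line.
- apply: derivable_within_continuous => s _.
  exact: (@ex_derive _ _ _ _ _ _ _ (is_derive_entry i j (is_derive_line (dF _)))).
rewrite in_itv/= => /andP[th0 th1].
have zd : z + d = y by rewrite /d addrC subrK.
rewrite scale1r scale0r addr0 subr0 mulr1 zd => ->.
have wr : `|z + th *: d - P| < r.
  have -> : z + th *: d - P = th *: (y - P) + (1 - th) *: (z - P).
    by rewrite scalerBl scale1r addrCA -scalerBr opprB addrA subrK -/d addrAC.
  rewrite (le_lt_trans (ler_normD _ _))// !normrZ !ger0_norm ?subr_ge0 ?(ltW th0) ?(ltW th1)//.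
  have : th * `|y - P| < th * r by rewrite ltr_pM2l.
  have : (1 - th) * `|z - P| <= (1 - th) * r by rewrite ler_wpM2l ?(ltW zr)// subr_ge0 ltW.
  lra.
have -> : forall A B : 'M[R]_(m, n), A i j - B i j = (A - B) i j by move=> A B; rewrite !mxE.
apply: le_trans (mx_norm_entry _ _ _) _.
have [dE dle] := bc d.
have dS w : 'd F w d = \sum_k c k d *: ('d F w : V -> 'M[R]_(m, n)) (b k).
  by rewrite {1}dE linear_sum; apply: eq_bigr => k _; rewrite linearZ.
rewrite !dS -sumrB.
rewrite (le_trans (ler_norm_sum _ _ _))//.
apply: (@le_trans _ _ (\sum_(k : I) (e1 * `|d|))).
  apply: ler_sum => k _; rewrite -scalerBr normrZ mulrC.
  by rewrite ler_pM// rF.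
rewrite sumr_const -mulr_natl mulrA ler_wpM2r// /e1 mulrCA ler_piMr ?(ltW e0)//.
by rewrite ler_pdivrMr ?ltr_wpDl// mul1r lerDl.
Qed.

(** Joint strict differentiability in time and state is restricted to pairs of points with the same
    time coordinate; with the maximum norm it suffices to treat the entries separately and take a
    common radius. *)
Lemma strict_diff_field N (f : R -> 'cV[R]_N -> 'cV[R]_N) c x0 :
  (forall j, strict_diff (fun P : R * 'cV[R]_N => f P.1 P.2 j 0) (c, x0)) ->
  cont_at f c x0 /\ exists A, sdiff_at f c x0 A.
Proof.
move=> sf; split.
  move=> e e0.
  have [r r0 rf] : exists2 r, 0 < r & forall j (P : R * 'cV[R]_N), `|P - (c, x0)| < r ->
      `|f P.1 P.2 j 0 - f c x0 j 0| <= e.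
    apply: fin_radius => [k r r' rr' h w wr|k]; first by apply: h; exact: lt_le_trans rr'.
    by have [r r0 h] := strict_diff_cont (sf k) e0; exists r => // P /h/ltW.
  exists r => // u y ur yr; apply: mx_norm_le => [|j k]; first exact: ltW.
  by rewrite (ord1 k) !mxE; apply: (rf j (u, y)); rewrite prod_normE/= gt_max ur.
have /choice[l lP] : forall j, exists l : R * 'cV[R]_N -> R^o, bounded_linear l /\
    forall e : R, 0 < e -> exists2 r : R, 0 < r & forall y z : R * 'cV[R]_N,
      `|y - (c, x0)| < r -> `|z - (c, x0)| < r ->
      `|f y.1 y.2 j 0 - f z.1 z.2 j 0 - l (y - z)| <= e * `|y - z|.
  by move=> j; have [l l1 l2] := sf j; exists l.
(* The rows of [A] are the restrictions of the joint linear forms to the state directions. *)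
pose A := \matrix_(j, k) l j (0, delta_mx k 0).
exists A => e e0.
have lA j v : l j (0, v) = (A *m v) j 0.
  have [[lD lZ _] _] := lP j.
  have l0 : l j 0 = 0 by rewrite -(scale0r 0) lZ scale0r.
  have ls (I : Type) (s : seq I) (g : I -> 'cV[R]_N) :
      l j (0, \sum_(i <- s) g i) = \sum_(i <- s) l j (0, g i).
    elim: s => [|i s ih]; first by rewrite !big_nil; exact: l0.
    rewrite !big_cons -ih -lD; congr (l j _).
    by rewrite /GRing.add/=/add_pair/= addr0.
  rewrite {1}[v]matrix_sum_delta.
  under eq_bigr do rewrite big_ord1.
  rewrite ls mxE; apply: eq_bigr => k _; rewrite mxE mulrC.
  rewrite -[RHS]/(v k 0 *: l j (0, delta_mx k 0)) -lZ; congr (l j _).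
  by rewrite /GRing.scale/=/scale_pair/= /GRing.scale/= mulr0.
have [r r0 rf] : exists2 r, 0 < r & forall j (P Q : R * 'cV[R]_N), `|P - (c, x0)| < r ->
    `|Q - (c, x0)| < r -> `|f P.1 P.2 j 0 - f Q.1 Q.2 j 0 - l j (P - Q)| <= e * `|P - Q|.
  apply: fin_radius => [k r r' rr' h w w' wr w'r|k].
    by apply: h; exact: lt_le_trans rr'.
  exact: (lP k).2.
exists r => // u y z ur yr zr; apply: mx_norm_le => [|j k].
  by rewrite mulr_ge0// ltW.
have := rf j (u, y) (u, z); rewrite !prod_normE/= !gt_max ur/= => /(_ yr zr).
have -> : (f u y - f u z - A *m (y - z)) j k = f u y j 0 - f u z j 0 - l j (0, y - z).
  by rewrite (ord1 k) lA !mxE.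
have -> : (u, y) - (u, z) = (0, y - z) :> (R * 'cV[R]_N).
  by rewrite /GRing.add/=/GRing.opp/=/add_pair/= subrr.
by rewrite /= subrr normr0 (max_idPr _).
Qed.

End SmoothStrict.

(** * Linearity and norms of the components of the canonical state *)

Section Projections.
Context {R : realType} {n p nc : nat}.
Local Notation state := (@state R n p nc).

Lemma normr_usubmx m1 m2 (x : 'cV[R]_(m1 + m2)) : `|usubmx x| <= `|x|.
Proof. by apply: mx_norm_le => // i j; rewrite mxE mx_norm_entry. Qed.

Lemma normr_dsubmx m1 m2 (x : 'cV[R]_(m1 + m2)) : `|dsubmx x| <= `|x|.
Proof. by apply: mx_norm_le => // i j; rewrite mxE mx_norm_entry. Qed.

Lemma posD (x y : state) : pos (x + y) = pos x + pos y.
Proof. by apply/matrixP => i j; rewrite !mxE. Qed.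
Lemma velD (x y : state) : vel (x + y) = vel x + vel y.
Proof. by apply/matrixP => i j; rewrite !mxE. Qed.
Lemma parD (x y : state) : par (x + y) = par x + par y.
Proof. by apply/matrixP => i j; rewrite !mxE. Qed.
Lemma posZ a (x : state) : pos (a *: x) = a *: pos x.
Proof. by apply/matrixP => i j; rewrite !mxE. Qed.
Lemma velZ a (x : state) : vel (a *: x) = a *: vel x.
Proof. by apply/matrixP => i j; rewrite !mxE. Qed.
Lemma parZ a (x : state) : par (a *: x) = a *: par x.
Proof. by apply/matrixP => i j; rewrite !mxE. Qed.
Lemma posB (x y : state) : pos (x - y) = pos x - pos y.
Proof. by apply/matrixP => i j; rewrite !mxE. Qed.
Lemma velB (x y : state) : vel (x - y) = vel x - vel y.
Proof. by apply/matrixP => i j; rewrite !mxE. Qed.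
Lemma parB (x y : state) : par (x - y) = par x - par y.
Proof. by apply/matrixP => i j; rewrite !mxE. Qed.
Lemma quadB (x y : state) : quad (x - y) = quad x - quad y.
Proof. by apply/matrixP => i j; rewrite !mxE. Qed.
Lemma norm_pos (x : state) : `|pos x| <= `|x|.
Proof. exact: normr_usubmx. Qed.
Lemma norm_vel (x : state) : `|vel x| <= `|x|.
Proof. exact: le_trans (normr_usubmx _) (normr_dsubmx _). Qed.
Lemma norm_par (x : state) : `|par x| <= `|x|.
Proof. by rewrite (le_trans (normr_usubmx _))// (le_trans (normr_dsubmx _))// normr_dsubmx. Qed.
Lemma mk_stateK (x : state) : mk_state (pos x) (vel x) (par x) (quad x) = x.
Proof. by rewrite /mk_state /pos /vel /par /quad !vsubmxK. Qed.
Lemma norm_mk_state q v r (z : 'cV[R]_nc) c : `|q| <= c -> `|v| <= c -> `|r| <= c ->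
  `|z| <= c -> `|mk_state q v r z : state| <= c.
Proof.
have cmx m1 m2 (a : 'cV[R]_m1) (b : 'cV[R]_m2) : `|a| <= c -> `|b| <= c -> `|col_mx a b| <= c.
  move=> ac bc; apply: mx_norm_le => [|i j]; first exact: le_trans ac.
  by rewrite mxE; case: (fintype.split i) => k; rewrite (le_trans (mx_norm_entry _ _ _)).
by move=> ? ? ? ?; apply: (cmx) => //; apply: (cmx) => //; exact: cmx.
Qed.

End Projections.

Section FieldSmooth.
Context {R : realType} {n p nc : nat}.
Variable H : hybrid_system R n p nc.
Hypothesis smoothH : smooth_system H.

(** The field is assembled block by block from smooth data composed with the linear projections [p3]
    and [p4]; the inverse mass matrix is the only ingredient that is not such a composition. *)
Lemma canonical_rhs_C1 i : C1field (canonical_rhs H i).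
Proof.
move=> c x0; apply: strict_diff_field => j.
pose p4 (P : R * @state R n p nc) : R * 'cV[R]_n * 'cV[R]_n * 'cV[R]_p :=
  (P.1, pos P.2, vel P.2, par P.2).
pose p3 (P : R * @state R n p nc) : R * 'cV[R]_n * 'cV[R]_p := (P.1, pos P.2, par P.2).
have p4_linear : bounded_linear p4.
  split=> [u v|a u|]; first by rewrite /p4 /= posD velD parD.
    by rewrite /p4 /= posZ velZ parZ.
  exists 1 => // v; rewrite mul1r !prod_normE/= !ge_max !le_max lexx/=.
  by rewrite norm_pos norm_vel norm_par !orbT.
have p3_linear : bounded_linear p3.
  split=> [u v|a u|]; first by rewrite /p3 /= posD parD.
    by rewrite /p3 /= posZ parZ.
  exists 1 => // v; rewrite mul1r !prod_normE/= !ge_max !le_max lexx/=.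
  by rewrite norm_pos norm_par !orbT.
have fr3 : fin_frame (R * 'cV[R]_n * 'cV[R]_p)%type.
  apply: fin_frame_prod (fin_frame_cV _); apply: fin_frame_prod (fin_frame_cV _).
  exact: fin_frame_R.
have fr4 : fin_frame (R * 'cV[R]_n * 'cV[R]_n * 'cV[R]_p)%type.
  apply: fin_frame_prod (fin_frame_cV _); apply: fin_frame_prod (fin_frame_cV _).
  by apply: fin_frame_prod (fin_frame_cV _); exact: fin_frame_R.
have velS k l : strict_diff (fun P : R * @state R n p nc => vel P.2 k l) (c, x0).
  exists (fun P => vel P.2 k l).
    split=> [u v|a u|]; first by rewrite /= velD mxE.
      by rewrite /= velZ mxE.
    exists 1 => // v; rewrite mul1r prod_normE le_max; apply/orP; right.
    exact: le_trans (mx_norm_entry _ _ _) (norm_vel _).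
  move=> e e0; exists 1 => // y z _ _.
  by rewrite /= velB !mxE subrr normr0 mulr_ge0// ltW.
apply: (@strict_diff_col_mx _ _ _ _ _ (fun P => vel P.2)) => // k l.
apply: strict_diff_col_mx => {}k {}l.
  apply: strict_diff_mulmx => {}k {}l.
    apply: strict_diff_invmx => [y|a b]; first exact: mass_unit.
    apply: (@strict_diff_comp _ _ _ (fun y => mass H i y.1.1 y.1.2 y.2 a b) p3) => //.
    by apply: strict_diff_C1 => //; exact: smooth_mass smoothH i 1.
  apply: (@strict_diff_comp _ _ _ (fun y => force H i y.1.1.1 y.1.1.2 y.1.2 y.2 k l) p4) => //.
  by apply: strict_diff_C1 => //; exact: smooth_force smoothH i 1.
apply: strict_diff_col_mx => {}k {}l.
  by under eq_fun do rewrite mxE; exact: strict_diff_cst.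
apply: (@strict_diff_comp _ _ _ (fun y => run_cost H i y.1.1.1 y.1.1.2 y.1.2 y.2 k l) p4) => //.
by apply: strict_diff_C1 => //; exact: smooth_run_cost smoothH i 1.
Qed.

End FieldSmooth.

(** * Hybrid trajectories *)

Section Patch.
Context {R : realType}.

Lemma at_right_radius (P : R -> Prop) (a : R) :
  (\forall u \near a^'+, P u) -> exists2 r, 0 < r & forall u, a < u < a + r -> P u.
Proof.
move=> /nbhs_ballP[r /= r0 rP]; exists r => // u /andP[au ur].
by apply: rP => //; rewrite /ball/= ltr_distl; lra.
Qed.

Lemma at_left_radius (P : R -> Prop) (a : R) :
  (\forall u \near a^'-, P u) -> exists2 r, 0 < r & forall u, a - r < u < a -> P u.
Proof.
move=> /nbhs_ballP[r /= r0 rP]; exists r => // u /andP[au ur].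
by apply: rP => //; rewrite /ball/= ltr_distl; lra.
Qed.

Lemma radius_at_right (P : R -> Prop) (a r : R) : 0 < r ->
  (forall u, a < u < a + r -> P u) -> \forall u \near a^'+, P u.
Proof.
move=> r0 rP; near=> u; apply: rP; apply/andP; split; near: u.
  exact: nbhs_right_gt.
by apply: nbhs_right_lt; rewrite ltrDl.
Unshelve. all: by end_near. Qed.

Lemma radius_at_left (P : R -> Prop) (a r : R) : 0 < r ->
  (forall u, a - r < u < a -> P u) -> \forall u \near a^'-, P u.
Proof.
move=> r0 rP; near=> u; apply: rP; apply/andP; split; near: u.
  by apply: nbhs_left_gt; rewrite gtrBl.
exact: nbhs_left_lt.
Unshelve. all: by end_near. Qed.

(** Extending by the one-sided limits, constantly outside the interval, turns a curve known on an
    open interval into the globally continuous curve that [sol] asks for. *)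
Lemma patch_sol N (f : R -> 'cV[R]_N -> 'cV[R]_N) (a b : R) (x : R -> 'cV[R]_N) u0 u1 :
  a < b -> (forall u : R, a < u < b -> is_derive u 1 x (f u (x u))) ->
  x u @[u --> a^'+] --> u0 -> x u @[u --> b^'-] --> u1 ->
  exists X, [/\ sol f a b X, X a = u0, X b = u1 & forall u, a < u < b -> X u = x u].
Proof.
move=> ab xd xa xb.
pose X u := if u <= a then u0 else if b <= u then u1 else x u.
have Xx u : a < u < b -> X u = x u by rewrite /X => /andP[? ?]; rewrite !leNgt ifN ?ifN ?negbK.
have Xa u : u <= a -> X u = u0 by rewrite /X => ->.
have Xb u : b <= u -> X u = u1.
  by move=> bu; rewrite /X bu ifN// -ltNge (lt_le_trans ab).
exists X; split; [split|exact: Xa|exact: Xb|exact: Xx]; last first.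
  move=> u uab; rewrite Xx//; apply: near_eq_is_derive (xd u uab).
  have : u \in `]a, b[ by rewrite in_itv.
  move=> /near_in_itvoo; apply: filterS => w; rewrite in_itv/= => wab.
  by rewrite Xx.
suff XP u e : 0 < e -> exists2 r : R, 0 < r & forall w, `|w - u| < r -> `|X u - X w| <= e.
  move=> u; apply/cvgrPdist_le => e e0; have [r r0 rX] := XP u e e0.
  by apply/nbhs_ballP; exists r => // w; rewrite /ball/= distrC; exact: rX.
move=> e0; have e0' : 0 <= e by exact: ltW.
have [ua|au] := ltP u a.
  exists (a - u); first by rewrite subr_gt0.
  move=> w; rewrite ltr_distl => wu.
  by rewrite !Xa ?subrr ?normr0//; lra.
have [bu|ub] := ltP b u.
  exists (u - b); first by rewrite subr_gt0.
  move=> w; rewrite ltr_distl => wu.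
  by rewrite !Xb ?subrr ?normr0//; lra.
move: au; rewrite le_eqVlt => /predU1P[<-|au].
  have /cvgrPdist_le/(_ _ e0)/at_right_radius[r r0 rx] := xa.
  exists (Num.min r (b - a)); first by rewrite lt_min r0 subr_gt0.
  move=> w; rewrite lt_min => /andP[]; rewrite !ltr_distl => wr wb.
  have [wa|aw] := leP w a; first by rewrite !Xa ?subrr ?normr0.
  by rewrite Xa// Xx ?rx//; lra.
move: ub; rewrite le_eqVlt => /predU1P[->|ub].
  have /cvgrPdist_le/(_ _ e0)/at_left_radius[r r0 rx] := xb.
  exists (Num.min r (b - a)); first by rewrite lt_min r0 subr_gt0.
  move=> w; rewrite lt_min => /andP[]; rewrite !ltr_distl => wr wb.
  have [wa|aw] := leP b w; first by rewrite !Xb ?subrr ?normr0.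
  by rewrite Xb// Xx ?rx//; lra.
have uab : a < u < b by rewrite au.
have xcu : {for u, continuous x}.
  apply: differentiable_continuous; apply/derivable1_diffP.
  exact: (@ex_derive _ _ _ _ _ _ _ (xd u uab)).
have /cvgrPdist_le/(_ _ e0)/nbhs_ballP[r /= r0 rx] := xcu.
exists (Num.min r (Num.min (u - a) (b - u))); first by rewrite !lt_min r0 !subr_gt0 au.
move=> w; rewrite !lt_min => /and3P[]; rewrite !ltr_distl => wr wa wb.
by rewrite !Xx ?rx//; [rewrite /ball/= ltr_distl; lra|lra].
Qed.

End Patch.

Section HybridLayer.
Context {R : realType} {n p nc : nat}.
Variable H : hybrid_system R n p nc.
Hypothesis smoothH : smooth_system H.
Local Notation state := (@state R n p nc).
Implicit Types (x : R -> state) (te : nat -> R).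

(* The next four functions are sealed behind opaque proofs: conversion would
   otherwise unfold them down to the representation of block matrices. *)
Fact jump_state_subproof : {F : nat -> R -> state -> state | forall i t y, F i t y =
  mk_state (pos y) (jump H i t (pos y) (vel y) (par y)) (par y) (quad y)}.
Proof. by eexists. Qed.

Definition jump_state := sval jump_state_subproof.

Lemma jump_stateE i t y : jump_state i t y =
  mk_state (pos y) (jump H i t (pos y) (vel y) (par y)) (par y) (quad y).
Proof. exact: (svalP jump_state_subproof). Qed.

Fact pre_state_subproof : {F : (nat -> R) -> (R -> state) -> nat -> state |
  forall te x i, F te x i =
  mk_state (pos (x (te i))) (left_lim (fun s => vel (x s)) (te i))
    (par (x (te i))) (quad (x (te i)))}.
Proof. by eexists. Qed.

Definition pre_state := sval pre_state_subproof.

Lemma pre_stateE te x i : pre_state te x i =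
  mk_state (pos (x (te i))) (left_lim (fun s => vel (x s)) (te i))
    (par (x (te i))) (quad (x (te i))).
Proof. exact: (svalP pre_state_subproof). Qed.

Fact start_state_subproof :
  {F : R -> nat -> (nat -> R) -> (R -> state) -> nat -> state |
   forall s k te x i, F s k te x i =
     if i == k then x s else jump_state i.-1 (te i.-1) (pre_state te x i.-1)}.
Proof. by eexists. Qed.

Definition start_state := sval start_state_subproof.

Lemma start_stateE s k te x i : start_state s k te x i =
  if i == k then x s else jump_state i.-1 (te i.-1) (pre_state te x i.-1).
Proof. exact: (svalP start_state_subproof). Qed.

Fact end_state_subproof : {F : (nat -> R) -> (R -> state) -> nat -> state |
  forall te x i, F te x i = if (i < nevents H)%N then pre_state te x i else x (tF H)}.
Proof. by eexists. Qed.

Definition end_state := sval end_state_subproof.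

Lemma end_stateE te x i : end_state te x i =
  if (i < nevents H)%N then pre_state te x i else x (tF H).
Proof. exact: (svalP end_state_subproof). Qed.

Lemma pos_mk q v r z : pos (mk_state q v r z : state) = q.
Proof. by rewrite /pos /mk_state col_mxKu. Qed.
Lemma vel_mk q v r z : vel (mk_state q v r z : state) = v.
Proof. by rewrite /vel /mk_state col_mxKd col_mxKu. Qed.
Lemma par_mk q v r z : par (mk_state q v r z : state) = r.
Proof. by rewrite /par /mk_state !col_mxKd col_mxKu. Qed.
Lemma quad_mk q v r z : quad (mk_state q v r z : state) = z.
Proof. by rewrite /quad /mk_state !col_mxKd. Qed.

Lemma cvg_state (F : set_system R) (FF : Filter F) x (y : state) :
  pos (x u) @[u --> F] --> pos y -> vel (x u) @[u --> F] --> vel y ->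
  par (x u) @[u --> F] --> par y -> quad (x u) @[u --> F] --> quad y ->
  x u @[u --> F] --> y.
Proof.
move=> /cvgrPdist_le cq /cvgrPdist_le cv /cvgrPdist_le cr /cvgrPdist_le cz.
apply/cvgrPdist_le => e e0; near=> u.
rewrite -(mk_stateK (y - x u)) norm_mk_state// ?posB ?velB ?parB ?quadB; near: u.
- exact: cq.
- exact: cv.
- exact: cr.
- exact: cz.
Unshelve. all: by end_near. Qed.

Lemma event_pre_cvg i t te x : t = te i -> event_transition H i t x ->
  x u @[u --> t^'-] --> pre_state te x i.
Proof.
move=> -> [_ cq cr cz [cv _]]; rewrite pre_stateE; apply: cvg_state.
- by rewrite pos_mk; apply: cvg_at_left_filter.
- by rewrite vel_mk.
- by rewrite par_mk; apply: cvg_at_left_filter.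
- by rewrite quad_mk; apply: cvg_at_left_filter.
Qed.

Lemma event_post_cvg i t te x : t = te i -> event_transition H i t x ->
  x u @[u --> t^'+] --> jump_state i t (pre_state te x i).
Proof.
move=> -> [_ cq cr cz [_ cv]]; rewrite jump_stateE pre_stateE; apply: cvg_state.
- by rewrite !pos_mk; apply: cvg_at_right_filter.
- by rewrite !vel_mk pos_mk par_mk.
- by rewrite !par_mk; apply: cvg_at_right_filter.
- by rewrite !quad_mk; apply: cvg_at_right_filter.
Qed.

(** All arguments on differential equations use [X] in place of [x]: at an event time the velocity
    of [x] is arbitrary, while [X] ends at the left limit and starts at its image under the jump. *)
Lemma ht_mode s k te x i : hybrid_trajectory H s k te x -> (k <= i <= nevents H)%N ->
  exists X, [/\ sol (canonical_rhs H i) (mode_start s k te i) (mode_end H te i) X,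
    X (mode_start s k te i) = start_state s k te x i,
    X (mode_end H te i) = end_state te x i &
    forall u, mode_start s k te i < u < mode_end H te i -> X u = x u].
Proof.
move=> hx ki; apply: (@patch_sol R _ (canonical_rhs H i) (mode_start s k te i)
  (mode_end H te i) x (start_state s k te x i) (end_state te x i)).
- exact: ht_order hx _ ki.
- by move=> u uI; apply: (ht_ode hx) => //; rewrite in_itv.
- rewrite /mode_start start_stateE; case: eqP => [_|ik]; first exact: ht_start hx.
  have i1 : (k <= i.-1 < nevents H)%N by lia.
  exact: event_post_cvg (ht_event hx i1).
- rewrite /mode_end end_stateE; case: ifP => iN; last exact: ht_end hx.
  by apply: event_pre_cvg (ht_event hx _) => //; rewrite iN andbT; case/andP: ki.
Qed.

Lemma mode_startS s k te i : (k <= i < nevents H)%N ->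
  mode_start s k te i.+1 = mode_end H te i.
Proof.
move=> /andP[ki iN]; rewrite /mode_start /mode_end iN ifN//.
by rewrite neq_ltn; lia.
Qed.

Lemma start_stateS s k te x i : (k <= i)%N ->
  start_state s k te x i.+1 = jump_state i (te i) (pre_state te x i).
Proof. by move=> ki; rewrite start_stateE ifN//=; rewrite neq_ltn; lia. Qed.

Lemma event_pre i t te x : t = te i -> event_transition H i t x ->
  event_fun H i (pos (pre_state te x i)) = 0.
Proof. by move=> -> [? _ _ _ _]; rewrite pre_stateE pos_mk. Qed.

Lemma start_state_first s k te x : start_state s k te x k = x s.
Proof. by rewrite start_stateE eqxx. Qed.

Lemma end_state_event te x i : (i < nevents H)%N -> end_state te x i = pre_state te x i.
Proof. by rewrite end_stateE => ->. Qed.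

Lemma end_state_last te x : end_state te x (nevents H) = x (tF H).
Proof. by rewrite end_stateE ltnn. Qed.

Lemma mode_end_event te i : (i < nevents H)%N -> mode_end H te i = te i.
Proof. by rewrite /mode_end => ->. Qed.

Lemma mode_end_last te : mode_end H te (nevents H) = tF H.
Proof. by rewrite /mode_end ltnn. Qed.

Lemma mode_start_first s k te : mode_start s k te k = s.
Proof. by rewrite /mode_start eqxx. Qed.

(** By uniqueness for the differential equation the trajectories agree up to the earlier end. Were
    that end strictly earlier, it would be an event, and the event function would vanish along the
    other trajectory before its own event, against [ht_armed]. In the last mode both ends are
    [tF H]. *)
Lemma ht_mode_end_unique s s' k te te' x x' i :
  hybrid_trajectory H s k te x -> hybrid_trajectory H s' k te' x' ->
  (k <= i <= nevents H)%N ->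
  mode_start s k te i = mode_start s' k te' i ->
  start_state s k te x i = start_state s' k te' x' i ->
  mode_end H te i <= mode_end H te' i ->
  [/\ mode_end H te i = mode_end H te' i, end_state te x i = end_state te' x' i &
    forall u, mode_start s k te i < u < mode_end H te i -> x u = x' u].
Proof.
move=> hx hx' ki Es Ex le_end.
have [X [Xsol Xs Xe Xx]] := ht_mode hx ki.
have [X' [Xsol' Xs' Xe' Xx']] := ht_mode hx' ki.
move: Ex; rewrite -Xs -Xs' => {Xs Xs'}XX'a.
have st := ht_order hx ki.
have XX' : forall u, mode_start s k te i <= u <= mode_end H te i -> X u = X' u.
  apply: (ode_uniq (ltW st) (canonical_rhs_C1 smoothH i) Xsol).
    by apply: (sol_sub Xsol' _ le_end); rewrite Es.
  by rewrite XX'a Es.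
have Eend : mode_end H te i = mode_end H te' i.
  apply/eqP; rewrite eq_le le_end leNgt /=; apply/negP => lt_end.
  have iN : (i < nevents H)%N.
    rewrite ltnNge; apply/negP => Ni; have iE : i = nevents H by lia.
    by move: lt_end; rewrite iE !mode_end_last ltxx.
  have ki' : (k <= i < nevents H)%N by lia.
  have Ete := mode_end_event te iN; have Ete' := mode_end_event te' iN.
  have h : te i \in `]mode_start s' k te' i, te' i[.
    by rewrite in_itv/= -Ete -Ete' lt_end andbT -Es.
  have := ht_armed hx' ki' h; rewrite -Xx'; last first.
    by rewrite -Ete -Es lt_end st.
  have -> : X' (te i) = pre_state te x i.
    rewrite -Ete -XX' ?Xe ?end_state_event//; by rewrite lexx ltW.
  by rewrite (event_pre erefl (ht_event hx ki')) eqxx.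
split=> //.
  by rewrite -Xe -Xe' -Eend XX'// lexx ltW.
move=> u uI; rewrite -Xx// XX' ?Xx'//; first by rewrite -Es -Eend.
by case/andP: uI => /ltW-> /ltW->.
Qed.

Lemma ht_mode_unique s k te te' x x' :
  hybrid_trajectory H s k te x -> hybrid_trajectory H s k te' x' -> x s = x' s ->
  forall i, (k <= i <= nevents H)%N ->
  [/\ mode_end H te i = mode_end H te' i, end_state te x i = end_state te' x' i &
    forall u, mode_start s k te i < u < mode_end H te i -> x u = x' u].
Proof.
move=> hx hx' xs.
have step i : (k <= i <= nevents H)%N ->
    mode_start s k te i = mode_start s k te' i ->
    start_state s k te x i = start_state s k te' x' i ->
  [/\ mode_end H te i = mode_end H te' i, end_state te x i = end_state te' x' i &
    forall u, mode_start s k te i < u < mode_end H te i -> x u = x' u].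
  move=> ki Es Ex.
  have [le_end|/ltW le_end] := leP (mode_end H te i) (mode_end H te' i).
    exact: (ht_mode_end_unique hx hx').
  have [-> -> h] := ht_mode_end_unique hx' hx ki (esym Es) (esym Ex) le_end.
  by split=> // u uI; rewrite h// -Es.
elim=> [|i ih] ki.
  have k0 : k = 0%N by lia.
  by rewrite -k0 in ki *; apply: step; rewrite ?mode_start_first ?start_state_first//.
have [ik|ki'] := eqVneq i.+1 k.
  by rewrite ik in ki *; apply: step; rewrite ?mode_start_first ?start_state_first//.
have ki1 : (k <= i < nevents H)%N by lia.
have [|E1 E2 _] := ih; first by lia.
have iN : (i < nevents H)%N by lia.
have ki2 : (k <= i)%N by lia.
move: E1 E2; rewrite !(mode_end_event _ iN) !(end_state_event _ _ iN) => E1 E2.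
apply: step => //; first by rewrite !mode_startS ?(mode_end_event _ iN).
by rewrite !start_stateS// E1 E2.
Qed.

Lemma mode_locate s k te (u : R) : (k <= nevents H)%N -> s < u < tF H ->
  (forall i, (k <= i < nevents H)%N -> u != te i) ->
  exists2 i, (k <= i <= nevents H)%N & mode_start s k te i < u < mode_end H te i.
Proof.
move=> kN /andP[su uF] ute.
suff h m i : (m = nevents H - i)%N -> (k <= i <= nevents H)%N -> mode_start s k te i < u ->
    exists2 i, (k <= i <= nevents H)%N & mode_start s k te i < u < mode_end H te i.
  by apply: (h _ k erefl); rewrite ?leqnn// mode_start_first.
elim: m i => [|m ih] i mi ki iu.
  have iE : i = nevents H by lia.
  by exists i => //; rewrite iu iE mode_end_last uF.
have iN : (i < nevents H)%N by lia.
have [ui|iu'] := ltP u (te i).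
  by exists i => //; rewrite iu mode_end_event.
apply: (ih i.+1); [lia|lia|].
rewrite mode_startS ?iN ?andbT; last by case/andP: ki.
by rewrite mode_end_event// lt_neqAle iu' andbT eq_sym ute// iN andbT; case/andP: ki.
Qed.

Lemma ht_unique_val s k te te' x x' u : (k <= nevents H)%N ->
  hybrid_trajectory H s k te x -> hybrid_trajectory H s k te' x' -> x s = x' s ->
  s <= u <= tF H -> (forall i, (k <= i < nevents H)%N -> u != te i) -> x u = x' u.
Proof.
move=> kN hx hx' xs /andP[]; rewrite le_eqVlt => /predU1P[<-//|su].
rewrite le_eqVlt => /predU1P[-> _|uF ute].
  have [|_] := ht_mode_unique hx hx' xs (i := nevents H); first by rewrite kN leqnn.
  by rewrite !end_state_last.
have suF : s < u < tF H by rewrite su.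
have [i ki uI] := mode_locate kN suF ute.
by have [_ _] := ht_mode_unique hx hx' xs ki; apply.
Qed.

(** All hybrid trajectories from the same state have the same final state, so the choice made by
    [xget] has a single possible value. *)
Lemma ht_cost_to_go s k te x : (k <= nevents H)%N -> s <= tF H ->
  hybrid_trajectory H s k te x -> cost_to_go H s k (x s) = cost H x.
Proof.
move=> kN sF hx; rewrite /cost_to_go.
apply: xget_unique; first by exists te, x.
move=> c [te' [x' [hx' xs ->]]]; rewrite /cost.
suff -> : x' (tF H) = x (tF H) by [].
have [|_] := ht_mode_unique hx' hx xs (i := nevents H); first by rewrite kN leqnn.
by rewrite !end_state_last.
Qed.

Lemma ht_te_lt s k te x i : hybrid_trajectory H s k te x ->
  (k <= i <= nevents H)%N -> s <= mode_start s k te i.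
Proof.
move=> hx; elim: i => [|i ih] ki.
  have -> : k = 0%N by lia.
  by rewrite mode_start_first.
have [ik|ki'] := eqVneq i.+1 k; first by rewrite ik mode_start_first.
rewrite mode_startS; last by lia.
by apply: le_trans (ih _) (ltW (ht_order hx _)); lia.
Qed.

Lemma ht_restrict s k te x j t : hybrid_trajectory H s k te x ->
  (k <= j <= nevents H)%N -> mode_start s k te j < t < mode_end H te j ->
  hybrid_trajectory H t j te x.
Proof.
move=> hx kj /andP[jt tj].
have ms i : (j < i)%N -> mode_start t j te i = mode_start s k te i.
  by move=> ji; rewrite /mode_start !ifN// neq_ltn; lia.
have tc : {for t, continuous x}.
  apply: differentiable_continuous; apply/derivable1_diffP.
  have tI : t \in `]mode_start s k te j, mode_end H te j[ by rewrite in_itv/= jt tj.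
  exact: (@ex_derive _ _ _ _ _ _ _ (ht_ode hx kj tI)).
have sub i u : (j <= i <= nevents H)%N -> mode_start t j te i < u ->
    mode_start s k te i < u.
  move=> ji; have [->|ij] := eqVneq i j.
    by rewrite {1}/mode_start eqxx => /(lt_trans jt).
  by rewrite ms//; lia.
split.
- move=> i ji; have [->|ij] := eqVneq i j; first by rewrite {1}/mode_start eqxx.
  by rewrite ms; [apply: (ht_order hx); lia|lia].
- exact: cvg_at_right_filter.
- move=> i ji u; rewrite in_itv/= => /andP[iu ui]; apply: (ht_ode hx); first by lia.
  by rewrite in_itv/= (sub _ _ ji)// ui.
- move=> i ji u; rewrite in_itv/= => /andP[iu ui]; apply: (ht_armed hx); first by lia.
  by rewrite in_itv/= (sub _ _ _ iu) ?ui//; lia.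
- by move=> i ji; apply: (ht_event hx); lia.
- exact: ht_end hx.
Qed.

Lemma mode_at_le te t : (mode_at H te t <= nevents H)%N.
Proof.
rewrite /mode_at -[leqRHS]card_ord -sum1_card; apply: leq_sum => i _.
exact: leq_b1.
Qed.

Lemma ht_te_mono s k te x i j : hybrid_trajectory H s k te x ->
  (k <= i)%N -> (i < j)%N -> (j < nevents H)%N -> te i < te j.
Proof.
move=> hx ki; elim: j => // j ih ij jN.
have h : te j < te j.+1.
  have := ht_order hx (i := j.+1); rewrite /mode_start /mode_end jN ifN; first by apply; lia.
  by rewrite neq_ltn; lia.
by move: ij; rewrite ltnS leq_eqVlt => /predU1P[->//|ij]; apply: lt_trans (ih ij _) h; lia.
Qed.

(** Event times increase, so the events before [t] are exactly those numbered below [j]. *)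
Lemma mode_atE s te x t j : hybrid_trajectory H s 0 te x -> (j <= nevents H)%N ->
  mode_start s 0 te j < t < mode_end H te j -> mode_at H te t = j.
Proof.
move=> hx jN /andP[jt tj]; rewrite /mode_at.
transitivity (\sum_(i < nevents H) (i < j))%N.
  apply: eq_bigr => i _; congr (nat_of_bool _); case: ltnP => [ij|ji].
    have jt' : te j.-1 < t by move: jt; rewrite /mode_start ifN//; lia.
    apply: le_lt_trans jt'; have [->//|ij'] := eqVneq (i : nat) j.-1.
    by apply/ltW/(ht_te_mono hx) => //; lia.
  apply/negbTE; rewrite -leNgt ltW//; apply: lt_le_trans tj _.
  rewrite /mode_end ifT; last by have := ltn_ord i; lia.
  have [->//|ij'] := eqVneq (i : nat) j.
  by apply/ltW/(ht_te_mono hx) => //; have := ltn_ord i; lia.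
rewrite -(big_mkord xpredT (fun i => nat_of_bool (i < j)%N)) (@big_cat_nat _ _ _ j)//=.
rewrite [X in (X + _)%N](eq_big_nat _ _ (F2 := fun=> 1%N)); last by move=> i /andP[_ ->].
rewrite [X in (_ + X)%N]big1_seq ?addn0; last first.
  by move=> i; rewrite mem_index_iota => /andP[_ /andP[ji _]]; rewrite ltnNge ji.
by rewrite sum_nat_const_nat subn0 muln1.
Qed.

End HybridLayer.

(** * Approximate Jacobians *)

Section Approx.
Context {R : realType}.

Lemma near_radius (V : normedModType R) (x : V) (P : V -> Prop) :
  (\forall y \near x, P y) <-> exists2 r : R, 0 < r & forall y, `|y - x| < r -> P y.
Proof.
split.
  move=> /nbhs_ballP[r /= r0 rP]; exists r => // y yx; apply: rP.
  by rewrite -ball_normE /= distrC.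
move=> [r r0 rP]; apply/nbhs_ballP; exists r => // y.
by rewrite -ball_normE /= distrC; exact: rP.
Qed.

Lemma is_diff_eps (V W : normedModType R) (f : V -> W) (df : {linear V -> W}) (x : V) :
  continuous df ->
  (forall e : R, 0 < e -> \forall y \near x, `|f y - f x - df (y - x)| <= e * `|y - x|) ->
  is_diff x f df.
Proof.
move=> dfc fe.
have h : f \o shift x = cst (f x) + df +o_ 0 id.
  apply/eqaddoP => e e0; have /near_radius[r r0 rf] := fe e e0.
  apply/near_radius; exists r => // y; rewrite subr0 => yr.
  have := rf (y + x); rewrite addrK => /(_ yr); apply: le_trans.
  by rewrite !fctE /= opprD addrA.
have dE := diff_unique dfc h.
by apply: DiffDef => //; apply/diff_locallyP; rewrite dE.
Qed.

Lemma differentiable_eps (V W : normedModType R) (f : V -> W) (x : V) :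
  differentiable f x -> forall e : R, 0 < e ->
  \forall y \near x, `|f y - f x - 'd f x (y - x)| <= e * `|y - x|.
Proof.
move=> /diff_locallyP[_ /eqaddoP h] e e0; have /near_radius[r r0 rf] := h e e0.
apply/near_radius; exists r => // y yr.
have := rf (y - x); rewrite subr0 => /(_ yr); apply: le_trans.
by rewrite !fctE /= subrK opprD addrA.
Qed.

Definition approx_at m n (f : 'cV[R]_n -> 'cV[R]_m) x (M : 'M[R]_(m, n)) (c : R) :=
  \forall y \near x, `|f y - f x - M *m (y - x)| <= c * `|y - x|.

Definition lip_at m n (f : 'cV[R]_n -> 'cV[R]_m) x (c : R) :=
  \forall y \near x, `|f y - f x| <= c * `|y - x|.

Lemma jac_mulmx m n (f : 'cV[R]_n -> 'cV[R]_m) x v : 'd f x v = jac f x *m v :> 'cV[R]_m.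
Proof.
rewrite {1}[v]matrix_sum_delta.
under eq_bigr do rewrite big_ord1.
rewrite linear_sum; apply/matrixP => i j; rewrite (ord1 j) summxE mxE.
by apply: eq_bigr => k _; rewrite linearZ !mxE mulrC.
Qed.

Section ApproxTheory.
Variables m n : nat.
Implicit Types (f g : 'cV[R]_n -> 'cV[R]_m) (M : 'M[R]_(m, n)).

Lemma approx_near f g x M c : (\forall y \near x, f y = g y) ->
  approx_at f x M c -> approx_at g x M c.
Proof.
move=> fg; have fgx := nbhs_singleton fg; apply: filterS2 fg => y.
by rewrite fgx => ->.
Qed.

Lemma approx_lip f x M c B : (forall v : 'cV[R]_n, `|M *m v| <= B * `|v|) ->
  approx_at f x M c -> lip_at f x (B + c).
Proof.
move=> MB; apply: filterS => y h.
have := ler_normD (f y - f x - M *m (y - x)) (M *m (y - x)).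
by rewrite subrK; have := MB (y - x); lra.
Qed.

(** Both approximations are tested on a small multiple of [v], and the scale is divided out. *)
Lemma approx_uniq f x M M' c c' : approx_at f x M c -> approx_at f x M' c' ->
  forall v : 'cV[R]_n, `|(M - M') *m v| <= (c + c') * `|v|.
Proof.
move=> fM fM' v; have [r r0 h] := (near_radius x _).1 (filterI fM fM').
have v1 : 0 < `|v| + 1 by rewrite ltr_wpDl.
have [th th0 thv] : exists2 th : R, 0 < th & `|th *: v| < r.
  exists (r / (`|v| + 1)); first by rewrite divr_gt0.
  rewrite normrZ gtr0_norm ?divr_gt0// mulrAC -mulrA gtr_pMr// ltr_pdivrMr//.
  by rewrite mul1r ltrDl.
have [] := h (th *: v + x); first by rewrite addrK.
rewrite addrK; set a := f _ - f _ => h1 h2.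
have : `|(M - M') *m (th *: v)| <= (c + c') * `|th *: v|.
  have := ler_normB (a - M' *m (th *: v)) (a - M *m (th *: v)).
  rewrite [X in `|X| <= _](_ : _ = (M - M') *m (th *: v)); first by lra.
  by rewrite mulmxBl opprB addrC addrA subrK.
by rewrite -scalemxAr !normrZ (gtr0_norm th0) mulrCA ler_pM2l.
Qed.

Lemma differentiable_approx f x c : differentiable f x -> 0 < c ->
  approx_at f x (jac f x) c.
Proof.
move=> df c0; apply: filterS (differentiable_eps df c0) => y.
by rewrite jac_mulmx.
Qed.

Lemma approx_jac f x M c : differentiable f x -> approx_at f x M c ->
  forall v : 'cV[R]_n, `|(jac f x - M) *m v| <= c * `|v|.
Proof.
move=> df fM v; apply/ler_addgt0Pr => e e0.
have v1 : 0 < `|v| + 1 by rewrite ltr_wpDl.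
have ev : 0 < e / (`|v| + 1) by rewrite divr_gt0.
have := approx_uniq (differentiable_approx df ev) fM v.
move=> /le_trans; apply; rewrite mulrDl addrC lerD2l mulrAC -mulrA.
by rewrite ler_piMr ?(ltW e0)// ler_pdivrMr// mul1r lerDl.
Qed.

Lemma mx_norm_mulmx (M : 'M[R]_(m, n)) c : 0 <= c ->
  (forall v : 'cV[R]_n, `|M *m v| <= c * `|v|) -> `|M| <= c.
Proof.
move=> c0 Mc; apply: mx_norm_le => // i j.
have -> : M i j = (M *m delta_mx j 0 : 'cV[R]_m) i 0 by rewrite -colE mxE.
apply: le_trans (mx_norm_entry _ _ _) _; apply: le_trans (Mc _) _.
rewrite ler_piMr//; apply: mx_norm_le => // k l; rewrite mxE.
by case: (_ && _); rewrite ?normr1 ?normr0.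
Qed.

Lemma at_right_cauchy (F : R -> 'M[R]_(m, n)) t :
  (forall e : R, 0 < e -> exists2 h : R, 0 < h & forall s s' : R,
     t < s < t + h -> t < s' < t + h -> `|F s - F s'| <= e) ->
  exists L : 'M[R]_(m, n), F s @[s --> t^'+] --> L.
Proof.
move=> Fc; apply/cvg_ex; apply/cauchy_cvgP; apply: cauchy_exP => e e0.
have e20 : 0 < e / 2 by rewrite divr_gt0.
have [h h0 hF] := Fc _ e20; exists (F (t + h / 2)).
apply: (radius_at_right h0) => s ts /=; rewrite -ball_normE /=.
apply: le_lt_trans (_ : e / 2 < e); last by lra.
by apply: hF => //; lra.
Qed.

Lemma approx_differentiable f x :
  (forall c, 0 < c -> exists M, approx_at f x M c) -> differentiable f x.
Proof.
move=> fM.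
have /choice[M MP] : forall c : R, exists M, 0 < c -> approx_at f x M c.
  move=> c; have [/fM[M ?]|] := boolP (0 < c); first by exists M.
  by exists 0.
have [|L ML] := @at_right_cauchy M 0.
  move=> e e0; exists (e / 2); first by rewrite divr_gt0.
  move=> s s' hs hs'; apply: mx_norm_mulmx => [|v]; first exact: ltW.
  have := @approx_uniq f x (M s) (M s') s s'.
  move=> /(_ _ _ v) h; apply: le_trans (h _ _) _; try (apply: MP; lra).
  by rewrite ler_wpM2r//; lra.
have Lf e : 0 < e -> approx_at f x L e.
  (* [e] is cut into [n + 2] shares: replacing [M s] by [L] costs [n] of them, one for each term of
     a row sum, and the error [s] of [M s] costs one more. *)
  move=> e0; have n1 : 0 < n%:R + 2 :> R by rewrite ltr_wpDl.
  have e1 : 0 < e / (n%:R + 2) by rewrite divr_gt0.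
  have /cvgrPdist_le/(_ _ e1)/at_right_radius[h h0 hL] := ML.
  pose s := Num.min (h / 2) (e / (n%:R + 2)).
  have s0 : 0 < s by rewrite lt_min divr_gt0.
  have sh : s < h by rewrite gt_min ltr_pdivrMr// ltr_pMr// ltr1n.
  have se : s <= e / (n%:R + 2) by rewrite ge_min lexx orbT.
  have := hL s; rewrite add0r s0 sh => /(_ isT) Ls.
  apply: filterS (MP s s0) => y hy.
  have := ler_normB (f y - f x - M s *m (y - x)) ((L - M s) *m (y - x)).
  rewrite [X in `|X| <= _](_ : _ = f y - f x - L *m (y - x)); last first.
    by rewrite mulmxBl opprB addrA subrK.
  move=> /le_trans; apply.
  have : `|(L - M s) *m (y - x)| <= (n%:R * (e / (n%:R + 2))) * `|y - x|.
    apply: mx_norm_le => [|i j]; first by rewrite !mulr_ge0// ltW.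
    rewrite mxE (le_trans (ler_norm_sum _ _ _))//.
    apply: (@le_trans _ _ (\sum_(k < n) (e / (n%:R + 2)) * `|y - x|)).
      apply: ler_sum => k _; rewrite normrM ler_pM ?mx_norm_entry//.
      exact: le_trans (mx_norm_entry _ _ _) Ls.
    by rewrite sumr_const card_ord -[leRHS]mulrA mulr_natl.
  have : s * `|y - x| <= e / (n%:R + 2) * `|y - x| by rewrite ler_wpM2r.
  have : 0 <= e / (n%:R + 2) * `|y - x| by rewrite mulr_ge0// ltW.
  have -> : e * `|y - x| = (n%:R + 2) * (e / (n%:R + 2) * `|y - x|).
    by rewrite mulrA mulrCA divff ?mulr1// lt0r_neq0.
  lra.
pose l : {linear 'cV[R]_n -> 'cV[R]_m} := mulmx L.
have lc : continuous l.
  apply/linear_bounded_continuous/linear_boundedP.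
  have [K K0 LK] := mulmx_bound L.
  exists K; split; first exact: gtr0_real.
  by move=> r Kr v; rewrite (le_trans (LK v))// ler_wpM2r// ltW.
exact: (@ex_diff _ _ _ _ _ _ _ (@is_diff_eps _ _ f l x lc Lf)).
Qed.

End ApproxTheory.

(** The error of [f] is transported by [N], hence the factor [B]; the error of [g] is relative to
    the increment of [f], hence the factor [L]. *)
Lemma approx_comp m n q (f : 'cV[R]_n -> 'cV[R]_m) (g : 'cV[R]_m -> 'cV[R]_q) x M N c d L B :
  0 < L -> 0 <= d -> 0 <= B ->
  approx_at f x M c -> lip_at f x L -> approx_at g (f x) N d ->
  (forall v : 'cV[R]_m, `|N *m v| <= B * `|v|) ->
  approx_at (g \o f) x (N *m M) (B * c + d * L).
Proof.
move=> L0 d0 B0 fM fL gN0 NB; have [r r0 gN] := (near_radius _ _).1 gN0.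
have rL0 : 0 < r / L by rewrite divr_gt0.
have xr : \forall y \near x, `|y - x| < r / L.
  by apply/near_radius; exists (r / L).
apply: filterS (filterI fM (filterI fL xr)) => y [h1 [h2]].
rewrite ltr_pdivlMr// mulrC => h3.
have := gN (f y) (le_lt_trans h2 h3) => h4.
have := ler_normD (g (f y) - g (f x) - N *m (f y - f x)) (N *m (f y - f x - M *m (y - x))).
rewrite (mulmxBr N (f y - f x)) addrA subrK mulmxA => /le_trans; apply.
have := NB (f y - f x - M *m (y - x)); rewrite (mulmxBr N (f y - f x)) mulmxA.
have : d * `|f y - f x| <= d * (L * `|y - x|) by rewrite ler_wpM2l.
have : B * `|f y - f x - M *m (y - x)| <= B * (c * `|y - x|) by rewrite ler_wpM2l.
lra.
Qed.

End Approx.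

(** * One event *)

Section EventStep.
Context {R : realType} {N : nat}.
Implicit Types (f : R -> 'cV[R]_N -> 'cV[R]_N) (X Y : R -> 'cV[R]_N).

(** Around an event only the size of the change of the deviation matters, so the matrix of
    [short_step] is absorbed into a constant [K], in terms of which the steps are shortened
    further. *)
Lemma short_step_lip f c x0 A e : cont_at f c x0 -> sdiff_at f c x0 A -> 0 < e ->
  exists2 K : R, 0 < K & exists2 h, 0 < h & forall t s X Y, t <= s -> `|t - c| < h ->
    `|s - c| < h -> `|X t - x0| < h -> `|Y t - x0| < h -> sol f t s X -> sol f t s Y ->
    `|Y s - Y t - (s - t) *: f c x0| <= e * (s - t) /\
    `|Y s - X s - (Y t - X t)| <= K * (s - t) * `|Y t - X t|.
Proof.
move=> fc fA e0; have [K K0 AK] := mulmx_bound A.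
have [h h0 hloc] := short_step fc fA e0.
exists (K + e); first by rewrite addr_gt0.
exists h => // t s X Y ts tc sc Xt Yt Xsol Ysol.
have [h1 h2] := hloc t s X Y ts tc sc Xt Yt Xsol Ysol; split=> //.
set d := Y t - X t in h2 *.
have := ler_normD (Y s - X s - d - (s - t) *: (A *m d)) ((s - t) *: (A *m d)).
rewrite subrK normrZ ger0_norm ?subr_ge0//.
have : (s - t) * `|A *m d| <= (s - t) * (K * `|d|) by rewrite ler_wpM2l ?subr_ge0.
lra.
Qed.

(* The perturbed trajectory [Y] is stopped at its own event time [t'], before or
   after the event time [c] of the nominal trajectory [X]. *)
Lemma shift_end f c x0 A (e : R) : cont_at f c x0 -> sdiff_at f c x0 A -> 0 < e ->
  exists2 h : R, 0 < h & forall t t' X Y, t <= c -> t <= t' -> `|t - c| < h ->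
    `|t' - c| < h -> `|X t - x0| < h -> `|Y t - x0| < h ->
    sol f t c X -> sol f t t' Y -> X c = x0 ->
    `|Y t' - x0| < e /\
    `|Y t' - x0 - (t' - c) *: f c x0 - (Y t - X t)| <= e * (`|Y t - X t| + `|t' - c|).
Proof.
move=> fc fA e0; pose k : R := Num.min e 1.
have k0 : 0 < k by rewrite lt_min e0 ltr01.
have ke : k <= e by rewrite ge_min lexx.
have k1 : k <= 1 by rewrite ge_min lexx orbT.
have [K K0 [h0 h00 hloc]] := short_step_lip fc fA k0; clearbody k.
set g := f c x0; pose G := 1 + 2 * (`|g| + 1).
have G0 : 0 < G by rewrite /G; have := normr_ge0 g; lra.
(* A solution that starts within [h] of [x0] and runs for less than [2 * h] stays within [h * G] of
   it, which has to be below [h0] and [e]; the last term makes the Lipschitz factor [K * (2 * h)] at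
   most [e]. *)
pose h : R := Num.min (Num.min (h0 / G) (e / G)) (e / (2 * K)).
have h_gt0 : 0 < h by rewrite !lt_min !divr_gt0// mulr_gt0.
have hG : h * G <= h0 by rewrite -ler_pdivlMr// !ge_min lexx.
have heG : h * G <= e by rewrite -ler_pdivlMr// !ge_min lexx orbT.
have hK : h * (2 * K) <= e by rewrite -ler_pdivlMr ?mulr_gt0// !ge_min lexx orbT.
clearbody h.
have hh0 : h <= h0.
  by apply: le_trans hG; rewrite ler_peMr ?ltW// /G; have := normr_ge0 g; lra.
exists h => // t t' X Y tc tt' tch t'ch Xt Yt Xsol Ysol Xc.
have tch0 := lt_le_trans tch hh0; have t'ch0 := lt_le_trans t'ch hh0.
have cch0 : `|c - c| < h0 by rewrite subrr normr0.
have Xt0 := lt_le_trans Xt hh0; have Yt0 := lt_le_trans Yt hh0.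
have ct : c - t < h by move: tch; rewrite ltr_distl; lra.
have ct2 : c - t <= 2 * h by move: h_gt0 ct; clear; lra.
have t't : t' - t < 2 * h by move: tch t'ch; rewrite !ltr_distl; lra.
have far Z u : t <= u -> `|u - c| < h -> `|Z t - x0| < h -> sol f t u Z -> `|Z u - x0| < h * G.
  move=> tu uc Zt Zsol.
  have [h1 _] := hloc t u Z Z tu tch0 (lt_le_trans uc hh0) (lt_le_trans Zt hh0)
    (lt_le_trans Zt hh0) Zsol Zsol.
  have ut : u - t < 2 * h by move: tch uc; rewrite !ltr_distl; lra.
  have := ler_normD (Z u - Z t - (u - t) *: g) (Z t - x0 + (u - t) *: g).
  rewrite [X in `|X| <= _](_ : _ = Z u - x0); last first.
    by apply/matrixP => i j; rewrite !mxE; ring.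
  have := ler_normD (Z t - x0) ((u - t) *: g); rewrite normrZ ger0_norm ?subr_ge0//.
  have : (u - t) * `|g| <= 2 * h * `|g| by rewrite ler_wpM2r// ltW.
  have : k * (u - t) <= 1 * (u - t) by rewrite ler_wpM2r// subr_ge0.
  rewrite /G; lra.
have d0 := normr_ge0 (Y t - X t); have g0 := normr_ge0 g.
have Klip l : 0 <= l -> l <= 2 * h -> K * l * `|Y t - X t| <= e * `|Y t - X t|.
  move=> l0 lh; rewrite ler_wpM2r//.
  have : K * l <= K * (2 * h) by rewrite ler_wpM2l// ltW.
  lra.
split.
  by apply: lt_le_trans heG; apply: far.
(* The curves are compared on the common part of their time intervals; the one that goes on alone,
   [X] in the first case and [Y] in the second, then moves along [f c x0] for the remaining time. *)
have [t'c|ct'] := leP t' c.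
  have Xsol1 := sol_sub Xsol (lexx t) t'c; have Xsol2 := sol_sub Xsol tt' (lexx c).
  have [_ h1] := hloc t t' X Y tt' tch0 t'ch0 Xt0 Yt0 Xsol1 Ysol.
  have Xt' : `|X t' - x0| < h0 by apply: lt_le_trans hG; apply: far.
  have [h2 _] := hloc t' c X X t'c t'ch0 cch0 Xt' Xt' Xsol2 Xsol2.
  have := Klip (t' - t) _ (ltW t't); rewrite subr_ge0 => /(_ tt').
  have : k * (c - t') <= e * (c - t') by rewrite ler_wpM2r// subr_ge0.
  rewrite Xc in h2; rewrite [`|t' - c|]distrC.
  rewrite [X in _ -> _ -> _ <= _ * (_ + X)]ger0_norm ?subr_ge0//.
  have := ler_normB (Y t' - X t' - (Y t - X t)) (x0 - X t' - (c - t') *: g).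
  rewrite [X in `|X| <= _](_ : _ = Y t' - x0 - (t' - c) *: g - (Y t - X t)).
    clear -h1 h2; lra.
  by apply/matrixP => i j; rewrite !mxE; ring.
have Ysol1 := sol_sub Ysol (lexx t) (ltW ct'); have Ysol2 := sol_sub Ysol tc (lexx t').
have [_ h1] := hloc t c X Y tc tch0 cch0 Xt0 Yt0 Xsol Ysol1.
have Yc : `|Y c - x0| < h0.
  by apply: lt_le_trans hG; apply: far => //; rewrite subrr normr0.
have [h2 _] := hloc c t' Y Y (ltW ct') cch0 t'ch0 Yc Yc Ysol2 Ysol2.
have := Klip (c - t) _ ct2; rewrite subr_ge0 => /(_ tc).
have : k * (t' - c) <= e * (t' - c) by rewrite ler_wpM2r// subr_ge0 ltW.
rewrite Xc in h1; rewrite [X in _ -> _ -> _ <= _ * (_ + X)]ger0_norm ?subr_ge0 ?(ltW ct')//.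
have := ler_normD (Y c - x0 - (Y t - X t)) (Y t' - Y c - (t' - c) *: g).
rewrite [X in `|X| <= _](_ : _ = Y t' - x0 - (t' - c) *: g - (Y t - X t)).
  clear -h1 h2; lra.
by apply/matrixP => i j; rewrite !mxE; ring.
Qed.

(** Counterpart of [shift_end] after the event. Up to the later of the two starting times one curve
    moves alone along [f c x0]; from there on the deviation changes little, by the Lipschitz
    bound. *)
Lemma shift_start f c x0 A (e : R) : cont_at f c x0 -> sdiff_at f c x0 A -> 0 < e ->
  exists2 h : R, 0 < h & forall s t' X Y, c <= s -> t' <= s -> `|s - c| < h ->
    `|t' - c| < h -> `|Y t' - x0| < h ->
    sol f c s X -> sol f t' s Y -> X c = x0 ->
    `|Y s - X s - (Y t' - x0 - (t' - c) *: f c x0)| <= e * (`|Y t' - x0| + `|t' - c|).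
Proof.
(* One half of [e] is for the curve that moves alone, the other half for the Lipschitz bound in
   [Klip]. *)
move=> fc fA e0; pose k : R := Num.min (e / 2) 1.
have k0 : 0 < k by rewrite lt_min ltr01 andbT divr_gt0.
have ke : k <= e / 2 by rewrite ge_min lexx.
have k1 : k <= 1 by rewrite ge_min lexx orbT.
have [K K0 [h0 h00 hloc]] := short_step_lip fc fA k0; clearbody k.
set g := f c x0; pose G := `|g| + 2.
have G0 : 0 < G by rewrite /G; have := normr_ge0 g; lra.
pose h : R := Num.min (h0 / (2 * G)) (e / (4 * K * G)).
have h_gt0 : 0 < h by rewrite !lt_min !divr_gt0 ?mulr_gt0.
have hG : h * (2 * G) <= h0 by rewrite -ler_pdivlMr ?mulr_gt0// !ge_min lexx.
have hK : h * (4 * K * G) <= e by rewrite -ler_pdivlMr ?mulr_gt0// !ge_min lexx orbT.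
clearbody h.
have g0 := normr_ge0 g.
have hh0 : h <= h0 by apply: le_trans hG; rewrite ler_peMr ?ltW// /G; lra.
exists h => // s t' X Y cs t's sch t'ch Yt' Xsol Ysol Xc.
have sch0 := lt_le_trans sch hh0; have t'ch0 := lt_le_trans t'ch hh0.
have cch0 : `|c - c| < h0 by rewrite subrr normr0.
have Yt'0 := lt_le_trans Yt' hh0.
have xx0 : `|x0 - x0| < h0 by rewrite subrr normr0.
have sc : s - c < h by move: sch; rewrite ltr_distl; lra.
have sc2 : s - c <= 2 * h by move: h_gt0 sc; clear; lra.
have st' : s - t' < 2 * h by move: sch t'ch; rewrite !ltr_distl; lra.
have y0 := normr_ge0 (Y t' - x0).
have Klip l w : 0 <= l -> l <= 2 * h -> 0 <= w -> w <= `|Y t' - x0| + G * `|t' - c| ->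
    K * l * w <= e / 2 * (`|Y t' - x0| + `|t' - c|).
  move=> l0 lh w0 wG.
  have : K * l * w <= K * (2 * h) * (`|Y t' - x0| + G * `|t' - c|).
    by rewrite ler_pM ?mulr_ge0 ?ler_wpM2l// ltW.
  have : K * (2 * h) * (`|Y t' - x0| + G * `|t' - c|) <=
      K * (2 * h) * (G * `|Y t' - x0| + G * `|t' - c|).
    rewrite ler_wpM2l ?lerD2r ?ler_peMl// ?mulr_ge0 ?(ltW K0) ?(ltW h_gt0)// /G; clear -g0; lra.
  have : h * (4 * K * G) * (`|Y t' - x0| + `|t' - c|) <= e * (`|Y t' - x0| + `|t' - c|).
    by rewrite ler_wpM2r// addr_ge0.
  clear; lra.
have [ct'|t'c] := leP c t'.
  have Xsol1 := sol_sub Xsol (lexx c) t's; have Xsol2 := sol_sub Xsol ct' (lexx s).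
  have xX : `|X c - x0| < h0 by rewrite Xc.
  have [h1 _] := hloc c t' X X ct' cch0 t'ch0 xX xX Xsol1 Xsol1.
  rewrite Xc in h1.
  have tc : `|t' - c| = t' - c by rewrite ger0_norm// subr_ge0.
  have Xt'1 : `|X t' - x0| <= (`|g| + 1) * (t' - c).
    have := ler_normD (X t' - x0 - (t' - c) *: g) ((t' - c) *: g).
    rewrite subrK normrZ tc.
    have : k * (t' - c) <= 1 * (t' - c) by rewrite ler_wpM2r// subr_ge0.
    clear -h1; lra.
  have Xt' : `|X t' - x0| < h0.
    apply: le_lt_trans Xt'1 _; apply: lt_le_trans hG.
    have : (`|g| + 1) * (t' - c) <= (`|g| + 1) * h by rewrite ler_wpM2l ?addr_ge0// -tc ltW.
    have : 0 <= h * `|g| by rewrite mulr_ge0// ltW.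
    clear -h_gt0; rewrite /G; lra.
  have [_ h2] := hloc t' s X Y t's t'ch0 sch0 Xt' Yt'0 Xsol2 Ysol.
  have := Klip (s - t') `|Y t' - X t'| _ (ltW st') (normr_ge0 _).
  rewrite subr_ge0 => /(_ t's).
  have : `|Y t' - X t'| <= `|Y t' - x0| + G * `|t' - c|.
    have := ler_normB (Y t' - x0) (X t' - x0); rewrite opprB addrA subrK tc /G.
    by clear -Xt'1 ct'; lra.
  move=> h3 /(_ h3).
  have : k * (t' - c) <= e / 2 * (t' - c) by rewrite ler_wpM2r// subr_ge0.
  have := ler_normB (Y s - X s - (Y t' - X t')) (X t' - x0 - (t' - c) *: g).
  rewrite [X in `|X| <= _](_ : _ = Y s - X s - (Y t' - x0 - (t' - c) *: g)).
    have : 0 <= e / 2 * `|Y t' - x0| by rewrite mulr_ge0// divr_ge0// ltW.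
    rewrite tc; clear -h1 h2; lra.
  by apply/matrixP => i j; rewrite !mxE; ring.
have Ysol1 := sol_sub Ysol (lexx t') cs; have Ysol2 := sol_sub Ysol (ltW t'c) (lexx s).
have [h1 _] := hloc t' c Y Y (ltW t'c) t'ch0 cch0 Yt'0 Yt'0 Ysol1 Ysol1.
have tc : `|t' - c| = c - t' by rewrite distrC ger0_norm// subr_ge0 ltW.
have Yc1 : `|Y c - x0| <= `|Y t' - x0| + (`|g| + 1) * (c - t').
  have := ler_normD (Y c - Y t' - (c - t') *: g) (Y t' - x0 + (c - t') *: g).
  rewrite [X in `|X| <= _](_ : _ = Y c - x0); last first.
    by apply/matrixP => i j; rewrite !mxE; ring.
  have := ler_normD (Y t' - x0) ((c - t') *: g).
  rewrite normrZ ger0_norm ?subr_ge0 ?(ltW t'c)//.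
  have : k * (c - t') <= 1 * (c - t') by rewrite ler_wpM2r// subr_ge0 ltW.
  clear -h1; lra.
have Yc : `|Y c - x0| < h0.
  apply: le_lt_trans Yc1 _; apply: lt_le_trans hG.
  have : (`|g| + 1) * (c - t') <= (`|g| + 1) * h.
    by rewrite ler_wpM2l ?addr_ge0// -tc ltW.
  have : 0 <= h * `|g| by rewrite mulr_ge0// ltW.
  clear -Yt' h_gt0; rewrite /G; lra.
have xX : `|X c - x0| < h0 by rewrite Xc.
have [_ h2] := hloc c s X Y cs cch0 sch0 xX Yc Xsol Ysol2.
rewrite Xc in h2.
have := Klip (s - c) `|Y c - x0| _ sc2 (normr_ge0 _); rewrite subr_ge0 => /(_ cs).
have : `|Y c - x0| <= `|Y t' - x0| + G * `|t' - c| by rewrite tc /G; clear -Yc1 t'c; lra.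
move=> h3 /(_ h3).
have : k * (c - t') <= e / 2 * (c - t') by rewrite ler_wpM2r// subr_ge0 ltW.
have := ler_normD (Y s - X s - (Y c - x0)) (Y c - Y t' - (c - t') *: g).
rewrite [X in `|X| <= _](_ : _ = Y s - X s - (Y t' - x0 - (t' - c) *: g)).
  have : 0 <= e / 2 * `|Y t' - x0| by rewrite mulr_ge0// divr_ge0// ltW.
  rewrite tc; clear -h1 h2; lra.
by apply/matrixP => i j; rewrite !mxE; ring.
Qed.

(* Derivative of the flow across an event where the vector field changes from [g1]
   to [g2], the event function has differential [p] and the jump map has time
   derivative [j0] and state derivative [J1]. *)
Definition saltation (J1 : 'M[R]_N) (j0 g1 g2 : 'cV[R]_N) (p : 'rV[R]_N) : 'M[R]_N :=
  J1 - (j0 + J1 *m g1 - g2) *m (((p *m g1) 0 0)^-1 *: p).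

(* [D] is the shift of the event time: linearizing [r] along the trajectory
   determines it as [- p v / p g1] up to a small error. *)
Lemma event_time_shift (p : 'rV[R]_N) (g1 : 'cV[R]_N) : (p *m g1) 0 0 != 0 ->
  exists2 C : R, 0 < C & forall (e D : R) (v w : 'cV[R]_N), 0 < e -> e * C <= 1 ->
    `|w - D *: g1 - v| <= e * (`|v| + `|D|) -> `|(p *m w) 0 0| <= e * `|w| ->
    `|D| <= C * `|v| /\ `|D + ((p *m g1) 0 0)^-1 * (p *m v) 0 0| <= e * C * `|v|.
Proof.
set q := (p *m g1) 0 0 => q0; have [P P0 pP] := mulmx_bound p.
have p1 (w : 'cV[R]_N) : `|(p *m w) 0 0| <= P * `|w|.
  by apply: le_trans (pP w); exact: mx_norm_entry.
have qV : 0 < `|q^-1| by rewrite normr_gt0 invr_eq0.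
pose G := `|g1| + 1; have G0 : 0 < G by rewrite ltr_wpDl.
pose C1 := `|q^-1| * (G + 1 + P); have C10 : 0 < C1 by rewrite mulr_gt0//; lra.
pose C2 := 2 * (`|q^-1| * P) + 1; have C20 : 0 < C2 by rewrite /C2; have := mulr_gt0 qV P0; lra.
(* With [e * C <= 1], the summand 1 gives [e <= 1], and [2 * C1] gives [e * C1 <= 1 / 2], so that
   the |D| on the right of the estimate [Da] is absorbed into the left; this leaves |D| <= C2 |v|.
   The last summand is for the final error. *)
pose C := 1 + 2 * C1 + C2 + C1 * (1 + C2).
have C1C2 : 0 < C1 * (1 + C2) by rewrite mulr_gt0//; lra.
exists C; first by rewrite /C; lra.
move=> e D v w e0 eC wDv pw.
have e1 : e <= 1.
  apply: le_trans eC; rewrite ler_peMr ?(ltW e0)// /C; lra.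
have v0 := normr_ge0 v; have D0 := normr_ge0 D.
have wG : `|w| <= (G + 1) * (`|v| + `|D|).
  have := ler_normD (w - D *: g1 - v) (v + D *: g1).
  rewrite [X in `|X| <= _](_ : _ = w); last by apply/matrixP => i j; rewrite !mxE; ring.
  have := ler_normD v (D *: g1); rewrite normrZ.
  have : e * (`|v| + `|D|) <= 1 * (`|v| + `|D|) by rewrite ler_wpM2r// addr_ge0.
  have : 0 <= `|v| * `|g1| by rewrite mulr_ge0.
  rewrite /G; lra.
pose a := (p *m v) 0 0.
have qDa : `|q * D + a| <= e * (G + 1 + P) * (`|v| + `|D|).
  have := ler_normB ((p *m w) 0 0) ((p *m (w - D *: g1 - v)) 0 0).
  rewrite [X in `|X| <= _](_ : _ = q * D + a); last first.
    by rewrite !mulmxBr -scalemxAr !mxE -/a [in RHS]/q [in RHS]/a !mxE; ring.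
  have := p1 (w - D *: g1 - v).
  have : P * `|w - D *: g1 - v| <= P * (e * (`|v| + `|D|)) by rewrite ler_wpM2l// ltW.
  have : e * `|w| <= e * ((G + 1) * (`|v| + `|D|)) by rewrite ler_wpM2l// ltW.
  lra.
have Da : `|D + q^-1 * a| <= e * C1 * (`|v| + `|D|).
  have -> : D + q^-1 * a = q^-1 * (q * D + a) by rewrite mulrDr mulKf.
  rewrite normrM; have := ler_wpM2l (ltW qV) qDa; rewrite /C1; lra.
have eC1 : e * C1 <= 1 / 2.
  have : e * (2 * C1) <= e * C by rewrite ler_wpM2l ?(ltW e0)// /C; lra.
  lra.
have qa : `|q^-1 * a| <= `|q^-1| * P * `|v|.
  by rewrite normrM -mulrA ler_wpM2l// p1.
have DC2 : `|D| <= C2 * `|v|.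
  have := ler_normB (D + q^-1 * a) (q^-1 * a); rewrite addrK.
  have : e * C1 * (`|v| + `|D|) <= 1 / 2 * (`|v| + `|D|) by rewrite ler_wpM2r// addr_ge0.
  rewrite /C2; lra.
split.
  apply: le_trans DC2 _; rewrite ler_wpM2r// /C; lra.
apply: le_trans Da _.
have : e * C1 * `|D| <= e * C1 * (C2 * `|v|) by rewrite ler_wpM2l// mulr_ge0 ?ltW.
have : e * (C1 * (1 + C2)) * `|v| <= e * C * `|v|.
  rewrite ler_wpM2r// ler_wpM2l ?(ltW e0)// /C; lra.
lra.
Qed.

Lemma saltation_mulmx (J1 : 'M[R]_N) (j0 g1 g2 v : 'cV[R]_N) (p : 'rV[R]_N) :
  saltation J1 j0 g1 g2 p *m v =
  J1 *m v - (((p *m g1) 0 0)^-1 * (p *m v) 0 0) *: (j0 + J1 *m g1 - g2).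
Proof.
rewrite /saltation mulmxBl -mulmxA -scalemxAl; congr (_ - _).
rewrite -scalemxAr -scalerA; congr (_ *: _).
by apply/matrixP => i j; rewrite [LHS]mxE big_ord1 [RHS]mxE (ord1 j) mulrC.
Qed.

Lemma jump_bound (J1 : 'M[R]_N) (j0 : 'cV[R]_N) :
  exists2 G : R, 0 < G & forall (k D : R) (w y : 'cV[R]_N), k <= 1 ->
    `|y - (D *: j0 + J1 *m w)| <= k * (`|D| + `|w|) -> `|y| <= G * (`|D| + `|w|).
Proof.
have [L L0 J1L] := mulmx_bound J1; exists (`|j0| + L + 1) => [|k D w y k1 h].
  by have := normr_ge0 j0; lra.
have := ler_normD (y - (D *: j0 + J1 *m w)) (D *: j0 + J1 *m w); rewrite subrK.
have := ler_normD (D *: j0) (J1 *m w); rewrite normrZ; have := J1L w.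
have : k * (`|D| + `|w|) <= 1 * (`|D| + `|w|) by rewrite ler_wpM2r// addr_ge0.
have : 0 <= L * `|D| by rewrite mulr_ge0// ltW.
have : 0 <= `|j0| * `|w| by rewrite mulr_ge0.
lra.
Qed.

(** Here [v] is the initial deviation, [D] the shift of the event time, [w] and [y] the deviations
    of the perturbed trajectory just before and just after its own jump, and [z] the final
    deviation. The four first-order relations hold up to a factor [k]; once they bound [D], [w] and
    [y] by multiples of |v|, every remainder is of order k |v|. *)
Lemma saltation_estimate (J1 : 'M[R]_N) (j0 g1 g2 : 'cV[R]_N) (p : 'rV[R]_N) :
  (p *m g1) 0 0 != 0 ->
  exists2 B : R, 0 < B & forall (k D : R) (v w y z : 'cV[R]_N), 0 < k -> k * B <= 1 ->
    `|w - D *: g1 - v| <= k * (`|v| + `|D|) -> `|(p *m w) 0 0| <= k * `|w| ->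
    `|y - (D *: j0 + J1 *m w)| <= k * (`|D| + `|w|) ->
    `|z - (y - D *: g2)| <= k * (`|y| + `|D|) ->
    `|z - saltation J1 j0 g1 g2 p *m v| <= k * B * `|v|.
Proof.
move=> q0; have [C C0 shift] := event_time_shift q0.
have [L L0 J1L] := mulmx_bound J1; have [G1 G10 yG1] := jump_bound J1 j0.
pose b := j0 + J1 *m g1 - g2.
pose G : R := `|g1| + G1 + `|b| + 2.
have [G1G g1G bG G1'] : [/\ G1 <= G, `|g1| + 2 <= G, `|b| <= G & 1 <= G].
  by rewrite /G; have := normr_ge0 g1; have := normr_ge0 b; split; lra.
clearbody G.
have G0 : 0 <= G by lra.
(* The summands bound, in this order, the four terms of the decomposition [zE] below, the last 1
   being slack; the factor [1 + C] in [B] turns |v| + |D| into |v|. *)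
pose B0 : R := G * (1 + G) + 1 + (1 + G) + L + G + 1.
have GG : 0 <= G * (1 + G) by rewrite mulr_ge0//; lra.
have B00 : 1 <= B0 by rewrite /B0; lra.
pose B := B0 * (1 + C).
exists B => [|k D v w y z k0 kB end1 pw Jw start2].
  by rewrite mulr_gt0//; lra.
have B1C : 1 + C <= B by rewrite ler_peMl//; lra.
have [k1 kC] : k <= 1 /\ k * C <= 1.
  have : k * (1 + C) <= k * B by rewrite ler_wpM2l// ltW.
  have : 0 <= k * C by rewrite mulr_ge0// ltW.
  by move=> kC0 kBC; clear -k0 kB kC0 kBC; split; lra.
have [DC Dq] := shift k D v w k0 kC end1 pw.
have v0 := normr_ge0 v; have D0 := normr_ge0 D; have w0 := normr_ge0 w.
set q := (p *m g1) 0 0 in q0 Dq *; set a := (p *m v) 0 0 in Dq.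
(* An exact identity: the errors after the event, of the jump, and before the event carried through
   the jump, then the error made on [D], whose total coefficient in the final deviation is [b]. *)
have zE : z - saltation J1 j0 g1 g2 p *m v =
    (z - (y - D *: g2)) + (y - (D *: j0 + J1 *m w)) + J1 *m (w - D *: g1 - v)
    + (D + q^-1 * a) *: b.
  rewrite saltation_mulmx /b -/q -/a !mulmxBr -scalemxAr.
  move: (J1 *m v) (J1 *m w) (J1 *m g1) (q^-1 * a) => B1' B2' B3' qa.
  by apply/matrixP => i j; rewrite !mxE; ring.
have wG : `|w| <= G * (`|v| + `|D|).
  have := ler_normD (w - D *: g1 - v) (v + D *: g1).
  rewrite [X in `|X| <= _](_ : _ = w); last by apply/matrixP => i j; rewrite !mxE; ring.
  have := ler_normD v (D *: g1); rewrite normrZ.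
  have : k * (`|v| + `|D|) <= 1 * (`|v| + `|D|) by rewrite ler_wpM2r// addr_ge0.
  have : (`|g1| + 2) * (`|v| + `|D|) <= G * (`|v| + `|D|) by rewrite ler_wpM2r// addr_ge0.
  have : 0 <= `|g1| * `|v| by rewrite mulr_ge0.
  clear -end1 D0; lra.
have yG : `|y| <= G * (`|D| + `|w|).
  by apply: le_trans (yG1 k D w y k1 Jw) _; rewrite ler_wpM2r// addr_ge0.
have E1 := J1L (w - D *: g1 - v).
have E2 : L * `|w - D *: g1 - v| <= L * (k * (`|v| + `|D|)) by rewrite ler_wpM2l// ltW.
have E3 : `|(D + q^-1 * a) *: b| <= (k * C * `|v|) * G by rewrite normrZ ler_pM.
rewrite zE.
set T1 := z - _ in start2 *; set T2 := y - (D *: j0 + _) in Jw *.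
set T3 := J1 *m _ in E1 *; set T4 := _ *: b in E3 *.
have := ler_normD (T1 + T2 + T3) T4; have := ler_normD (T1 + T2) T3.
have := ler_normD T1 T2.
move: (normr_ge0 T4) start2 Jw E1 E2 E3 yG wG DC.
move: `|T1| `|T2| `|T3| `|T4| `|T1 + T2| `|T1 + T2 + T3| `|T1 + T2 + T3 + T4|.
move: `|w - _ - _| v0 D0 w0; move: `|v| `|D| `|w| `|y|.
clear -k0 G0 C0 L0 GG => nv nD nw ny nT nv0 nD0 nw0 n1 n2 n3 n4 n12 n123 n1234.
move=> _ start2 Jw E1 E2 E3 yG wG DC N1 N2 N3.
pose m := (1 + C) * nv.
have Dm : nD <= m by rewrite /m; lra.
have vDm : nv + nD <= m by rewrite /m; lra.
have wm : nw <= G * m by apply: le_trans wG _; rewrite ler_wpM2l.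
have ym : ny <= G * (1 + G) * m.
  by apply: le_trans yG _; rewrite -mulrA ler_wpM2l//; lra.
have F1 : k * (ny + nD) <= k * (G * (1 + G) * m + m).
  by rewrite ler_wpM2l ?(ltW k0)//; lra.
have F2 : k * (nD + nw) <= k * (m + G * m) by rewrite ler_wpM2l ?(ltW k0)//; lra.
have F3 : L * (k * (nv + nD)) <= L * (k * m).
  by rewrite ler_wpM2l ?ler_wpM2l// ltW.
have F4 : k * C * nv * G <= k * m * G.
  rewrite ler_wpM2r// -mulrA ler_wpM2l ?(ltW k0)// /m; lra.
have F5 : 0 <= k * m by rewrite mulr_ge0 ?(ltW k0)//; lra.
have F6 : k * B * nv = k * (G * (1 + G) * m + m) + k * (m + G * m) + L * (k * m)
    + k * m * G + k * m by rewrite /B /B0 /m; ring.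
rewrite F6; clear -start2 Jw E1 E2 E3 N1 N2 N3 F1 F2 F3 F4 F5; lra.
Qed.

(** The perturbed trajectory provides its event time [t']. Its motion up to [t'], its jump and its
    motion after [t'] give the first-order relations of [saltation_estimate], and the vanishing of
    [r] at [Y1 t'] gives the one that determines the time shift. *)
Lemma event_step f1 f2 (c : R) (x1 x2 j0 : 'cV[R]_N) A1 A2 (r : 'cV[R]_N -> R)
    (J : R -> 'cV[R]_N -> 'cV[R]_N) (p : 'rV[R]_N) (J1 : 'M[R]_N) (e : R) :
  cont_at f1 c x1 -> sdiff_at f1 c x1 A1 -> cont_at f2 c x2 -> sdiff_at f2 c x2 A2 ->
  J c x1 = x2 -> r x1 = 0 ->
  (forall e : R, 0 < e -> exists2 h : R, 0 < h & forall w, `|w - x1| < h ->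
    `|r w - r x1 - (p *m (w - x1)) 0 0| <= e * `|w - x1|) ->
  (forall e : R, 0 < e -> exists2 h : R, 0 < h & forall u w, `|u - c| < h ->
    `|w - x1| < h -> `|J u w - J c x1 - ((u - c) *: j0 + J1 *m (w - x1))|
      <= e * (`|u - c| + `|w - x1|)) ->
  (p *m f1 c x1) 0 0 != 0 -> 0 < e ->
  exists2 h : R, 0 < h & forall t s t' X1 X2 Y1 Y2, t <= c -> c <= s -> t <= t' ->
    t' <= s -> `|t - c| < h -> `|s - c| < h -> `|X1 t - x1| < h -> `|Y1 t - x1| < h ->
    sol f1 t c X1 -> sol f1 t t' Y1 -> sol f2 c s X2 -> sol f2 t' s Y2 ->
    X1 c = x1 -> X2 c = x2 -> r (Y1 t') = 0 -> Y2 t' = J t' (Y1 t') ->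
    `|Y2 s - X2 s - saltation J1 j0 (f1 c x1) (f2 c x2) p *m (Y1 t - X1 t)|
      <= e * `|Y1 t - X1 t|.
Proof.
move=> f1c f1A f2c f2A Jx rx rd Jd q0 e0.
set g1 := f1 c x1 in q0 *; set g2 := f2 c x2.
have [B B0 est] := saltation_estimate J1 j0 g2 q0.
have [G G0 yG] := jump_bound J1 j0.
pose k : R := Num.min (Num.min 1 (1 / B)) (e / B).
have k0 : 0 < k by rewrite !lt_min ltr01 !divr_gt0.
have k1 : k <= 1 by rewrite !ge_min lexx.
have kB1 : k * B <= 1 by rewrite -ler_pdivlMr// !ge_min lexx orbT.
have kB : k * B <= e by rewrite -ler_pdivlMr// !ge_min lexx !orbT.
clearbody k.
have [h1 h10 loc2] := shift_start f2c f2A k0.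
have [h2 h20 rd2] := rd _ k0.
have [h3 h30 Jd3] := Jd _ k0.
pose h4 : R := h1 / (2 * G).
have h40 : 0 < h4 by rewrite divr_gt0// mulr_gt0.
have Gh4 : G * (h4 + h4) = h1.
  by rewrite /h4; field; rewrite lt0r_neq0.
clearbody h4.
(* [shift_end] with tolerance [k'] also bounds the distance from [Y1 t'] to [x1] by [k']. This puts
   [Y1 t'] where the expansions of [r] and [J] hold and, through [h4], the state after the jump
   where [shift_start] applies. *)
pose k' : R := Num.min k (Num.min h2 (Num.min h3 h4)).
have k'0 : 0 < k' by rewrite !lt_min k0 h20 h30.
have k'k : k' <= k by rewrite ge_min lexx.
have k'h w : `|w| < k' -> [/\ `|w| < h2, `|w| < h3 & `|w| < h4].
  by rewrite !lt_min => /and4P[].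
clearbody k'.
have [h5 h50 loc1] := shift_end f1c f1A k'0.
exists (Num.min (Num.min h1 h3) (Num.min h4 h5)).
  by rewrite !lt_min h10 h30 h40.
move=> t s t' X1 X2 Y1 Y2 tc cs tt' t's; rewrite !lt_min.
move=> /andP[/andP[tc1 tc3] /andP[tc4 tc5]] /andP[/andP[sc1 sc3] /andP[sc4 sc5]].
move=> /andP[_ /andP[_ X1t5]] /andP[_ /andP[_ Y1t5]].
move=> X1sol Y1sol X2sol Y2sol X1c X2c rY YJ.
have t'h (a : R) : `|t - c| < a -> `|s - c| < a -> `|t' - c| < a.
  by rewrite !ltr_distl; clear -tt' t's; lra.
have t'1 := t'h _ tc1 sc1; have t'3 := t'h _ tc3 sc3; have t'4 := t'h _ tc4 sc4.
have t'5 := t'h _ tc5 sc5.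
have [/k'h[wh2 wh3 wh4] end1] := loc1 t t' X1 Y1 tc tt' tc5 t'5 X1t5 Y1t5 X1sol Y1sol X1c.
have Jw := Jd3 t' (Y1 t') t'3 wh3; rewrite Jx -YJ in Jw.
have yh1 : `|Y2 t' - x2| < h1.
  apply: le_lt_trans (yG k _ _ _ k1 Jw) _.
  by rewrite -Gh4 ltr_pM2l// ltrD.
have start2 := loc2 s t' X2 Y2 cs t's sc1 t'1 yh1 X2sol Y2sol X2c.
have pw := rd2 _ wh2; rewrite rY rx subrr sub0r normrN in pw.
apply: le_trans (ler_wpM2r (normr_ge0 _) kB).
apply: est k0 kB1 _ pw Jw start2.
apply: le_trans end1 _; rewrite ler_wpM2r// addr_ge0//.
Qed.

End EventStep.

(** * The hybrid flow *)

Lemma same_side_lt (R : realType) (a b s e : R) :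
  `|a - b| < e -> e <= `|s - b| -> b < s -> a < s.
Proof.
move=> h1 h2 bs; rewrite ger0_norm ?subr_ge0 ?(ltW bs)// in h2.
by move: h1; rewrite ltr_distl; lra.
Qed.

Lemma same_side_gt (R : realType) (a b s e : R) :
  `|a - b| < e -> e <= `|s - b| -> s < b -> s < a.
Proof.
move=> h1 h2 bs; rewrite distrC ger0_norm ?subr_ge0 ?(ltW bs)// in h2.
by move: h1; rewrite ltr_distl; lra.
Qed.

Section Flow.
Context {R : realType} {n p nc : nat}.
Variable H : hybrid_system R n p nc.
Hypothesis smoothH : smooth_system H.
Variables (te : nat -> R) (x : R -> @state R n p nc).
Hypothesis traj_x : hybrid_trajectory H (t0 H) 0 te x.
Hypothesis stable_x : stable_event_sequence H te x.
Local Notation state := (@state R n p nc).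
Local Notation mode := (mode_at H te).
Local Notation free := (event_free H te).

Lemma ht_end_le s k te' x' i : hybrid_trajectory H s k te' x' ->
  (k <= i <= nevents H)%N -> mode_end H te' i <= tF H.
Proof.
move=> hx'; move mE : (nevents H - i)%N => m.
elim: m i mE => [|m ih] i mE ki.
  have -> : i = nevents H by lia.
  by rewrite mode_end_last.
have kiN : (k <= i < nevents H)%N by lia.
rewrite -(mode_startS s te' kiN).
apply: le_trans (ltW (ht_order hx' _)) (ih i.+1 _ _); lia.
Qed.

Lemma ht_te_lt_tF s k te' x' i : hybrid_trajectory H s k te' x' ->
  (k <= i < nevents H)%N -> te' i < tF H.
Proof.
move=> hx' kiN; have kiN' : (k <= i.+1 <= nevents H)%N by lia.
apply: lt_le_trans (ht_end_le hx' kiN').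
rewrite -(@mode_end_event _ _ _ _ H te' i (andP kiN).2).
by have := ht_order hx' kiN'; rewrite (mode_startS s te' kiN).
Qed.

Lemma event_free_sep s : free s ->
  exists2 e : R, 0 < e & forall i, (i < nevents H)%N -> e <= `|s - te i|.
Proof.
move=> fs; have [e e0 eP] : exists2 e : R, 0 < e & forall i : 'I_(nevents H), e <= `|s - te i|.
  apply: fin_radius => [i r r' rr' h|i]; first exact: le_trans rr' h.
  by exists `|s - te i| => //; rewrite normr_gt0 subr_eq0 fs.
by exists e => // i iN; exact: (eP (Ordinal iN)).
Qed.

Lemma mode_interior t : t0 H < t < tF H -> free t ->
  mode_start (t0 H) 0 te (mode t) < t < mode_end H te (mode t).
Proof.
move=> tI ft; have [j jN tj] := mode_locate (leq0n _) tI (fun i iN => ft i (andP iN).2).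
by rewrite (mode_atE traj_x _ tj)//; lia.
Qed.

Lemma nominal_restrict t : t0 H < t < tF H -> free t ->
  hybrid_trajectory H t (mode t) te x.
Proof.
move=> tI ft; apply: (ht_restrict traj_x) (mode_interior tI ft).
by rewrite mode_at_le.
Qed.

(* The condition [s != te' i] keeps [x' s] determined by [y]: at an event time the
   definition of trajectories leaves the velocity unspecified. *)
Definition flow (t s : R) (y : state) : state :=
  xget 0 [set w | exists te' x', [/\ hybrid_trajectory H t (mode t) te' x', x' t = y,
    (forall i, (mode t <= i < nevents H)%N -> s != te' i) & w = x' s]].

Lemma flow_val t s te' x' : hybrid_trajectory H t (mode t) te' x' -> t <= s <= tF H ->
  (forall i, (mode t <= i < nevents H)%N -> s != te' i) -> flow t s (x' t) = x' s.
Proof.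
move=> hx' ts ste; rewrite /flow; apply: xget_unique; first by exists te', x'.
move=> w [te2 [x2 [hx2 x2t ste2 ->]]].
exact: (ht_unique_val smoothH (mode_at_le _ _ _) hx2 hx' x2t ts ste2).
Qed.

Definition near_nominal (t e : R) (y : state) te' x' :=
  [/\ hybrid_trajectory H t (mode t) te' x', x' t = y &
    forall i, (mode t <= i < nevents H)%N -> `|te' i - te i| < e].

Lemma near_stable t e : t0 H < t < tF H -> free t -> 0 < e ->
  \forall y \near x t, exists te' x', near_nominal t e y te' x'.
Proof.
by move=> tI ft e0; apply: stable_x => //; rewrite in_itv.
Qed.

(** No event time moves by as much as its distance to [s], so none crosses [s], and [s] stays in the
    mode it has for the nominal trajectory. *)
Lemma near_nominal_mode t s e y te' x' : t < s < tF H -> t0 H < t -> free s ->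
  (forall i, (i < nevents H)%N -> e <= `|s - te i|) -> near_nominal t e y te' x' ->
  [/\ (mode t <= mode s)%N, mode_start t (mode t) te' (mode s) < s < mode_end H te' (mode s) &
     forall i, (mode t <= i < nevents H)%N -> s != te' i].
Proof.
move=> /andP[ts sF] t0t fs es [hx' _ close].
have sI : t0 H < s < tF H by rewrite (lt_trans t0t).
have /andP[s1 s2] := mode_interior sI fs.
have ms : (mode t <= mode s)%N.
  apply: leq_sum => i _; have [ti|//] := ltP (te i) t.
  by rewrite (lt_trans ti ts).
have lt_te i : (mode t <= i < nevents H)%N -> te i < s -> te' i < s.
  by move=> iN; apply: same_side_lt (close i iN) (es i (andP iN).2).
have gt_te i : (mode t <= i < nevents H)%N -> s < te i -> s < te' i.
  by move=> iN; apply: same_side_gt (close i iN) (es i (andP iN).2).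
split=> //.
- apply/andP; split.
    have [->|mts] := eqVneq (mode s) (mode t); first by rewrite mode_start_first.
    have ms1 : (mode t <= (mode s).-1 < nevents H)%N.
      by have := mode_at_le H te s; lia.
    move: s1; rewrite /mode_start !ifN//; first exact: lt_te.
    by lia.
  have := mode_at_le H te s; rewrite leq_eqVlt => /predU1P[msN|msN].
    by rewrite msN mode_end_last.
  rewrite mode_end_event//; apply: gt_te; first by rewrite ms.
  by rewrite mode_end_event in s2.
- move=> i iN; have := fs i (andP iN).2; rewrite !neq_lt => /orP[h|h].
    by rewrite gt_te.
  by rewrite lt_te ?orbT.
Qed.

Lemma flow_nominal t s : t0 H < t < tF H -> free t -> t <= s <= tF H ->
  (s = tF H \/ free s) -> flow t s (x t) = x s.
Proof.
move=> tI ft ts fs; apply: (flow_val (nominal_restrict tI ft) ts) => i iN.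
  case: fs => [->|fs]; last by apply: fs; case/andP: iN.
by rewrite gt_eqF// (ht_te_lt_tF (nominal_restrict tI ft) iN).
Qed.

(** The stability hypothesis in terms of [flow]: the event times are allowed to move by less than
    both [e] and the distance from [s] to the nominal events. *)
Lemma near_flow t s (e : R) : t0 H < t -> t < s < tF H -> free t -> free s -> 0 < e ->
  \forall y \near x t, exists te' x', [/\ near_nominal t e y te' x',
    mode_start t (mode t) te' (mode s) < s < mode_end H te' (mode s),
    flow t s y = x' s & hybrid_trajectory H s (mode s) te' x'].
Proof.
move=> t0t /[dup] tsF /andP[ts sF] ft fs e0; have [e1 e10 e1P] := event_free_sep fs.
have tI : t0 H < t < tF H by rewrite t0t (lt_trans ts).
have e2 : 0 < Num.min e e1 by rewrite lt_min e0.
apply: filterS (near_stable tI ft e2) => y [te' [x' nn]].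
have e2P i : (i < nevents H)%N -> Num.min e e1 <= `|s - te i|.
  by move=> iN; apply: le_trans (e1P i iN); rewrite ge_min lexx orbT.
have [ms mI ste] := near_nominal_mode tsF t0t fs e2P nn.
have [hx' x't close] := nn.
exists te', x'; split; [|exact: mI| |].
- split=> [||i iN]; [exact: hx'|exact: x't|].
  by apply: lt_le_trans (close i iN) _; rewrite ge_min lexx.
- by rewrite -x't (flow_val hx' _ ste) ?(ltW ts) ?(ltW sF).
- by apply: ht_restrict hx' _ mI; rewrite ms mode_at_le.
Qed.

Lemma cost_to_go_flow t s : t0 H < t -> t < s < tF H -> free t -> free s ->
  \forall y \near x t, cost_to_go_at H te t y = (cost_to_go_at H te s \o flow t s) y.
Proof.
move=> t0t tsF ft fs; have /andP[ts sF] := tsF.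
apply: filterS (near_flow t0t tsF ft fs ltr01) => y [te' [x' [[hx' <- _] _ /= -> hxs]]].
rewrite /cost_to_go_at (ht_cost_to_go smoothH _ _ hxs) ?mode_at_le ?(ltW sF)//.
by rewrite (ht_cost_to_go smoothH _ _ hx') ?mode_at_le// ltW// (lt_trans ts).
Qed.

Definition end_cost_state (w : state) : 'cV[R]_nc :=
  quad w + end_cost H (tF H) (pos w) (vel w) (par w).

Lemma cost_to_go_end t : t0 H < t < tF H -> free t ->
  \forall y \near x t, cost_to_go_at H te t y = (end_cost_state \o flow t (tF H)) y.
Proof.
move=> tI ft; apply: filterS (near_stable tI ft ltr01) => y [te' [x' [hx' <- _]]].
have /andP[_ tF'] := tI.
rewrite /cost_to_go_at (ht_cost_to_go smoothH _ _ hx') ?mode_at_le ?(ltW tF')//=.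
rewrite (flow_val hx') ?lexx ?(ltW tF')// => i iN.
by rewrite gt_eqF// (ht_te_lt_tF hx' iN).
Qed.

Lemma flow_flow t s u : t0 H < t -> t < s -> s < u < tF H -> free t -> free s -> free u ->
  \forall y \near x t, flow t u y = (flow s u \o flow t s) y.
Proof.
move=> t0t ts suF ft fs fu; have /andP[su uF] := suF.
have [e e0 eP] := event_free_sep fu.
have tsF : t < s < tF H by rewrite ts (lt_trans su).
have tuF : t < u < tF H by rewrite (lt_trans ts su).
apply: filterS (near_flow t0t tsF ft fs e0) => y [te' [x' [nn _ /= -> hxs]]].
have [hx' x't _] := nn.
have [mtu _ ute] := near_nominal_mode tuF t0t fu eP nn.
rewrite -x't (flow_val hx') ?(ltW uF) ?andbT; [|by rewrite ltW// (lt_trans ts)|by []].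
rewrite (flow_val hxs) ?(ltW su) ?(ltW uF)// => i iN; apply: ute.
case/andP: iN => msi ->; rewrite andbT; apply: leq_trans msi.
by apply: leq_sum => j _; have [tj|//] := ltP (te j) t; rewrite (lt_trans tj ts).
Qed.

(** Without an event between [t] and [s], the perturbed trajectories are plain solutions of the
    differential equation. The case of the final time is separate: it serves the last mode, where
    the induction on modes begins. *)
Lemma near_same_mode t s : t0 H < t -> t < s <= tF H -> free t ->
  (s = tF H /\ mode t = nevents H) \/ [/\ s < tF H, free s & mode s = mode t] ->
  \forall y \near x t, exists Y, [/\ sol (canonical_rhs H (mode t)) t s Y, Y t = y &
    Y s = flow t s y].
Proof.
move=> t0t /andP[ts sF] ft [[sE mN]|[sF' fs ms]].
  have tI : t0 H < t < tF H by rewrite t0t -sE.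
  apply: filterS (near_stable tI ft ltr01) => y [te' [x' [hx' x't _]]].
  have mm : (mode t <= mode t <= nevents H)%N by rewrite leqnn mode_at_le.
  have [Y [Ysol Y0 Y1 _]] := ht_mode hx' mm.
  move: Ysol Y0 Y1; rewrite mode_start_first start_state_first => Ysol Y0.
  have -> : mode_end H te' (mode t) = s by rewrite mN mode_end_last.
  have -> : end_state H te' x' (mode t) = x' s by rewrite mN end_state_last sE.
  move=> Y1; exists Y; split.
  - apply: sol_sub Ysol _ _; rewrite ?lexx// sE mN mode_end_last lexx//.
  - by rewrite Y0.
  - rewrite Y1 -x't (flow_val hx') ?(ltW ts)// => i iN.
    by rewrite sE gt_eqF// (ht_te_lt_tF hx' iN).
have tsF : t < s < tF H by rewrite ts.
apply: filterS (near_flow t0t tsF ft fs ltr01) => y [te' [x' [[hx' x't _] mI -> hxs]]].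
have mm : (mode t <= mode t <= nevents H)%N by rewrite leqnn mode_at_le.
have [Y [Ysol Y0 Y1 Yx]] := ht_mode hx' mm.
rewrite ms in mI; have /andP[_ sE] := mI; have Ys := Yx _ mI.
rewrite mode_start_first in Ysol Y0; rewrite start_state_first in Y0.
exists Y; split=> //; last by rewrite Y0.
by apply: sol_sub Ysol _ _; rewrite ?lexx// ltW.
Qed.

Lemma flow_differentiable t s : t0 H < t -> t < s <= tF H -> free t ->
  (s = tF H /\ mode t = nevents H) \/ [/\ s < tF H, free s & mode s = mode t] ->
  differentiable (flow t s) (x t).
Proof.
move=> t0t tsF ft same; have nY := near_same_mode t0t tsF ft same.
have [X [Xsol Xt Xs]] := nbhs_singleton nY; have /andP[ts _] := tsF.
apply: approx_differentiable => c c0.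
have [M [r r0 MP]] := ode_diff (ltW ts) (canonical_rhs_C1 smoothH (mode t)) Xsol c0.
exists M; have xr : \forall y \near x t, `|y - x t| < r.
  by apply/near_radius; exists r.
apply: filterS2 nY xr => y [Y [Ysol <- <-]] Yr; rewrite -Xs -Xt.
by apply: MP => //; rewrite Xt.
Qed.

(** The constant does not depend on [t] and [s]. This uniformity near an event is what makes the
    Jacobians after it bounded and Cauchy. *)
Lemma flow_near_id j (c : R) (x0 : state) :
  exists2 C : R, 0 < C & exists2 h : R, 0 < h & forall t s, t0 H < t -> t < s < tF H ->
    free t -> free s -> mode t = j -> mode s = j -> `|t - c| < h -> `|s - c| < h ->
    `|x t - x0| < h -> approx_at (flow t s) (x t) 1%:M (C * (s - t)).
Proof.
have [fc [A fA]] := canonical_rhs_C1 smoothH j c x0.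
have [K K0 [h h0 hloc]] := short_step_lip fc fA ltr01.
exists K => //; exists h => // t s t0t tsF ft fs mt ms tc sc xt.
have /andP[ts sF] := tsF.
have nY : \forall y \near x t, exists Y, [/\ sol (canonical_rhs H (mode t)) t s Y, Y t = y &
    Y s = flow t s y].
  by apply: near_same_mode; rewrite ?ts ?(ltW sF)//; right; rewrite mt.
have [X [Xsol Xt Xs]] := nbhs_singleton nY.
have xr : \forall y \near x t, `|y - x t| < h - `|x t - x0|.
  by apply/near_radius; exists (h - `|x t - x0|) => //; rewrite subr_gt0.
apply: filterS2 nY xr => y [Y [Ysol Yt <-]] Yr; rewrite -Xs -Xt mul1mx.
rewrite mt in Xsol Ysol.
have Xh : `|X t - x0| < h by rewrite Xt.
have Yh : `|Y t - x0| < h.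
  by have := ler_normD (Y t - x t) (x t - x0); rewrite subrKA Yt; lra.
rewrite -Yt; exact: (hloc t s X Y (ltW ts) tc sc Xh Yh Xsol Ysol).2.
Qed.

End Flow.

(** * The jump matrix as a saltation matrix *)

Section Jacobians.
Context {R : realType}.

Lemma grad_row_mulmx n (r : 'cV[R]_n -> R) x v : 'd r x v = (grad_row r x *m v) 0 0 :> R.
Proof.
rewrite {1}[v]matrix_sum_delta.
under eq_bigr do rewrite big_ord1.
rewrite linear_sum mxE.
by apply: eq_bigr => k _; rewrite linearZ !mxE mulrC.
Qed.

Lemma diff_precomp (U V W : normedModType R) (G : V -> W) (i di : U -> V) u du :
  is_diff u i di -> differentiable G (i u) -> 'd (G \o i) u du = 'd G (i u) (di du) :> W.
Proof.
move=> idi dG; have di' : differentiable i u := ex_diff.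
by rewrite (@diff_comp _ _ _ _ i G)//= (@diff_val _ _ _ _ _ _ _ idi).
Qed.

(** The data are smooth jointly while the jump matrix is made of partial Jacobians; the chain rule
    along the four inclusions of the factors relates them. *)
Lemma diff_tqvr m n p (h : R -> 'cV[R]_n -> 'cV[R]_n -> 'cV[R]_p -> 'cV[R]_m)
    t q v r (a : R) (b c : 'cV[R]_n) (d : 'cV[R]_p) :
  let G := fun y : R * 'cV[R]_n * 'cV[R]_n * 'cV[R]_p => h y.1.1.1 y.1.1.2 y.1.2 y.2 in
  differentiable G (t, q, v, r) ->
  'd G (t, q, v, r) (a, b, c, d) =
    a *: (fun t' => h t' q v r)^`()%classic t + jac (fun q' => h t q' v r) q *m b +
    jac (fun v' => h t q v' r) v *m c + jac (fun r' => h t q v r') r *m d :> 'cV[R]_m.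
Proof.
move=> G dG.
have cst0 (U V : normedModType R) (u : V) (z : U) : is_diff z (fun _ : U => u) (fun=> 0).
  exact: is_diff_cst.
have idd (U : normedModType R) (z : U) : is_diff z (fun u : U => u) (fun u => u).
  exact: is_diff_id.
have i1 : is_diff t (fun t' : R => (t', q, v, r)) (fun a => (a, 0, 0, 0)).
  by do 3 apply: is_diff_pair.
have i2 : is_diff q (fun q' => (t, q', v, r)) (fun a => (0, a, 0, 0)).
  by do 3 apply: is_diff_pair.
have i3 : is_diff v (fun v' => (t, q, v', r)) (fun a => (0, 0, a, 0)).
  by do 3 apply: is_diff_pair.
have i4 : is_diff r (fun r' => (t, q, v, r')) (fun a => (0, 0, 0, a)).
  by do 3 apply: is_diff_pair.
have e1 : 'd G (t, q, v, r) (a, 0, 0, 0) =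
    a *: (fun t' => h t' q v r)^`()%classic t :> 'cV[R]_m.
  rewrite derive1E'; last first.
    exact: (@differentiable_comp _ _ _ _ (fun t' : R => (t', q, v, r)) G).
  rewrite -linearZ /= -[a%:A]/(a * 1 : R) mulr1.
  by rewrite -(diff_precomp a i1 dG).
have e2 : 'd G (t, q, v, r) (0, b, 0, 0) = jac (fun q' => h t q' v r) q *m b :> 'cV[R]_m.
  by rewrite -(jac_mulmx (fun q' => h t q' v r)) -(diff_precomp b i2 dG).
have e3 : 'd G (t, q, v, r) (0, 0, c, 0) = jac (fun v' => h t q v' r) v *m c :> 'cV[R]_m.
  by rewrite -(jac_mulmx (fun v' => h t q v' r)) -(diff_precomp c i3 dG).
have e4 : 'd G (t, q, v, r) (0, 0, 0, d) = jac (fun r' => h t q v r') r *m d :> 'cV[R]_m.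
  by rewrite -(jac_mulmx (fun r' => h t q v r')) -(diff_precomp d i4 dG).
have -> : (a, b, c, d) = (a, 0, 0, 0) + (0, b, 0, 0) + (0, 0, c, 0) + (0, 0, 0, d)
    :> (R * 'cV[R]_n * 'cV[R]_n * 'cV[R]_p)%type.
  have pD (U V : zmodType) (u w : U) (u' w' : V) :
    (u, u') + (w, w') = (u + w, u' + w') by [].
  by rewrite !pD !(addr0, add0r).
have dGD u w : 'd G (t, q, v, r) (u + w) =
    'd G (t, q, v, r) u + 'd G (t, q, v, r) w :> 'cV[R]_m by exact: linearD.
by rewrite !dGD e1 e2 e3 e4.
Qed.

End Jacobians.

(** * First-order expansions of the jump map and of the event function on canonical states *)

Section EventData.
Context {R : realType} {n p nc : nat}.
Variable H : hybrid_system R n p nc.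
Hypothesis smoothH : smooth_system H.
Local Notation state := (@state R n p nc).

(** State derivative of [jump_state]; only the velocity rows differ from the identity. *)
Definition jump_jac (hq hv : 'M[R]_n) (hr : 'M[R]_(n, p)) :
    'M[R]_(n + (n + (p + nc))) :=
  col_mx   (row_mx 1%:M (row_mx 0   (row_mx 0     0)))
  (col_mx  (row_mx hq   (row_mx hv  (row_mx hr    0)))
  (col_mx  (row_mx 0    (row_mx 0   (row_mx 1%:M  0)))
           (row_mx 0    (row_mx 0   (row_mx 0     1%:M))))).

(** Differential of the event function seen on the whole state; it depends on the position alone. *)
Definition event_row (rq : 'rV[R]_n) : 'rV[R]_(n + (n + (p + nc))) :=
  row_mx rq (row_mx 0 (row_mx 0 0)).

Lemma event_row_mulmx rq (w : state) : event_row rq *m w = rq *m pos w.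
Proof.
rewrite -{1}[w]mk_stateK /event_row /mk_state !mul_row_col.
by rewrite !mul0mx !addr0.
Qed.

Lemma jump_jac_mulmx hq hv hr (w : state) : jump_jac hq hv hr *m w =
  mk_state (pos w) (hq *m pos w + hv *m vel w + hr *m par w) (par w) (quad w).
Proof.
rewrite -{1}[w]mk_stateK /jump_jac /mk_state !mul_col_mx !mul_row_col.
by rewrite !mul0mx !mul1mx !(addr0, add0r) addrA.
Qed.

(** The vector field has the velocity in its position block, the acceleration in its velocity block,
    zero in its parameter block and the running cost in its quadrature block. The rank-one
    correction of the saltation matrix therefore only touches the position columns, where it
    produces the blocks A, B and G. *)
Lemma saltation_jump_jac hq hv hr (v1 v2 a1 a2 ht : 'cV[R]_n) (z1 z2 : 'cV[R]_nc)
    (rq : 'rV[R]_n) :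
  let rn := ((rq *m v1) 0 0)^-1 *: rq in
  saltation (jump_jac hq hv hr) (mk_state 0 ht 0 0) (mk_state v1 a1 0 z1)
    (mk_state v2 a2 0 z2) (event_row rq) =
  col_mx   (row_mx (1%:M + (v2 - v1) *m rn) (row_mx 0   (row_mx 0     0)))
  (col_mx  (row_mx (hq - (hq *m v1 - a2 + hv *m a1 + ht) *m rn) (row_mx hv (row_mx hr 0)))
  (col_mx  (row_mx 0      (row_mx 0   (row_mx 1%:M  0)))
           (row_mx ((z2 - z1) *m rn) (row_mx 0   (row_mx 0     1%:M))))).
Proof.
move=> rn; rewrite /saltation jump_jac_mulmx.
rewrite pos_mk vel_mk par_mk quad_mk mulmx0 addr0.
rewrite event_row_mulmx pos_mk -/rn /event_row !scale_row_mx !scaler0 -/rn.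
have -> : mk_state 0 ht 0 0 + mk_state v1 (hq *m v1 + hv *m a1) 0 z1 - mk_state v2 a2 0 z2 =
   mk_state (v1 - v2) (hq *m v1 - a2 + hv *m a1 + ht) 0 (z1 - z2) :> state.
  rewrite /mk_state !opp_col_mx !add_col_mx !add0r oppr0.
  congr (col_mx _ (col_mx _ _)).
  by rewrite -addrA [RHS]addrC (addrAC (hq *m v1)).
rewrite /mk_state !mul_col_mx !mul_mx_row !mulmx0 mul0mx /jump_jac.
rewrite !opp_col_mx !opp_row_mx !add_col_mx !add_row_mx !oppr0 !(addr0, add0r).
by rewrite -!mulNmx !opprB.
Qed.

Lemma jump_state_expansion i (c : R) (w0 : state) : forall e : R, 0 < e ->
  exists2 h : R, 0 < h & forall u w, `|u - c| < h -> `|w - w0| < h ->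
   `|jump_state H i u w - jump_state H i c w0 -
     ((u - c) *: mk_state 0 ((fun t' => jump H i t' (pos w0) (vel w0) (par w0))^`()%classic c) 0 0
      + jump_jac (jac (fun q' => jump H i c q' (vel w0) (par w0)) (pos w0))
          (jac (fun v' => jump H i c (pos w0) v' (par w0)) (vel w0))
          (jac (fun r' => jump H i c (pos w0) (vel w0) r') (par w0)) *m (w - w0))|
   <= e * (`|u - c| + `|w - w0|).
Proof.
move=> e e0.
pose G := fun y : R * 'cV[R]_n * 'cV[R]_n * 'cV[R]_p => jump H i y.1.1.1 y.1.1.2 y.1.2 y.2.
have dG : differentiable G (c, pos w0, vel w0, par w0) by exact: (smooth_jump smoothH i 1).1.
have /near_radius[h h0 hG] := differentiable_eps dG e0.
exists h => // u w uc ww.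
rewrite jump_jac_mulmx posB velB parB quadB !jump_stateE.
have PE : (u, pos w, vel w, par w) - (c, pos w0, vel w0, par w0) =
    (u - c, pos w - pos w0, vel w - vel w0, par w - par w0)
    :> (R * 'cV[R]_n * 'cV[R]_n * 'cV[R]_p)%type by [].
have Pn : `|(u - c, pos w - pos w0, vel w - vel w0, par w - par w0)| <=
    Num.max `|u - c| `|w - w0|.
  rewrite !prod_normE /= !ge_max !le_max lexx /=.
  by rewrite -posB -velB -parB norm_pos norm_vel norm_par !orbT.
have Ph : `|(u - c, pos w - pos w0, vel w - vel w0, par w - par w0)| < h.
  by apply: le_lt_trans Pn _; rewrite gt_max uc.
have := hG (u, pos w, vel w, par w); rewrite PE => /(_ Ph).
rewrite (diff_tqvr (h := jump H i)) // /G /= => hj.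
set a := _ *: _ + _ + _ + _ in hj.
(* The jump is affine in the other blocks, so the whole error lies in the velocity block. *)
rewrite [X in `|X|](_ : _ = mk_state 0 (jump H i u (pos w) (vel w) (par w) -
   jump H i c (pos w0) (vel w0) (par w0) - a) 0 0); last first.
  rewrite /mk_state !scale_col_mx !scaler0 !add_col_mx !opp_col_mx !add_col_mx.
  by rewrite !add0r !subrr /a !addrA.
have bound : 0 <= e * (`|u - c| + `|w - w0|) by rewrite mulr_ge0 ?addr_ge0// ltW.
apply: norm_mk_state; rewrite ?normr0//.
apply: le_trans hj _; rewrite ler_wpM2l ?(ltW e0)//.
by apply: le_trans Pn _; rewrite ge_max lerDl lerDr !normr_ge0.
Qed.

Lemma event_fun_expansion i (w0 : state) : forall e : R, 0 < e ->
  exists2 h : R, 0 < h & forall w, `|w - w0| < h ->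
   `|event_fun H i (pos w) - event_fun H i (pos w0) -
     (event_row (grad_row (event_fun H i) (pos w0)) *m (w - w0)) 0 0|
   <= e * `|w - w0|.
Proof.
move=> e e0.
have dr : differentiable (event_fun H i) (pos w0) by exact: (smooth_event_fun smoothH i 1).1.
have /near_radius[h h0 hr] := differentiable_eps dr e0.
exists h => // w ww; have wn := norm_pos (w - w0); rewrite posB in wn.
have := hr (pos w) (le_lt_trans wn ww); rewrite grad_row_mulmx => hj.
rewrite event_row_mulmx posB.
by apply: le_trans hj _; rewrite ler_wpM2l// ltW.
Qed.

End EventData.

(** * The nominal trajectory and its perturbations around one event *)

Section NearEvent.
Context {R : realType} {n p nc : nat}.
Variable H : hybrid_system R n p nc.
Hypothesis smoothH : smooth_system H.
Variables (te : nat -> R) (x : R -> @state R n p nc).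
Hypothesis traj_x : hybrid_trajectory H (t0 H) 0 te x.
Hypothesis no_grazing_x : no_grazing H te x.
Hypothesis stable_x : stable_event_sequence H te x.
Local Notation state := (@state R n p nc).
Local Notation mode := (mode_at H te).
Local Notation free := (event_free H te).
Local Notation flow := (flow H te).

Lemma interior_free j t : (j <= nevents H)%N ->
  mode_start (t0 H) 0 te j < t < mode_end H te j ->
  [/\ t0 H < t < tF H, free t & mode t = j].
Proof.
move=> jN /[dup] tj /andP[jt tj']; split; last exact: (mode_atE traj_x).
  apply/andP; split; first by apply: le_lt_trans jt; exact: (ht_te_lt traj_x).
  by apply: lt_le_trans tj' (ht_end_le traj_x _).
move=> i iN; have [ij|ji] := ltnP i j.
  rewrite gt_eqF//; move: jt; rewrite /mode_start ifN; last by lia.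
  apply: le_lt_trans; have [->//|ij'] := eqVneq i j.-1.
  by apply/ltW/(ht_te_mono traj_x) => //; lia.
rewrite lt_eqF//; rewrite mode_end_event in tj'; last by lia.
apply: lt_le_trans tj' _; have [->//|ij'] := eqVneq i j.
by apply/ltW/(ht_te_mono traj_x) => //; lia.
Qed.

Lemma nominal_before i : (i < nevents H)%N -> exists X,
  [/\ sol (canonical_rhs H i) (mode_start (t0 H) 0 te i) (te i) X,
      X (te i) = pre_state te x i &
      forall u, mode_start (t0 H) 0 te i < u < te i -> X u = x u].
Proof.
move=> iN; have kiN : (0 <= i <= nevents H)%N by rewrite /= (ltnW iN).
have [X [Xsol _ Xe Xx]] := ht_mode traj_x kiN.
rewrite (mode_end_event te iN) end_state_event// in Xsol Xe Xx.
by exists X.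
Qed.

Lemma nominal_after i : (i < nevents H)%N -> exists X,
  [/\ sol (canonical_rhs H i.+1) (te i) (mode_end H te i.+1) X,
      X (te i) = jump_state H i (te i) (pre_state te x i) &
      forall u, te i < u < mode_end H te i.+1 -> X u = x u].
Proof.
move=> iN; have kiN : (0 <= i.+1 <= nevents H)%N by [].
have kiN' : (0 <= i < nevents H)%N by [].
have [X [Xsol Xs _ Xx]] := ht_mode traj_x kiN.
rewrite (mode_startS _ _ kiN') (mode_end_event te iN) start_stateS// in Xsol Xs Xx.
by exists X.
Qed.

Lemma mode_start_lt_event i : (i < nevents H)%N -> mode_start (t0 H) 0 te i < te i.
Proof.
move=> iN; rewrite -(mode_end_event te iN); apply: ht_order traj_x _ _.
by rewrite /= (ltnW iN).
Qed.

Lemma event_lt_mode_end i : (i < nevents H)%N -> te i < mode_end H te i.+1.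
Proof.
move=> iN; have kiN' : (0 <= i < nevents H)%N by [].
rewrite -[te i](mode_end_event te iN) -(mode_startS (t0 H) te kiN').
exact: ht_order traj_x _ _.
Qed.

Lemma near_before i (h : R) : (i < nevents H)%N -> 0 < h ->
  exists2 r : R, 0 < r & forall t, te i - r < t < te i ->
    [/\ t0 H < t < tF H, free t, mode t = i,
        mode_start (t0 H) 0 te i < t < mode_end H te i &
        `|t - te i| < h /\ `|x t - pre_state te x i| < h].
Proof.
move=> iN h0; have [X [[Xc _] Xe Xx]] := nominal_before iN.
have [r r0 rX] := continuous_ball (te i) Xc h0.
have st := mode_start_lt_event iN.
exists (Num.min (Num.min h r) (te i - mode_start (t0 H) 0 te i)).
  by rewrite !lt_min h0 r0 subr_gt0.
move=> t /andP[]; rewrite ltrBlDl -ltrBlDr !lt_min => /andP[/andP[th tr] ts] tt.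
have tI : mode_start (t0 H) 0 te i < t < te i by lra.
have tI' : mode_start (t0 H) 0 te i < t < mode_end H te i by rewrite mode_end_event.
have [? ? ?] := interior_free (ltnW iN) tI'.
have tE : `|t - te i| = te i - t by rewrite distrC ger0_norm// subr_ge0 ltW.
by split=> //; rewrite tE -Xx// -Xe; split=> //; apply: rX; rewrite tE.
Qed.

Lemma near_after i (h : R) : (i < nevents H)%N -> 0 < h ->
  exists2 r : R, 0 < r & forall t, te i < t < te i + r ->
    [/\ t0 H < t < tF H, free t, mode t = i.+1,
        te i < t < mode_end H te i.+1 &
        `|t - te i| < h /\ `|x t - jump_state H i (te i) (pre_state te x i)| < h].
Proof.
move=> iN h0; have [X [[Xc _] Xe Xx]] := nominal_after iN.
have [r r0 rX] := continuous_ball (te i) Xc h0.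
have st := event_lt_mode_end iN.
exists (Num.min (Num.min h r) (mode_end H te i.+1 - te i)).
  by rewrite !lt_min h0 r0 subr_gt0.
move=> t /andP[tt]; rewrite -ltrBlDl !lt_min => /andP[/andP[th tr] ts].
have tI : te i < t < mode_end H te i.+1 by lra.
have kiN' : (0 <= i < nevents H)%N by [].
have tI' : mode_start (t0 H) 0 te i.+1 < t < mode_end H te i.+1.
  by rewrite (mode_startS _ _ kiN') mode_end_event.
have [? ? ?] := interior_free iN tI'.
have tE : `|t - te i| = t - te i by rewrite ger0_norm// subr_ge0 ltW.
by split=> //; rewrite tE -Xx// -Xe; split=> //; apply: rX; rewrite tE.
Qed.

Lemma v_plusE i : (i < nevents H)%N ->
  v_plus te x i = jump H i (te i) (pos (x (te i))) (v_minus te x i) (par (x (te i))).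
Proof.
move=> iN; have iN' : (0 <= i < nevents H)%N by [].
have [_ _ _ _ [_ vc]] := ht_event traj_x iN'.
exact: cvg_lim vc.
Qed.

(** The right limit [v_plus] is the velocity of the state after the jump by [v_plusE], so the fields
    on the two sides of the event give the accelerations and running costs of [jump_matrix]. *)
Lemma event_saltation i : (i < nevents H)%N ->
  let w0 := pre_state te x i in
  saltation
    (jump_jac (jac (fun q' => jump H i (te i) q' (vel w0) (par w0)) (pos w0))
       (jac (fun v' => jump H i (te i) (pos w0) v' (par w0)) (vel w0))
       (jac (fun r' => jump H i (te i) (pos w0) (vel w0) r') (par w0)))
    (mk_state 0 ((fun t' => jump H i t' (pos w0) (vel w0) (par w0))^`()%classic (te i)) 0 0)
    (canonical_rhs H i (te i) w0)
    (canonical_rhs H i.+1 (te i) (jump_state H i (te i) w0))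
    (event_row (grad_row (event_fun H i) (pos w0))) = jump_matrix H te x i.
Proof.
move=> iN w0; rewrite /canonical_rhs saltation_jump_jac /w0.
rewrite jump_stateE !pos_mk !vel_mk !par_mk pre_stateE pos_mk vel_mk par_mk.
rewrite /jump_matrix /jump_A /jump_B /jump_G /acc_plus /acc_minus /g_plus /g_minus.
by rewrite (v_plusE iN).
Qed.

Lemma flow_event i (e : R) : (i < nevents H)%N -> 0 < e ->
  exists2 h : R, 0 < h & forall t s, te i - h < t < te i -> te i < s < te i + h ->
    approx_at (flow t s) (x t) (jump_matrix H te x i) e.
Proof.
move=> iN e0; pose w0 := pre_state te x i; pose c := te i.
pose w1 := jump_state H i c w0.
have iN' : (0 <= i < nevents H)%N by [].
have [f1c [A1 f1A]] := canonical_rhs_C1 smoothH i c w0.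
have [f2c [A2 f2A]] := canonical_rhs_C1 smoothH i.+1 c w1.
have r0 : event_fun H i (pos w0) = 0 := event_pre erefl (ht_event traj_x iN').
have q0 : (event_row (grad_row (event_fun H i) (pos w0)) *m canonical_rhs H i c w0) 0 0 != 0.
  have := no_grazing_x iN.
  by rewrite event_row_mulmx /canonical_rhs pos_mk /w0 pre_stateE pos_mk vel_mk.
have [h h0 hstep] := event_step (r := fun w => event_fun H i (pos w)) f1c f1A f2c f2A
  erefl r0 (event_fun_expansion smoothH i w0) (jump_state_expansion smoothH i c w0) q0 e0.
rewrite event_saltation// in hstep.
have [rb rb0 before] := near_before iN h0; have [ra ra0 after] := near_after iN h0.
exists (Num.min rb ra); first by rewrite lt_min rb0.
move=> t s /andP[]; rewrite ltrBlDl -ltrBlDr lt_min => /andP[tb _] tc /andP[cs].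
rewrite -ltrBlDl lt_min => /andP[_ sa].
have tI : c - rb < t < c by rewrite tc ltrBlDl -ltrBlDr tb.
have sI : c < s < c + ra by rewrite cs -ltrBlDl sa.
have [t0F ft mt tm [tch xt]] := before t tI.
have [s0F fs ms sm [sch xs]] := after s sI.
have [X1 [X1sol X1c X1x]] := nominal_before iN.
have [X2 [X2sol X2c X2x]] := nominal_after iN.
have /andP[t0t _] := t0F; have /andP[_ sF] := s0F.
have tsF : t < s < tF H by rewrite (lt_trans tc cs).
have tm' : mode_start (t0 H) 0 te i < t < te i by rewrite -(mode_end_event te iN).
have xr : \forall y \near x t, `|y - x t| < h - `|x t - w0|.
  by apply/near_radius; exists (h - `|x t - w0|) => //; rewrite subr_gt0.
have fx : flow t s (x t) = x s.
  by apply: (flow_nominal smoothH traj_x) => //; [rewrite !ltW// (lt_trans tc)|right].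
apply: filterS2 (near_flow smoothH traj_x stable_x t0t tsF ft fs ltr01) xr.
move=> y [te' [x' [[hx' x't _] sI' -> _]]] yr; rewrite fx.
rewrite mt in hx' sI'; rewrite ms in sI'.
have ki : (i <= i <= nevents H)%N by rewrite leqnn ltnW.
have ki' : (i <= i.+1 <= nevents H)%N by rewrite leqnSn.
have kiN : (i <= i < nevents H)%N by rewrite leqnn.
(* The two modes of the perturbed trajectory meet at its own event time [te' i], which is the [t']
   of [event_step]. *)
have [Y1 [Y1sol Y1t Y1e _]] := ht_mode hx' ki.
have [Y2 [Y2sol Y2t _ Y2x]] := ht_mode hx' ki'.
have Y2s := Y2x _ sI'.
rewrite mode_start_first start_state_first mode_end_event// end_state_event// in Y1sol Y1t Y1e.
rewrite (mode_startS _ _ kiN) mode_end_event// start_stateS// in Y2sol Y2t sI'.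
have tt' : t < te' i by have := ht_order hx' ki; rewrite mode_start_first mode_end_event.
have /andP[t's sE] := sI'.
have X1t : X1 t = x t by rewrite X1x.
have X2s : X2 s = x s by rewrite X2x.
rewrite -Y2s -X2s -x't -Y1t -X1t.
have Yw : `|Y1 t - w0| < h.
  have := ler_normD (y - x t) (x t - w0); rewrite subrKA Y1t x't.
  by clear -yr; lra.
have [tm1 _] := andP tm'; have [_ sm2] := andP sm.
apply: (hstep t s (te' i) X1 X2 Y1 Y2); rewrite ?X1t//.
- exact: ltW.
- exact: ltW.
- exact: ltW.
- exact: ltW.
- exact: sol_sub X1sol (ltW tm1) (lexx _).
- exact: sol_sub X2sol (lexx _) (ltW sm2).
- exact: sol_sub Y2sol (lexx _) (ltW sE).
- by rewrite Y1e (event_pre erefl (ht_event hx' kiN)).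
- by rewrite Y1e.
Qed.

End NearEvent.

(** * Limits of the adjoint *)

Lemma point_before (R : realType) (t c h : R) : t < c -> 0 < h ->
  exists t1, [/\ t < t1, t1 < c & c - h < t1].
Proof.
move=> tc h0; exists (Num.max ((t + c) / 2) (c - h / 2)).
by rewrite !lt_max gt_max; split; lra.
Qed.

Lemma point_after (R : realType) (c h1 h2 h3 : R) : 0 < h1 -> 0 < h2 -> 0 < h3 ->
  exists s, [/\ c < s, s < c + h1, s < c + h2 & s < c + h3].
Proof.
move=> h10 h20 h30; pose m := Num.min (Num.min h1 h2) h3.
have m0 : 0 < m by rewrite !lt_min h10 h20.
have m1 : m <= h1 by rewrite !ge_min lexx.
have m2 : m <= h2 by rewrite !ge_min lexx orbT.
have m3 : m <= h3 by rewrite ge_min lexx orbT.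
by clearbody m; exists (c + m / 2); split; lra.
Qed.

Section ApproxComp.
Context {R : realType}.

Lemma near_differentiable m n (f g : 'cV[R]_n -> 'cV[R]_m) x :
  (\forall y \near x, f y = g y) -> differentiable f x -> differentiable g x.
Proof.
move=> fg df; apply: approx_differentiable => c c0; exists (jac f x).
exact: approx_near fg (differentiable_approx df c0).
Qed.

Lemma approx_comp_differentiable m n q (f : 'cV[R]_n -> 'cV[R]_m)
    (g : 'cV[R]_m -> 'cV[R]_q) x M c e B :
  0 <= c -> 0 <= B -> 0 < e -> approx_at f x M c -> differentiable g (f x) ->
  (forall v : 'cV[R]_m, `|jac g (f x) *m v| <= B * `|v|) ->
  approx_at (g \o f) x (jac g (f x) *m M) (B * c + e).
Proof.
move=> c0 B0 e0 fM dg gB; have [K K0 MK] := mulmx_bound M.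
have L0 : 0 < K + c by rewrite ltr_wpDr.
have eL : 0 < e / (K + c) by rewrite divr_gt0.
have := approx_comp L0 (ltW eL) B0 fM (approx_lip MK fM) (differentiable_approx dg eL) gB.
by rewrite divfK// lt0r_neq0.
Qed.

(** The inner map [f] is only approximated, with error [c]; the composite [k] is differentiable, so
    its Jacobian is compared with the product, up to the factor [B * c]. *)
Lemma jac_comp_approx m n q (f : 'cV[R]_n -> 'cV[R]_m) (g : 'cV[R]_m -> 'cV[R]_q)
    (k : 'cV[R]_n -> 'cV[R]_q) x M c B :
  0 <= c -> 0 <= B -> approx_at f x M c -> differentiable g (f x) ->
  (forall v : 'cV[R]_m, `|jac g (f x) *m v| <= B * `|v|) ->
  (\forall y \near x, k y = (g \o f) y) -> differentiable k x ->
  forall v : 'cV[R]_n, `|(jac k x - jac g (f x) *m M) *m v| <= B * c * `|v|.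
Proof.
move=> c0 B0 fM dg gB kgf dk v; apply/ler_addgt0Pr => e e0.
have v1 : 0 < `|v| + 1 by rewrite ltr_wpDl.
have ev : 0 < e / (`|v| + 1) by rewrite divr_gt0.
have gfk : \forall y \near x, (g \o f) y = k y by apply: filterS kgf => y ->.
have := approx_jac dk (approx_near gfk (approx_comp_differentiable c0 B0 ev fM dg gB)) v.
move=> /le_trans; apply; rewrite mulrDl lerD2l mulrAC -mulrA.
by rewrite ler_piMr ?(ltW e0)// ler_pdivrMr// mul1r lerDl.
Qed.

Lemma normr_trmx m n (A : 'M[R]_(m, n)) : `|A^T| = `|A|.
Proof.
have h p q (B : 'M[R]_(p, q)) : `|B^T| <= `|B|.
  by apply: mx_norm_le => // i j; rewrite mxE mx_norm_entry.
by apply/eqP; rewrite eq_le h -{1}[A]trmxK h.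
Qed.

Lemma cvg_trmx (F : set_system R) (FF : Filter F) m n (A : R -> 'M[R]_(m, n))
    (L : 'M[R]_(m, n)) :
  A s @[s --> F] --> L -> (A s)^T @[s --> F] --> L^T.
Proof.
move=> /cvgrPdist_le AL; apply/cvgrPdist_le => e e0.
by apply: filterS (AL e e0) => s; rewrite -linearB normr_trmx.
Qed.

Lemma mulmx_sub_split m n q (L : 'M[R]_(m, n)) (S : 'M[R]_(n, q)) (J : 'M[R]_(m, q))
    (K : 'M[R]_(m, n)) (v : 'cV[R]_q) :
  (L *m S - J) *m v = (L - K) *m (S *m v) - (J - K *m S) *m v.
Proof. by rewrite !mulmxBl !mulmxA opprB addrA subrK. Qed.

End ApproxComp.

(** * Differentiability of the cost-to-go and its Jacobians on both sides of an event *)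

Section Assembly.
Context {R : realType} {n p nc : nat}.
Variable H : hybrid_system R n p nc.
Hypothesis smoothH : smooth_system H.
Variables (te : nat -> R) (x : R -> @state R n p nc).
Hypothesis traj_x : hybrid_trajectory H (t0 H) 0 te x.
Hypothesis no_grazing_x : no_grazing H te x.
Hypothesis stable_x : stable_event_sequence H te x.
Local Notation state := (@state R n p nc).
Local Notation mode := (mode_at H te).
Local Notation free := (event_free H te).
Local Notation flow := (flow H te).
Local Notation psi := (cost_to_go_at H te).

Lemma end_cost_state_differentiable (w : state) : differentiable (@end_cost_state R n p nc H) w.
Proof.
pose G := fun y : R * 'cV[R]_n * 'cV[R]_n * 'cV[R]_p => end_cost H y.1.1.1 y.1.1.2 y.1.2 y.2.
have dG : differentiable G (tF H, pos w, vel w, par w).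
  exact: (smooth_end_cost smoothH 1).1.
apply: approx_differentiable => c c0.
exists (row_mx (jac (fun q' => end_cost H (tF H) q' (vel w) (par w)) (pos w))
  (row_mx (jac (fun v' => end_cost H (tF H) (pos w) v' (par w)) (vel w))
  (row_mx (jac (fun r' => end_cost H (tF H) (pos w) (vel w) r') (par w)) 1%:M))).
have /near_radius[h h0 hG] := differentiable_eps dG c0.
apply/near_radius; exists h => // y yw.
rewrite -[X in _ *m X]mk_stateK /mk_state !mul_row_col mul1mx posB velB parB quadB.
have PE : (tF H, pos y, vel y, par y) - (tF H, pos w, vel w, par w) =
    (0, pos y - pos w, vel y - vel w, par y - par w)
    :> (R * 'cV[R]_n * 'cV[R]_n * 'cV[R]_p)%type.
  by rewrite -(subrr (tF H)).
have Pn : `|((0 : R), pos y - pos w, vel y - vel w, par y - par w)| <= `|y - w|.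
  rewrite !prod_normE /= !ge_max normr0 normr_ge0 /=.
  by rewrite -posB -velB -parB norm_pos norm_vel norm_par.
have := hG (tF H, pos y, vel y, par y); rewrite PE => /(_ (le_lt_trans Pn yw)).
rewrite (diff_tqvr (h := end_cost H)) // /G /= scale0r add0r => hj.
set a := _ *m _ + _ + _ in hj.
rewrite /end_cost_state [X in `|X|](_ : _ = end_cost H (tF H) (pos y) (vel y) (par y) -
   end_cost H (tF H) (pos w) (vel w) (par w) - a).
  by apply: le_trans hj _; rewrite ler_wpM2l// ltW.
have alg (qy ey qw ew a1 a2 a3 : 'cV[R]_nc) :
    qy + ey - (qw + ew) - (a1 + (a2 + (a3 + (qy - qw)))) = ey - ew - (a1 + a2 + a3).
  by apply/matrixP => i j; rewrite !mxE; ring.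
exact: alg.
Qed.

(** The cost-to-go at [s] is the one at [s'] composed with a flow close to the identity, so the
    Jacobians are Lipschitz in time once they are bounded. The bound itself comes from the same
    comparison with a single reference time [s1]. *)
Lemma jac_bound_after i : (i < nevents H)%N ->
  (forall t, t0 H < t < tF H -> free t -> mode t = i.+1 -> differentiable (psi t) (x t)) ->
  exists2 C : R, 0 < C & exists2 B : R, 0 < B & exists2 h : R, 0 < h &
    (forall s, te i < s < te i + h -> forall v : state, `|jac (psi s) (x s) *m v| <= B * `|v|) /\
    (forall s s', te i < s -> s < s' -> s' < te i + h -> forall v : state,
      `|(jac (psi s) (x s) - jac (psi s') (x s')) *m v| <= C * (s' - s) * `|v|).
Proof.
move=> iN dpsi.
have [C C0 [h0 h00 near_id]] := flow_near_id smoothH traj_x stable_x i.+1 (te i)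
  (jump_state H i (te i) (pre_state te x i)).
have [r r0 after] := near_after traj_x iN h00.
have step B s s' : 0 <= B -> te i < s -> s < s' -> s' < te i + r ->
    (forall v : state, `|jac (psi s') (x s') *m v| <= B * `|v|) ->
    forall v : state, `|(jac (psi s) (x s) - jac (psi s') (x s')) *m v|
      <= B * (C * (s' - s)) * `|v|.
  move=> B0 ts ss' s'r Bv v.
  have sI : te i < s < te i + r by rewrite ts (lt_trans ss').
  have s'I : te i < s' < te i + r by rewrite (lt_trans ts).
  have [sF fs ms _ [sh xs]] := after s sI; have [s'F fs' ms' _ [s'h _]] := after s' s'I.
  have /andP[t0s _] := sF; have /andP[_ s'F'] := s'F.
  have ss'F : s < s' < tF H by rewrite ss'.
  have ap := near_id s s' t0s ss'F fs fs' ms ms' sh s'h xs.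
  have fx : flow s s' (x s) = x s'.
    by apply: (flow_nominal smoothH traj_x) => //; [rewrite !ltW|right].
  have c0 : 0 <= C * (s' - s) by rewrite mulr_ge0 ?subr_ge0 ?ltW.
  have := jac_comp_approx (g := psi s') c0 B0 ap _ _
    (cost_to_go_flow smoothH traj_x stable_x t0s ss'F fs fs') (dpsi s sF fs ms) v.
  rewrite fx mulmx1; apply; [exact: dpsi|exact: Bv].
pose s1 := te i + r / 2.
have [B1 B10 B1v] := mulmx_bound (jac (psi s1) (x s1)).
pose B := B1 * (C * r) + B1.
have B0 : 0 < B by rewrite addr_gt0// !mulr_gt0.
have Bh s : te i < s < te i + r / 2 -> forall v : state, `|jac (psi s) (x s) *m v| <= B * `|v|.
  move=> /andP[ts ss1] v.
  have := step B1 s s1 (ltW B10) ts ss1 _ B1v v.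
  have s1r : s1 < te i + r by rewrite /s1; lra.
  move=> /(_ s1r).
  have := ler_normD ((jac (psi s) (x s) - jac (psi s1) (x s1)) *m v) (jac (psi s1) (x s1) *m v).
  rewrite mulmxBl subrK; have := B1v v.
  have : B1 * (C * (s1 - s)) * `|v| <= B1 * (C * r) * `|v|.
    rewrite ler_wpM2r// ler_wpM2l ?(ltW B10)// ler_wpM2l ?(ltW C0)// /s1; lra.
  move=> h1 h2 h3 h4; rewrite /B mulrDl.
  exact: le_trans h3 (lerD (le_trans h4 h1) h2).
clearbody B; exists (B * C); first exact: mulr_gt0.
exists B => //; exists (r / 2); first exact: divr_gt0.
split=> [|s s' ts ss' s'r v]; first exact: Bh.
have s'I : te i < s' < te i + r / 2 by rewrite (lt_trans ts).
have s'r' : s' < te i + r by apply: lt_trans s'r _; lra.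
rewrite -(mulrA B C (s' - s)).
exact: (step B s s' (ltW B0) ts ss' s'r' (Bh s' s'I) v).
Qed.

(** [flow_event] has a small error only for times close to the event. For each accuracy [c], the
    evolution is cut at [t1] and [s1], chosen close enough for [c], and the three pieces are
    composed; for [t] far from the event, a smooth flow first leads close to it. *)
Lemma psi_differentiable_step i : (i < nevents H)%N ->
  (forall t, t0 H < t < tF H -> free t -> mode t = i.+1 -> differentiable (psi t) (x t)) ->
  forall t, t0 H < t < tF H -> free t -> mode t = i -> differentiable (psi t) (x t).
Proof.
move=> iN dpsi.
have [_ _ [B B0 [hB hB0 [Bv _]]]] := jac_bound_after iN dpsi.
have [C C0 [h0 h00 near_id]] := flow_near_id smoothH traj_x stable_x i (te i)
  (pre_state te x i).
have [r r0 before] := near_before traj_x iN h00.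
have [ra ra0 after] := near_after traj_x iN h00.
set S := jump_matrix H te x i.
have [K K0 SK] := mulmx_bound S.
(* A Lipschitz bound for the flow from [t] to [t1] that holds for every [t1] before the event; [e]
   can thus be fixed before [t1], which depends on it. *)
pose L1 := 1 + C * r.
have L10 : 0 < L1 by rewrite addr_gt0// mulr_gt0.
have near_case t : te i - r < t < te i -> differentiable (psi t) (x t).
  move=> tI; have [tT ft mt _ [th xt]] := before t tI; have /andP[t0t _] := tT.
  have /andP[tr ti] := tI.
  apply: approx_differentiable => c c0.
  (* Of the accuracy [c], a quarter goes to the event, a quarter through [c1] to the motion up to
     [t1], and a half to the cost-to-go at [s1]. *)
  pose e := c / (4 * B * L1); have e0 : 0 < e by rewrite divr_gt0 ?mulr_gt0.
  have eE : B * (e * L1) = c / 4.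
    by rewrite /e; field; rewrite !lt0r_neq0.
  clearbody e.
  have [he he0 ev] := flow_event smoothH traj_x no_grazing_x stable_x iN e0.
  have [t1 [tt1 t1i t1he]] := point_before ti he0.
  have [s1 [is1 s1he s1hB s1r]] := point_after (te i) he0 hB0 ra0.
  have t1I : te i - r < t1 < te i by rewrite t1i andbT (lt_trans tr).
  have s1I : te i < s1 < te i + ra by rewrite is1.
  have [t1F ft1 mt1 _ [t1h xt1]] := before t1 t1I.
  have [s1F fs1 ms1 _ _] := after s1 s1I.
  have /andP[t0t1 t1F'] := t1F; have /andP[_ s1F'] := s1F.
  have tt1F : t < t1 < tF H by rewrite tt1.
  have ts1F : t < s1 < tF H by rewrite (lt_trans tt1)// (lt_trans t1i).
  have fx1 : flow t t1 (x t) = x t1.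
    by apply: (flow_nominal smoothH traj_x) => //; [rewrite !ltW|right].
  have fx2 : flow t s1 (x t) = x s1.
    apply: (flow_nominal smoothH traj_x) => //; last by right.
    by rewrite !ltW//; case/andP: ts1F.
  have lip1 : lip_at (flow t t1) (x t) L1.
    have id1 (v : state) : `|1%:M *m v| <= 1 * `|v| by rewrite mul1mx mul1r.
    have := approx_lip id1 (near_id t t1 t0t tt1F ft ft1 mt mt1 th t1h xt).
    apply: filterS => y /le_trans; apply; rewrite ler_wpM2r// lerD2l ler_wpM2l ?(ltW C0)//.
    by lra.
  have d1 : differentiable (flow t t1) (x t).
    apply: (flow_differentiable smoothH traj_x stable_x) => //.
      by rewrite tt1 ltW.
    by right; rewrite mt mt1.
  pose c1 := c / (4 * B * K); have c10 : 0 < c1 by rewrite divr_gt0 ?mulr_gt0.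
  have c1E : B * (K * c1) = c / 4 by rewrite /c1; field; rewrite !lt0r_neq0.
  clearbody c1.
  have ev1 : approx_at (flow t1 s1) (flow t t1 (x t)) S e.
    by rewrite fx1; apply: ev; rewrite ?t1i ?is1 ?s1he ?andbT.
  have ap := approx_comp L10 (ltW e0) (ltW K0) (differentiable_approx d1 c10) lip1 ev1 SK.
  have s1FF : t1 < s1 < tF H by rewrite (lt_trans t1i).
  have ff : \forall y \near x t, (flow t1 s1 \o flow t t1) y = flow t s1 y.
    by apply: filterS (flow_flow smoothH traj_x stable_x t0t tt1 s1FF ft ft1 fs1) => y ->.
  have ap2 := approx_near ff ap.
  have c2 : 0 <= K * c1 + e * L1 by rewrite addr_ge0// mulr_ge0 ?ltW.
  have c20 : 0 < c / 2 by rewrite divr_gt0.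
  have Bs1 : forall v : state, `|jac (psi s1) (x s1) *m v| <= B * `|v|.
    by apply: Bv; rewrite is1.
  have := approx_comp_differentiable (g := psi s1) c2 (ltW B0) c20 ap2.
  rewrite fx2 => /(_ (dpsi s1 s1F fs1 ms1) Bs1) ap3.
  have cE : B * (K * c1 + e * L1) + c / 2 = c by rewrite mulrDr c1E eE; field.
  rewrite cE in ap3.
  have pf : \forall y \near x t, (psi s1 \o flow t s1) y = psi t y.
    by apply: filterS (cost_to_go_flow smoothH traj_x stable_x t0t ts1F ft fs1) => y ->.
  by eexists; exact: approx_near pf ap3.
move=> t tT ft mt; have /andP[t0t _] := tT.
have := mode_interior traj_x tT ft; rewrite mt mode_end_event// => /andP[_ ti].
have [t1 [tt1 t1i t1r]] := point_before ti r0.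
have t1I : te i - r < t1 < te i by rewrite t1r.
have [t1F ft1 mt1 _ _] := before t1 t1I; have /andP[_ t1F'] := t1F.
have tt1F : t < t1 < tF H by rewrite tt1.
have pf : \forall y \near x t, (psi t1 \o flow t t1) y = psi t y.
  by apply: filterS (cost_to_go_flow smoothH traj_x stable_x t0t tt1F ft ft1) => y ->.
apply: near_differentiable pf _; apply: differentiable_comp.
  apply: (flow_differentiable smoothH traj_x stable_x) => //.
    by rewrite tt1 ltW.
  by right; rewrite mt mt1.
rewrite (flow_nominal smoothH traj_x) => //; [exact: near_case|by rewrite !ltW|by right].
Qed.

Lemma psi_differentiable t : t0 H < t < tF H -> free t -> differentiable (psi t) (x t).
Proof.
suff h m i : (m + i = nevents H)%N -> forall t, t0 H < t < tF H -> free t -> mode t = i ->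
    differentiable (psi t) (x t).
  move=> tT ft; apply: (h (nevents H - mode t)%N (mode t)) => //.
  by rewrite subnK// mode_at_le.
elim: m i {t} => [|m ih] i miN; last first.
  have iN : (i < nevents H)%N by lia.
  by apply: (psi_differentiable_step iN); apply: ih; lia.
move=> t tT ft mt; have /andP[t0t tT'] := tT.
have tTE : t < tF H <= tF H by rewrite tT' lexx.
have pf : \forall y \near x t, (end_cost_state H \o flow t (tF H)) y = psi t y.
  by apply: filterS (cost_to_go_end smoothH stable_x tT ft) => y ->.
apply: near_differentiable pf _; apply: differentiable_comp.
  apply: (flow_differentiable smoothH traj_x stable_x t0t tTE ft).
  by left; rewrite mt -miN.
exact: end_cost_state_differentiable.
Qed.

Lemma adjoint_limits i : (i < nevents H)%N ->
  exists L : 'M[R]_(nc, n + (n + (p + nc))),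
    adjoint H te x t @[t --> (te i)^'+] --> L^T /\
    adjoint H te x t @[t --> (te i)^'-] --> (L *m jump_matrix H te x i)^T.
Proof.
move=> iN; set S := jump_matrix H te x i.
have [C C0 [B B0 [h h0 [Bv Cv]]]] := jac_bound_after iN (fun t tT ft _ => psi_differentiable tT ft).
have [L FL] : exists L : 'M[R]_(nc, n + (n + (p + nc))),
    jac (psi s) (x s) @[s --> (te i)^'+] --> L.
  apply: at_right_cauchy => e e0.
  have eC : 0 < e / C by rewrite divr_gt0.
  exists (Num.min h (e / C)); first by rewrite lt_min h0.
  have cl s s' : te i < s -> s < s' -> s' < te i + Num.min h (e / C) ->
      `|jac (psi s) (x s) - jac (psi s') (x s')| <= e.
    move=> ts ss'; rewrite -ltrBlDl lt_min => /andP[s'h s'e].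
    apply: mx_norm_mulmx => [|v]; first exact: ltW.
    apply: le_trans (Cv s s' ts ss' _ v) _; first by rewrite -ltrBlDl.
    rewrite ler_wpM2r// mulrC -ler_pdivlMr//; apply: ltW; apply: le_lt_trans s'e.
    by rewrite lerB// ltW.
  move=> s s' /andP[ts sh] /andP[ts' s'h].
  have [ss'|s's|->] := ltgtP s s'; first exact: cl.
    by rewrite distrC; apply: cl.
  by rewrite subrr normr0 ltW.
exists L; split; first exact: cvg_trmx FL.
apply: cvg_trmx; apply/cvgrPdist_le => e e0.
have [K K0 SK] := mulmx_bound S.
have e2 : 0 < e / 2 by rewrite divr_gt0.
have e20 : 0 < e / 2 / B by rewrite !divr_gt0.
have [he he0 ev] := flow_event smoothH traj_x no_grazing_x stable_x iN e20.
pose N : R := (n + (n + (p + nc)))%:R * K + 1.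
have N0 : 0 < N by rewrite ltr_wpDl// mulr_ge0// ltW.
have eN : 0 < e / 2 / N by rewrite !divr_gt0.
have /cvgrPdist_le/(_ _ eN)/at_right_radius[hL hL0 FLs] := FL.
have [rb rb0 before] := near_before traj_x iN ltr01.
have [ra ra0 after] := near_after traj_x iN ltr01.
have m0 : 0 < Num.min he rb by rewrite lt_min he0.
apply: (radius_at_left m0) => t /andP[]; rewrite ltrBlDl -ltrBlDr lt_min => /andP[the trb] ti.
have hra : 0 < Num.min h ra by rewrite lt_min h0.
(* [s] is auxiliary: it has to be close enough to the event for [E1] and [E2], and it does not occur
   in the final bound. *)
have [s [is1 she sra shL]] := point_after (te i) he0 hra hL0.
have tI : te i - rb < t < te i by rewrite ti ltrBlDl -ltrBlDr trb.
have [sh sra'] : s < te i + h /\ s < te i + ra.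
  by move: sra; rewrite -ltrBlDl lt_min !ltrBlDl => /andP[].
have sI : te i < s < te i + ra by rewrite is1.
have [tT ft mt _ _] := before t tI; have [sT fs ms _ _] := after s sI.
have /andP[t0t _] := tT; have /andP[_ sT'] := sT.
have tsT : t < s < tF H by rewrite (lt_trans ti).
have fx : flow t s (x t) = x s.
  apply: (flow_nominal smoothH traj_x tT ft); last by right.
  by rewrite !ltW//; case/andP: tsT.
have tI' : te i - he < t < te i by rewrite ti ltrBlDl -ltrBlDr the.
have sI' : te i < s < te i + he by rewrite is1.
have dps : differentiable (psi s) (flow t s (x t)).
  by rewrite fx; exact: psi_differentiable.
have sIh : te i < s < te i + h by rewrite is1.
have Bs : forall v : state, `|jac (psi s) (flow t s (x t)) *m v| <= B * `|v|.
  by rewrite fx; exact: Bv.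
have E1 := jac_comp_approx (ltW e20) (ltW B0) (ev t s tI' sI') dps Bs
  (cost_to_go_flow smoothH traj_x stable_x t0t tsT ft fs) (psi_differentiable tT ft).
rewrite fx -/S in E1.
have sIL : te i < s < te i + hL by rewrite is1.
have E2 := FLs s sIL.
apply: mx_norm_mulmx => [|v]; first exact: ltW.
have := E1 v; rewrite [B * _]mulrC divfK ?lt0r_neq0// => {}E1.
have E3 : `|(L - jac (psi s) (x s)) *m (S *m v)| <= e / 2 * `|v|.
  have D0 := normr_ge0 (L - jac (psi s) (x s)).
  apply: (@le_trans _ _ (e / 2 / N * ((n + (n + (p + nc)))%:R * (K * `|v|)))).
    apply: mx_norm_le => [|a b].
      by rewrite mulr_ge0 ?(ltW eN)// mulr_ge0// mulr_ge0// ltW.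
    rewrite mxE (le_trans (ler_norm_sum _ _ _))//.
    apply: (@le_trans _ _ (\sum_(k < n + (n + (p + nc))) e / 2 / N * (K * `|v|))).
      apply: ler_sum => k _; rewrite normrM ler_pM//.
        exact: le_trans (mx_norm_entry _ _ _) E2.
      exact: le_trans (mx_norm_entry _ _ _) (SK v).
    by rewrite sumr_const card_ord [leRHS]mulrCA [leRHS]mulr_natl.
  rewrite -mulrA ler_wpM2l ?(ltW e2)// [X in _ * X]mulrA mulrA ler_piMl//.
  by rewrite mulrC ler_pdivrMr// mul1r lerDl.
(* The Jacobian at [s], times the jump matrix, is inserted between its limit and the Jacobian at
   [t]; each of the two differences takes half of [e]. *)
rewrite (mulmx_sub_split L S (jac (psi t) (x t)) (jac (psi s) (x s)) v).
rewrite [e in e * _]splitr mulrDl.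
exact: le_trans (ler_normB _ _) (lerD E3 E1).
Qed.

End Assembly.

Theorem theorem1 (R : realType) (n p nc : nat) (H : hybrid_system R n p nc)
    (rho : 'cV[R]_p) (te : nat -> R) (x : R -> @state R n p nc)
    (smoothH : smooth_system H)
    (traj_x : nominal_trajectory H te x rho)
    (no_grazing_x : no_grazing H te x)
    (stable_x : stable_event_sequence H te x)
    (i : nat) (lt_i_nevents : (i < nevents H)%N) :
  (forall t : R, t \in `]t0 H, tF H[ -> event_free H te t ->
     differentiable (cost_to_go_at H te t) (x t)) /\
  exists lambda_minus lambda_plus : 'M[R]_(n + (n + (p + nc)), nc),
    [/\ adjoint H te x t @[t --> (te i)^'-] --> lambda_minus,
        adjoint H te x t @[t --> (te i)^'+] --> lambda_plus &
        lambda_minus = (jump_matrix H te x i)^T *m lambda_plus].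
Proof.
have ht := traj_x.1; split=> [t|].
  by rewrite in_itv; exact: psi_differentiable.
have [L [Lp Lm]] := adjoint_limits smoothH ht no_grazing_x stable_x lt_i_nevents.
by exists (L *m jump_matrix H te x i)^T, L^T; split=> //; rewrite trmx_mul.
Qed.
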